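(* Let $k$ be an algebraically closed field of characteristic $0$, let $p,q$ be prime numbers with $p^4<q$, and let $H$ be a semisimple Hopf algebra over $k$ of dimension $p^2q^2$. If $p$ divides neither $q-1$ nor $q+1$, then $H$ is semisolvable.
   Context: A Hopf algebra is called trivial if it is isomorphic to a group algebra or to the dual of a group algebra (of a finite group). A Hopf subalgebra $A\subseteq H$ of a finite-dimensional Hopf algebra is normal if $h_1AS(h_2)\subseteq A$ and $S(h_1)Ah_2\subseteq A$ for all $h\in H$; $A^+$ denotes the kernel of the counit on $A$. For a Hopf algebra map $\pi:H\to B$ put $H^{co\pi}=\{h\in H: (\mathrm{id}\otimes\pi)\Delta(h)=h\otimes 1\}$ and ${}^{co\pi}H=\{h\in H:(\pi\otimes \mathrm{id})\Delta(h)=1\otimes h\}$; $\pi$ is called normal if $H^{co\pi}={}^{co\pi}H$ (equivalently $H^{co\pi}$ is a Hopf subalgebra of $H$). $H$ is lower semisolvable if there is a chain of Hopf subalgebras $H_{n+1}=k\subseteq H_n\subseteq\cdots\subseteq H_1=H$ with $H_{i+1}$ a normal Hopf subalgebra of $H_i$ for all $i$ and all quotients $H_i/H_iH_{i+1}^+$ trivial. $H$ is upper semisolvable if there is a chain of quotient Hopf algebras $H_{(0)}=H\xrightarrow{\pi_1}H_{(1)}\xrightarrow{\pi_2}\cdots\xrightarrow{\pi_n}H_{(n)}=k$ with each $\pi_i$ normal and all $H_{(i-1)}^{co\pi_i}$ trivial. $H$ is semisolvable if it is upper or lower semisolvable. *)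

(* Defs.v *)
From HB Require Import structures.
From mathcomp Require Import all_boot all_order all_algebra all_fingroup all_field.

Set Implicit Arguments.
Unset Strict Implicit.
Unset Printing Implicit Defensive.

Import GRing.Theory.
Local Open Scope ring_scope.

Reserved Notation "u ⊗ v" (at level 40, left associativity).

Section Tensor.
Variable k : fieldType.
Implicit Types U V W : vectType k.

(* A tensor is the matrix of its coordinates on the products of basis vectors. *)
Definition tens U V := 'M[k]_(\dim {:U}, \dim {:V}).
HB.instance Definition _ U V := Vector.on (tens U V).

Definition tpure U V (u : U) (v : V) : tens U V :=
  \matrix_(i, j) (coord (vbasis {:U}) i u * coord (vbasis {:V}) j v).
Local Notation "u ⊗ v" := (tpure u v).

Definition tlift_fun U V W (f : U -> V -> W) (t : tens U V) : W :=
  \sum_i \sum_j t i j *: f (vbasis {:U})`_i (vbasis {:V})`_j.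

Fact tlift_fun_is_linear U V W (f : U -> V -> W) : linear (tlift_fun f).
Proof.
move=> a s t; rewrite /tlift_fun scaler_sumr -big_split; apply: eq_bigr => i _ /=.
rewrite scaler_sumr -big_split; apply: eq_bigr => j _ /=.
by rewrite !mxE scalerDl scalerA.
Qed.
HB.instance Definition _ U V W (f : U -> V -> W) :=
  GRing.isLinear.Build k (tens U V) W *:%R (tlift_fun f) (tlift_fun_is_linear f).

(* The linear map out of U ⊗ V induced by a map f that is meant to be bilinear. *)
Definition tlift U V W (f : U -> V -> W) : 'Hom(tens U V, W) :=
  linfun (tlift_fun f).

Definition bilin U V W (f : U -> V -> W) :=
  (forall u, linear (f u)) /\ (forall v, linear (f^~ v)).

Lemma lin_sum U V (f : U -> V) (fL : linear f) I r (P : pred I) (c : I -> k) F :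
  f (\sum_(i <- r | P i) c i *: F i) = \sum_(i <- r | P i) c i *: f (F i).
Proof.
pose lf : {linear U -> V} := HB.pack f (GRing.isLinear.Build k U V *:%R f fL).
by rewrite -[f]/(lf : U -> V) linear_sum; apply: eq_bigr => i _; rewrite linearZ.
Qed.

Lemma tliftE U V W (f : U -> V -> W) u v : bilin f -> tlift f (u ⊗ v) = f u v.
Proof.
case=> fL fR; rewrite lfunE /= /tlift_fun.
rewrite {2}(coord_vbasis (memvf u)) (lin_sum (fR _)); apply: eq_bigr => i _ /=.
rewrite {2}(coord_vbasis (memvf v)) (lin_sum (fL _)) scaler_sumr.
by apply: eq_bigr => j _; rewrite mxE scalerA.
Qed.

Lemma tpure_bilin U V : bilin (@tpure U V).
Proof.
by split=> [u|v] a x y; apply/matrixP=> i j; rewrite !mxE linearP /=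
  ?(mulrDr, mulrDl) ?mulrA // [a * _]mulrC.
Qed.

Lemma tens_expand U V (t : tens U V) :
  t = \sum_i \sum_j t i j *: ((vbasis {:U})`_i ⊗ (vbasis {:V})`_j).
Proof.
apply/matrixP=> i j; rewrite summxE (bigD1 i) //= summxE (bigD1 j) //=.
have E i' j' : (t i' j' *: ((vbasis {:U})`_i' ⊗ (vbasis {:V})`_j')) i j
    = t i' j' * ((i' == i)%:R * (j' == j)%:R).
  by rewrite !mxE !coord_free ?(basis_free (vbasisP _)).
rewrite E !eqxx !mulr1 big1 => [|j' /negPf nj]; last by rewrite E nj !mulr0.
rewrite addr0 big1 ?addr0 // => i' /negPf ni.
by rewrite summxE big1 // => j' _; rewrite E ni mul0r mulr0.
Qed.

Lemma tens_ind U V (P : tens U V -> Prop) :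
    (forall u v, P (u ⊗ v)) -> (forall a s t, P s -> P t -> P (a *: s + t)) ->
  forall t, P t.
Proof.
move=> Ppure Plin t; have P0 : P 0.
  by have := Plin (-1) _ _ (Ppure 0 0) (Ppure 0 0); rewrite scaleN1r addNr.
rewrite (tens_expand t); elim/big_rec: _ => // i x _ Px.
by elim/big_rec: _ => [|j y _ Py]; rewrite ?add0r // -addrA; apply: Plin.
Qed.

Definition tmap U V U' V' (f : 'Hom(U, U')) (g : 'Hom(V, V')) :
    'Hom(tens U V, tens U' V') :=
  tlift (fun u v => f u ⊗ g v).

Definition tassoc U V W : 'Hom(tens (tens U V) W, tens U (tens V W)) :=
  tlift (fun t w => tlift (fun u v => u ⊗ (v ⊗ w)) t).

Definition tensv U V (A : {vspace U}) (B : {vspace V}) : {vspace tens U V} :=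
  <<[seq a ⊗ b | a <- vbasis A, b <- vbasis B]>>%VS.
Lemma tpurePl U V a (x y : U) (v : V) : (a *: x + y) ⊗ v = a *: (x ⊗ v) + y ⊗ v.
Proof. exact: (tpure_bilin U V).2. Qed.

Lemma tpurePr U V a (u : U) (x y : V) : u ⊗ (a *: x + y) = a *: (u ⊗ x) + u ⊗ y.
Proof. exact: (tpure_bilin U V).1. Qed.

Lemma scalePl V a (b c : k^o) (v : V) : (a *: b + c) *: v = a *: (b *: v) + c *: v.
Proof. by rewrite scalerDl scalerA. Qed.

Lemma scalePr V a (b : k) (u v : V) : b *: (a *: u + v) = a *: (b *: u) + b *: v.
Proof. by rewrite scalerDr !scalerA mulrC. Qed.

Lemma mulPl (A : algType k) a (x y z : A) : (a *: x + y) * z = a *: (x * z) + y * z.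
Proof. by rewrite mulrDl scalerAl. Qed.

Lemma mulPr (A : algType k) a (x y z : A) : z * (a *: x + y) = a *: (z * x) + z * y.
Proof. by rewrite mulrDr scalerAr. Qed.

Lemma lfunPl U V a (f g : 'Hom(U, V)) x : (a *: f + g) x = a *: f x + g x.
Proof. by rewrite !lfunE /= lfunE. Qed.

Lemma lfun_lin U V (f : 'Hom(U, V)) a x y : f (a *: x + y) = a *: f x + f y.
Proof. exact: linearP. Qed.

Lemma tlift_linf U V W (f f1 f2 : U -> V -> W) a t :
    (forall u v, f u v = a *: f1 u v + f2 u v) ->
  tlift f t = a *: tlift f1 t + tlift f2 t.
Proof.
move=> Ef; rewrite !lfunE /= /tlift_fun scaler_sumr -big_split; apply: eq_bigr => i _.
rewrite scaler_sumr -big_split; apply: eq_bigr => j _ /=.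
by rewrite Ef scalePr.
Qed.
End Tensor.
Notation "u ⊗ v" := (tpure u v) : ring_scope.


Definition linPE := (tpurePl, tpurePr, scalePl, scalePr, mulPl, mulPr, lfunPl, lfun_lin).
Ltac bilin_tac :=
  by split=> [?|?] ? ? ?; rewrite /= ?linPE.

Section TensorMap.
Variable k : fieldType.
Implicit Types U V W : vectType k.

Lemma tmapE U V U' V' (f : 'Hom(U, U')) (g : 'Hom(V, V')) u v :
  tmap f g (u ⊗ v) = f u ⊗ g v.
Proof. by rewrite tliftE //; bilin_tac. Qed.

Lemma tassocE U V W (u : U) (v : V) (w : W) :
  tassoc U V W ((u ⊗ v) ⊗ w) = u ⊗ (v ⊗ w).
Proof.
rewrite tliftE ?tliftE //; first by bilin_tac.
split=> [t|w'] a x y; last by rewrite lfun_lin.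
by apply: tlift_linf => u' v'; rewrite !linPE.
Qed.

Lemma tmap_comp U V U1 V1 U2 V2 (f : 'Hom(U, U1)) (g : 'Hom(V, V1))
    (f' : 'Hom(U1, U2)) (g' : 'Hom(V1, V2)) t :
  tmap f' g' (tmap f g t) = tmap (f' \o f)%VF (g' \o g)%VF t.
Proof.
move: t; apply: tens_ind => [u v|a s t Hs Ht]; first by rewrite !tmapE !lfunE.
by rewrite !lfun_lin Hs Ht.
Qed.

Lemma tmap_id U V t : tmap (\1%VF : 'End(U)) (\1%VF : 'End(V)) t = t.
Proof.
move: t; apply: tens_ind => [u v|a s t Hs Ht]; first by rewrite !tmapE !lfunE.
by rewrite !lfun_lin Hs Ht.
Qed.

Lemma tlift_tmap U V W U' V' W' (h : 'Hom(W, W')) (f : 'Hom(U, U'))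
    (g : 'Hom(V, V')) (b : U -> V -> W) (b' : U' -> V' -> W') t :
    bilin b -> bilin b' -> (forall u v, h (b u v) = b' (f u) (g v)) ->
  h (tlift b t) = tlift b' (tmap f g t).
Proof.
move=> Bb Bb' E; move: t.
apply: tens_ind => [u v|a s t Hs Ht]; first by rewrite tmapE !tliftE.
by rewrite !lfun_lin Hs Ht.
Qed.

Lemma tassoc_tmap U V W U' V' W' (f : 'Hom(U, U')) (g : 'Hom(V, V'))
    (h : 'Hom(W, W')) t :
  tmap f (tmap g h) (tassoc U V W t) = tassoc U' V' W' (tmap (tmap f g) h t).
Proof.
move: t; apply: tens_ind => [t w|a s t Hs Ht]; last by rewrite !lfun_lin Hs Ht.
move: t; apply: tens_ind => [u v|a s t Hs Ht].
  by rewrite tassocE !tmapE tassocE.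
by rewrite !linPE Hs Ht.
Qed.
End TensorMap.

Definition tmul (k : fieldType) (H : falgType k) (s t : tens H H) : tens H H :=
  tlift (fun a b => tlift (fun c d => (a * c) ⊗ (b * d)) t) s.

Section TensorMul.
Variables (k : fieldType) (H : falgType k).

Lemma tmulPl a (s s' t : tens H H) : tmul (a *: s + s') t = a *: tmul s t + tmul s' t.
Proof. exact: linearP. Qed.

Lemma tmulPr a (s t t' : tens H H) : tmul s (a *: t + t') = a *: tmul s t + tmul s t'.
Proof. by apply: tlift_linf => x y; apply: linearP. Qed.

Lemma tmulE (a b c d : H) : tmul (a ⊗ b) (c ⊗ d) = (a * c) ⊗ (b * d).
Proof.
rewrite /tmul tliftE ?tliftE //; first by bilin_tac.
by split=> [a'|b'] e x y /=; apply: tlift_linf => u v; rewrite !linPE.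
Qed.

End TensorMul.

Lemma tmap_tmul (k : fieldType) (H K : falgType k) (f g : 'Hom(H, K)) s t :
    {morph f : x y / x * y} -> {morph g : x y / x * y} ->
  tmap f g (tmul s t) = tmul (tmap f g s) (tmap f g t).
Proof.
move=> fM gM; move: s; apply: tens_ind => [a b|e s s' Hs Hs']; last first.
  by rewrite tmulPl !lfun_lin tmulPl Hs Hs'.
move: t; apply: tens_ind => [c d|e s s' Hs Hs']; last first.
  by rewrite tmulPr !lfun_lin tmulPr Hs Hs'.
by rewrite tmulE !tmapE tmulE fM gM.
Qed.

HB.mixin Record Falgebra_isHopf (k : fieldType) H of Falgebra k H := {
  comul : 'Hom(H, tens H H);
  counit : 'Hom(H, k^o);
  antipode : 'Hom(H, H);
  comulA : forall x : H,
    tassoc H H H (tmap comul \1%VF (comul x)) = tmap \1%VF comul (comul x);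
  counitl : forall x : H, tlift (fun a b => counit a *: b) (comul x) = x;
  counitr : forall x : H, tlift (fun a b => counit b *: a) (comul x) = x;
  comul1 : comul 1 = 1 ⊗ 1;
  comulM : forall x y : H, comul (x * y) = tmul (comul x) (comul y);
  counit1 : counit 1 = 1;
  counitM : forall x y : H, counit (x * y) = counit x * counit y;
  antipodel : forall x : H,
    tlift (fun a b => antipode a * b) (comul x) = counit x *: 1;
  antipoder : forall x : H,
    tlift (fun a b => a * antipode b) (comul x) = counit x *: 1
}.

#[short(type="hopfAlgType")]
HB.structure Definition HopfAlgebra (k : fieldType) :=
  { H of Falgebra k H & Falgebra_isHopf k H }.

Section SubHopf.
Variables (k : fieldType) (H : hopfAlgType k).

Definition hopf_subalgebra (A : {vspace H}) :=
  [&& 1 \in A, (A * A <= A)%VS, (comul @: A <= tensv A A)%VS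
    & (antipode @: A <= A)%VS].

(* A Hopf subalgebra as a Hopf algebra in its own right. *)
Definition sub_hopf (A : {vspace H}) of hopf_subalgebra A := subvs_of A.

Variables (A : {vspace H}) (hA : hopf_subalgebra A).
Local Notation B := (sub_hopf hA).
HB.instance Definition _ := Vector.on B.

Fact sub_hopf_one_subproof : 1 \in A. Proof. by case/and4P: hA. Qed.
Fact sub_hopf_mul_subproof (x y : B) : vsval x * vsval y \in A.
Proof. by case/and4P: hA => _ sM _ _; apply: subvP sM _ (memv_mul _ _); apply: subvsP. Qed.

Definition sub_hopf_one : B := Subvs sub_hopf_one_subproof.
Definition sub_hopf_mul x y : B := Subvs (sub_hopf_mul_subproof x y).

Fact sub_hopf_mulA : associative sub_hopf_mul.
Proof. by move=> x y z; apply/val_inj/mulrA. Qed.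
Fact sub_hopf_mul1 : left_id sub_hopf_one sub_hopf_mul.
Proof. by move=> x; apply/val_inj/mul1r. Qed.
Fact sub_hopf_mulr1 : right_id sub_hopf_one sub_hopf_mul.
Proof. by move=> x; apply/val_inj/mulr1. Qed.
Fact sub_hopf_mulDl : left_distributive sub_hopf_mul +%R.
Proof. by move=> x y z; apply/val_inj/mulrDl. Qed.
Fact sub_hopf_mulDr : right_distributive sub_hopf_mul +%R.
Proof. by move=> x y z; apply/val_inj/mulrDr. Qed.
Fact sub_hopf_one_neq0 : sub_hopf_one != 0.
Proof. by rewrite -val_eqE oner_neq0. Qed.
HB.instance Definition _ := GRing.Zmodule_isNzRing.Build B sub_hopf_mulA
  sub_hopf_mul1 sub_hopf_mulr1 sub_hopf_mulDl sub_hopf_mulDr sub_hopf_one_neq0.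
Fact sub_hopf_scaleAl (a : k) (x y : B) : a *: (x * y) = a *: x * y.
Proof. exact/val_inj/scalerAl. Qed.
HB.instance Definition _ := GRing.Lmodule_isLalgebra.Build k B sub_hopf_scaleAl.
Fact sub_hopf_scaleAr (a : k) (x y : B) : a *: (x * y) = x * (a *: y).
Proof. exact/val_inj/scalerAr. Qed.
HB.instance Definition _ := GRing.Lalgebra_isAlgebra.Build k B sub_hopf_scaleAr.
HB.instance Definition _ := Algebra_isFalgebra.Build k B.

Definition sub_incl : 'Hom(B, H) := linfun (vsval : subvs_of A -> H).
Definition sub_proj : 'Hom(H, B) := linfun (vsproj A : H -> subvs_of A).
Local Notation i := sub_incl.
Local Notation p := sub_proj.

Definition sub_comul : 'Hom(B, tens B B) :=
  (tmap p p \o comul \o i)%VF.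
Definition sub_counit : 'Hom(B, k^o) := (counit \o i)%VF.
Definition sub_antipode : 'Hom(B, B) := (p \o antipode \o i)%VF.

Lemma sub_inclE x : i x = vsval x. Proof. exact: lfunE. Qed.
Lemma sub_inclK : (p \o i)%VF = \1%VF.
Proof. by apply/lfunP=> x; rewrite !lfunE /= sub_inclE lfunE /= vsvalK. Qed.
Lemma sub_incl_inj : injective i.
Proof. by move=> x y; rewrite !sub_inclE; apply: val_inj. Qed.
Lemma sub_incl1 : i 1 = 1. Proof. exact: sub_inclE. Qed.
Lemma sub_inclM : {morph i : x y / x * y}.
Proof. by move=> x y; rewrite !sub_inclE. Qed.

Lemma sub_tincl_inj : injective (tmap i i).
Proof. by apply: (can_inj (g := tmap p p)) => t; rewrite tmap_comp sub_inclK tmap_id. Qed.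

Lemma sub_tincl3_inj : injective (tmap i (tmap i i)).
Proof.
apply: (can_inj (g := tmap p (tmap p p))) => t; rewrite tmap_comp sub_inclK.
rewrite -[RHS]tmap_id; congr (tmap _ _ _); apply/lfunP=> s.
by rewrite comp_lfunE tmap_comp sub_inclK tmap_id lfunE.
Qed.

Lemma sub_comulE x : tmap i i (sub_comul x) = comul (i x).
Proof.
rewrite /sub_comul !comp_lfunE tmap_comp.
have: comul (i x) \in tensv A A.
  case/and4P: hA => _ _ sC _; apply: (subvP sC); apply: memv_img.
  by rewrite sub_inclE subvsP.
move: (comul _) => t.
suff /subvP s : (tensv A A <= lker (tmap (i \o p)%VF (i \o p)%VF - \1%VF))%VS.
  move=> /s; rewrite memv_ker add_lfunE opp_lfunE id_lfunE subr_eq0; exact: eqP.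
apply/span_subvP=> _ /allpairsP[[a b] /= [/vbasis_mem Aa /vbasis_mem Ab ->]].
rewrite memv_ker add_lfunE opp_lfunE id_lfunE tmapE !comp_lfunE ![i _]sub_inclE ![p _]lfunE /=.
by rewrite !vsprojK ?subrr.
Qed.

Lemma sub_antipodeE x : i (sub_antipode x) = antipode (i x).
Proof.
rewrite /sub_antipode !comp_lfunE [LHS]sub_inclE [p _]lfunE /= vsprojK //.
case/and4P: hA => _ _ _ sS; apply: (subvP sS); apply: memv_img.
by rewrite sub_inclE subvsP.
Qed.

Fact sub_comulA x : tassoc _ _ _ (tmap sub_comul \1%VF (sub_comul x))
  = tmap \1%VF sub_comul (sub_comul x).
Proof.
have Ei : (tmap i i \o sub_comul = comul \o i)%VF.
 by apply/lfunP=> y; rewrite [LHS]comp_lfunE [RHS]comp_lfunE [LHS]sub_comulE.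
have E1 : (i \o \1 = \1 \o i)%VF by rewrite comp_lfun1r comp_lfun1l.
apply: sub_tincl3_inj; rewrite tassoc_tmap !tmap_comp Ei E1.
by rewrite -!tmap_comp sub_comulE comulA.
Qed.

Fact sub_counitl x : tlift (fun a b => sub_counit a *: b) (sub_comul x) = x.
Proof.
apply: sub_incl_inj; rewrite -[RHS]counitl -sub_comulE.
apply: tlift_tmap => [||a b]; [bilin_tac|bilin_tac|].
by rewrite linearZ /= /sub_counit comp_lfunE.
Qed.

Fact sub_counitr x : tlift (fun a b => sub_counit b *: a) (sub_comul x) = x.
Proof.
apply: sub_incl_inj; rewrite -[RHS]counitr -sub_comulE.
apply: tlift_tmap => [||a b]; [bilin_tac|bilin_tac|].
by rewrite linearZ /= /sub_counit comp_lfunE.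
Qed.

Fact sub_comul1 : sub_comul 1 = 1 ⊗ 1.
Proof. by apply: sub_tincl_inj; rewrite sub_comulE tmapE sub_incl1 comul1. Qed.

Fact sub_comulM x y : sub_comul (x * y) = tmul (sub_comul x) (sub_comul y).
Proof.
apply: sub_tincl_inj; rewrite tmap_tmul ?sub_comulE ?sub_inclM ?comulM //;
  exact: sub_inclM.
Qed.

Fact sub_counit1 : sub_counit 1 = 1.
Proof. by rewrite /sub_counit comp_lfunE sub_incl1 counit1. Qed.

Fact sub_counitM x y : sub_counit (x * y) = sub_counit x * sub_counit y.
Proof. by rewrite /sub_counit !comp_lfunE sub_inclM counitM. Qed.

Fact sub_antipodel x :
  tlift (fun a b => sub_antipode a * b) (sub_comul x) = sub_counit x *: 1.
Proof.
apply: sub_incl_inj; rewrite linearZ /= sub_incl1 [sub_counit x]comp_lfunE -antipodel -sub_comulE.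
apply: tlift_tmap => [||a b]; [bilin_tac|bilin_tac|].
by rewrite sub_inclM sub_antipodeE.
Qed.

Fact sub_antipoder x :
  tlift (fun a b => a * sub_antipode b) (sub_comul x) = sub_counit x *: 1.
Proof.
apply: sub_incl_inj; rewrite linearZ /= sub_incl1 [sub_counit x]comp_lfunE -antipoder -sub_comulE.
apply: tlift_tmap => [||a b]; [bilin_tac|bilin_tac|].
by rewrite sub_inclM sub_antipodeE.
Qed.

HB.instance Definition _ := Falgebra_isHopf.Build k B
  sub_comulA sub_counitl sub_counitr sub_comul1 sub_comulM sub_counit1 sub_counitM
  sub_antipodel sub_antipoder.
End SubHopf.

Section GroupAlgebra.
Variables (k : fieldType) (gT : finGroupType).

Definition group_algebra := {ffun gT -> k^o}.
Local Notation G := group_algebra.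
HB.instance Definition _ := Vector.on G.

Definition gelt (g : gT) : G := [ffun h => (h == g)%:R].
Definition gmul (x y : G) : G := [ffun g => \sum_h x h * y (h^-1 * g)%g].

Lemma gexpand (x : G) : x = \sum_g x g *: gelt g.
Proof.
apply/ffunP=> h; rewrite sum_ffunE (bigD1 h) //= !ffunE eqxx big1 => [|g ng].
  by rewrite addr0 /GRing.scale /= mulr1.
by rewrite !ffunE eq_sym (negPf ng) /GRing.scale /= mulr0.
Qed.

Lemma group_algebra_ind (P : G -> Prop) :
    (forall g, P (gelt g)) -> (forall a x y, P x -> P y -> P (a *: x + y)) ->
  forall x, P x.
Proof.
move=> Pg Plin x; have P0 : P 0.
  by have := Plin (-1) _ _ (Pg 1%g) (Pg 1%g); rewrite scaleN1r addNr.
by rewrite (gexpand x); elim/big_rec: _ => // g y _; apply: Plin.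
Qed.

Fact gmulA : associative gmul.
Proof.
move=> x y z; apply/ffunP=> g; rewrite !ffunE.
under eq_bigr do rewrite ffunE mulr_sumr.
under [RHS]eq_bigr do rewrite ffunE mulr_suml.
rewrite [RHS]exchange_big; apply: eq_bigr => h _ /=.
rewrite [RHS](reindex_inj (mulgI h)); apply: eq_bigr => l _ /=.
by rewrite mulKg invMg !mulgA mulrA.
Qed.

Fact gmul1 : left_id (gelt 1) gmul.
Proof.
move=> x; apply/ffunP=> g; rewrite ffunE (bigD1 1%g) //= !ffunE eqxx mul1r.
rewrite invg1 mul1g big1 ?addr0 // => h /negPf nh.
by rewrite ffunE nh mul0r.
Qed.

Fact gmulr1 : right_id (gelt 1) gmul.
Proof.
move=> x; apply/ffunP=> g; rewrite ffunE (bigD1 g) //= !ffunE mulVg eqxx mulr1.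
rewrite big1 ?addr0 // => h nh.
by rewrite ffunE -eq_mulVg1 (negPf nh) mulr0.
Qed.

Fact gmulDl : left_distributive gmul +%R.
Proof.
move=> x y z; apply/ffunP=> g; rewrite !ffunE -big_split; apply: eq_bigr => h _.
by rewrite ffunE mulrDl.
Qed.

Fact gmulDr : right_distributive gmul +%R.
Proof.
move=> x y z; apply/ffunP=> g; rewrite !ffunE -big_split; apply: eq_bigr => h _.
by rewrite ffunE mulrDr.
Qed.

Fact gelt1_neq0 : gelt 1 != 0.
Proof. by apply/eqP=> /ffunP/(_ 1%g)/eqP; rewrite !ffunE eqxx oner_eq0. Qed.

HB.instance Definition _ := GRing.Zmodule_isNzRing.Build G
  gmulA gmul1 gmulr1 gmulDl gmulDr gelt1_neq0.

Fact gscaleAl (a : k) (x y : G) : a *: (x * y) = a *: x * y.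
Proof.
apply/ffunP=> g; rewrite !ffunE /GRing.scale /= mulr_sumr; apply: eq_bigr => h _.
by rewrite ffunE mulrA.
Qed.
HB.instance Definition _ := GRing.Lmodule_isLalgebra.Build k G gscaleAl.

Fact gscaleAr (a : k) (x y : G) : a *: (x * y) = x * (a *: y).
Proof.
apply/ffunP=> g; rewrite !ffunE /GRing.scale /= mulr_sumr; apply: eq_bigr => h _.
by rewrite ffunE mulrCA.
Qed.
HB.instance Definition _ := GRing.Lalgebra_isAlgebra.Build k G gscaleAr.
HB.instance Definition _ := Algebra_isFalgebra.Build k G.

Lemma geltM g h : gelt g * gelt h = gelt (g * h).
Proof.
apply/ffunP=> l; rewrite ffunE (bigD1 g) //= !ffunE eqxx mul1r.
rewrite big1 => [|m /negPf nm]; last by rewrite ffunE nm mul0r.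
by rewrite addr0 -(inj_eq (mulgI g)) mulKVg.
Qed.

(* The linear extension of a map defined on the basis of group elements. *)
Definition gext_fun (V : vectType k) (f : gT -> V) (x : G) : V := \sum_g x g *: f g.
Fact gext_fun_is_linear (V : vectType k) (f : gT -> V) : linear (gext_fun f).
Proof.
move=> a x y; rewrite /gext_fun scaler_sumr -big_split; apply: eq_bigr => g _ /=.
by rewrite !ffunE scalerDl scalerA.
Qed.
HB.instance Definition _ (V : vectType k) (f : gT -> V) :=
  GRing.isLinear.Build k G V *:%R (gext_fun f) (gext_fun_is_linear f).
Definition gext (V : vectType k) (f : gT -> V) : 'Hom(G, V) := linfun (gext_fun f).

Lemma gextE (V : vectType k) (f : gT -> V) g : gext f (gelt g) = f g.
Proof.
rewrite lfunE /= /gext_fun (bigD1 g) //= ffunE eqxx scale1r big1 ?addr0 // => h.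
by move/negPf=> nh; rewrite ffunE nh scale0r.
Qed.

Definition gcomul : 'Hom(G, tens G G) := gext (fun g => gelt g ⊗ gelt g).
Definition gcounit : 'Hom(G, k^o) := gext (fun => 1).
Definition gantipode : 'Hom(G, G) := gext (fun g => gelt g^-1).

Fact gcomulA x : tassoc _ _ _ (tmap gcomul \1%VF (gcomul x))
  = tmap \1%VF gcomul (gcomul x).
Proof.
move: x; apply: group_algebra_ind => [g|a x y Hx Hy].
  by rewrite gextE !tmapE !id_lfunE gextE tassocE.
by rewrite !linPE Hx Hy.
Qed.

Fact gcounitl x : tlift (fun a b => gcounit a *: b) (gcomul x) = x.
Proof.
move: x; apply: group_algebra_ind => [g|a x y Hx Hy]; last by rewrite !lfun_lin Hx Hy.
by rewrite gextE tliftE ?gextE ?scale1r //; bilin_tac.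
Qed.

Fact gcounitr x : tlift (fun a b => gcounit b *: a) (gcomul x) = x.
Proof.
move: x; apply: group_algebra_ind => [g|a x y Hx Hy]; last by rewrite !lfun_lin Hx Hy.
by rewrite gextE tliftE ?gextE ?scale1r //; bilin_tac.
Qed.

Fact gcomul1 : gcomul 1 = 1 ⊗ 1. Proof. exact: gextE. Qed.

Fact gcomulM x y : gcomul (x * y) = tmul (gcomul x) (gcomul y).
Proof.
move: x; apply: group_algebra_ind => [g|a x x' Hx Hx']; last first.
  by rewrite mulPl !lfun_lin tmulPl Hx Hx'.
move: y; apply: group_algebra_ind => [h|a x x' Hx Hx']; last first.
  by rewrite mulPr !lfun_lin tmulPr Hx Hx'.
by rewrite geltM !gextE tmulE geltM.
Qed.

Fact gcounit1 : gcounit 1 = 1. Proof. exact: gextE. Qed.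

Fact gcounitM x y : gcounit (x * y) = gcounit x * gcounit y.
Proof.
move: x; apply: group_algebra_ind => [g|a x x' Hx Hx']; last first.
  by rewrite mulPl !lfun_lin mulPl Hx Hx'.
move: y; apply: group_algebra_ind => [h|a x x' Hx Hx']; last first.
  by rewrite mulPr !lfun_lin mulPr Hx Hx'.
by rewrite geltM !gextE mulr1.
Qed.

Fact gantipodel x : tlift (fun a b => gantipode a * b) (gcomul x) = gcounit x *: 1.
Proof.
move: x; apply: group_algebra_ind => [g|a x y Hx Hy]; last first.
  by rewrite !lfun_lin Hx Hy scalePl.
rewrite !gextE tliftE ?gextE; last by bilin_tac.
by rewrite geltM mulVg scale1r.
Qed.

Fact gantipoder x : tlift (fun a b => a * gantipode b) (gcomul x) = gcounit x *: 1.
Proof.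
move: x; apply: group_algebra_ind => [g|a x y Hx Hy]; last first.
  by rewrite !lfun_lin Hx Hy scalePl.
rewrite !gextE tliftE ?gextE; last by bilin_tac.
by rewrite geltM mulgV scale1r.
Qed.

HB.instance Definition _ := Falgebra_isHopf.Build k G
  gcomulA gcounitl gcounitr gcomul1 gcomulM gcounit1 gcounitM
  gantipodel gantipoder.
End GroupAlgebra.

Section Contraction.
Variable k : fieldType.
Implicit Types U V W : vectType k.

Lemma eq_tlift U V W (f g : U -> V -> W) t : f =2 g -> tlift f t = tlift g t.
Proof.
move=> E; rewrite !lfunE; apply: eq_bigr => i _.
by apply: eq_bigr => j _; rewrite E.
Qed.

Lemma lfun_tlift U V W W' (h : 'Hom(W, W')) (f : U -> V -> W) t :
  h (tlift f t) = tlift (fun u v => h (f u v)) t.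
Proof.
rewrite !lfunE /= linear_sum; apply: eq_bigr => i _.
by rewrite linear_sum; apply: eq_bigr => j _; rewrite linearZ.
Qed.

Lemma tliftZ U V W c (f : U -> V -> W) t :
  tlift (fun u v => c *: f u v) t = c *: tlift f t.
Proof.
have := lfun_tlift (c *: \1%VF) f t; rewrite scale_lfunE id_lfunE => ->.
by apply: eq_tlift => u v; rewrite scale_lfunE id_lfunE.
Qed.

Definition tpair U V (f : 'Hom(U, k^o)) (g : 'Hom(V, k^o)) : 'Hom(tens U V, k^o) :=
  tlift (fun u v => f u * g v).

Lemma tpairE U V (f : 'Hom(U, k^o)) (g : 'Hom(V, k^o)) u v :
  tpair f g (u ⊗ v) = f u * g v.
Proof. by rewrite tliftE //; bilin_tac. Qed.

Lemma tpair_bilin U V : bilin (@tpair U V).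
Proof.
split=> [f|g] a x y; apply/lfunP; apply: tens_ind => [u v|b s t Hs Ht].
- by rewrite lfunPl !tpairE !linPE.
- by rewrite !lfun_lin Hs Ht.
- by rewrite lfunPl !tpairE !linPE.
- by rewrite !lfun_lin Hs Ht.
Qed.

Definition vcoord V (i : 'I_(\dim {:V})) : 'Hom(V, k^o) :=
  linfun (coord (vbasis {:V}) i : V -> k^o).

Lemma vcoordE V i (v : V) : vcoord i v = coord (vbasis {:V}) i v.
Proof. exact: lfunE. Qed.

Lemma tpair_sep U V I J (f : I -> 'Hom(U, k^o)) (g : J -> 'Hom(V, k^o)) :
    (forall u, (forall i, f i u = 0) -> u = 0) ->
    (forall v, (forall j, g j v = 0) -> v = 0) ->
  forall t, (forall i j, tpair (f i) (g j) t = 0) -> t = 0.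
Proof.
move=> fS gS t t0.
pose cr j : 'Hom(tens U V, U) := tlift (fun u v => g j v *: u).
pose cl (c : 'Hom(U, k^o)) : 'Hom(tens U V, V) := tlift (fun u v => c u *: v).
have crE (c : 'Hom(U, k^o)) j s : c (cr j s) = tpair c (g j) s.
  move: s; apply: tens_ind => [u v|a s s' Hs Hs']; last by rewrite !lfun_lin Hs Hs'.
  rewrite tpairE /cr tliftE; last by bilin_tac.
  by rewrite linearZ [RHS]mulrC.
have clE c j s : g j (cl c s) = tpair c (g j) s.
  move: s; apply: tens_ind => [u v|a s s' Hs Hs']; last by rewrite !lfun_lin Hs Hs'.
  rewrite tpairE /cl tliftE; last by bilin_tac.
  by rewrite linearZ.
have cl0 c : cl c t = 0.
  by apply: gS => j; rewrite clE -crE (fS (cr j t)) ?linear0 // => i; rewrite crE.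
have tE i j (s : tens U V) : s i j = coord (vbasis {:V}) j (cl (vcoord i) s).
  move: s; apply: tens_ind => [u v|a s s' Hs Hs'].
    rewrite /cl tliftE; last by bilin_tac.
    by rewrite linearZ /= mxE vcoordE.
  by rewrite lfun_lin [RHS]linearP /= -Hs -Hs' !mxE.
by apply/matrixP=> i j; rewrite tE cl0 linear0 mxE.
Qed.

Lemma tpair_tassoc U V W (f : 'Hom(U, k^o)) (g : 'Hom(V, k^o)) (h : 'Hom(W, k^o)) t :
  tpair f (tpair g h) (tassoc U V W t) = tpair (tpair f g) h t.
Proof.
move: t; apply: tens_ind => [t w|a s t Hs Ht]; last by rewrite !lfun_lin Hs Ht.
move: t; apply: tens_ind => [u v|a s t Hs Ht].
  by rewrite tassocE !tpairE mulrA.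
by rewrite !linPE Hs Ht.
Qed.

Lemma tpair_tmap U V U' V' (f : 'Hom(U', k^o)) (g : 'Hom(V', k^o)) (a : 'Hom(U, U'))
    (b : 'Hom(V, V')) t :
  tpair f g (tmap a b t) = tpair (f \o a)%VF (g \o b)%VF t.
Proof.
move: t; apply: tens_ind => [u v|c s t Hs Ht]; last by rewrite !lfun_lin Hs Ht.
by rewrite tmapE !tpairE !comp_lfunE.
Qed.
End Contraction.

Section Dual.
Variables (k : fieldType) (H : hopfAlgType k).

Definition dual_hopf := 'Hom(H, k^o).
Local Notation D := dual_hopf.
HB.instance Definition _ := Vector.on D.

Definition dmul (f g : D) : D := (tpair f g \o comul)%VF.

Lemma dmulE f g x : dmul f g x = tpair f g (comul x).
Proof. exact: comp_lfunE. Qed.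

Fact dmulA : associative dmul.
Proof.
move=> f g h; apply/lfunP=> x; rewrite !dmulE /dmul.
rewrite -[f in LHS]comp_lfun1r -[h in RHS]comp_lfun1r -!tpair_tmap.
by rewrite -comulA tpair_tassoc.
Qed.

Fact dmul1 : left_id (counit : D) dmul.
Proof.
move=> f; apply/lfunP=> x; rewrite dmulE -[in RHS](counitl x) lfun_tlift.
by apply: eq_tlift => a b; rewrite linearZ.
Qed.

Fact dmulr1 : right_id (counit : D) dmul.
Proof.
move=> f; apply/lfunP=> x; rewrite dmulE -[in RHS](counitr x) lfun_tlift.
by apply: eq_tlift => a b; rewrite linearZ /= mulrC.
Qed.

Fact dmulPl a (f f' g : D) : dmul (a *: f + f') g = a *: dmul f g + dmul f' g.
Proof. by apply/lfunP=> x; rewrite lfunPl !dmulE (tpair_bilin _ _).2 lfunPl. Qed.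

Fact dmulPr a (f g g' : D) : dmul f (a *: g + g') = a *: dmul f g + dmul f g'.
Proof. by apply/lfunP=> x; rewrite lfunPl !dmulE (tpair_bilin _ _).1 lfunPl. Qed.

Fact dmulDl : left_distributive dmul +%R.
Proof. by move=> f f' g; have := dmulPl 1 f f' g; rewrite !scale1r. Qed.

Fact dmulDr : right_distributive dmul +%R.
Proof. by move=> f g g'; have := dmulPr 1 f g g'; rewrite !scale1r. Qed.

Fact dcounit_neq0 : (counit : D) != 0.
Proof.
apply/eqP=> /lfunP/(_ 1)/eqP.
by rewrite counit1 lfunE /= oner_eq0.
Qed.

HB.instance Definition _ := GRing.Zmodule_isNzRing.Build D
  dmulA dmul1 dmulr1 dmulDl dmulDr dcounit_neq0.

Fact dscaleAl (a : k) (f g : D) : a *: (f * g) = a *: f * g.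
Proof.
have := dmulPl a f 0 g.
by rewrite addr0 -[dmul 0 g]/(0 * g) mul0r addr0; apply: esym.
Qed.
HB.instance Definition _ := GRing.Lmodule_isLalgebra.Build k D dscaleAl.

Fact dscaleAr (a : k) (f g : D) : a *: (f * g) = f * (a *: g).
Proof.
have := dmulPr a f g 0.
by rewrite addr0 -[dmul f 0]/(f * 0) mulr0 addr0; apply: esym.
Qed.
HB.instance Definition _ := GRing.Lalgebra_isAlgebra.Build k D dscaleAr.
HB.instance Definition _ := Algebra_isFalgebra.Build k D.

Definition dev_fun (x : H) (f : D) : k^o := f x.
Fact dev_fun_is_linear x : linear (dev_fun x).
Proof. by move=> a f g; rewrite /dev_fun lfunPl. Qed.
HB.instance Definition _ x :=
  GRing.isLinear.Build k D k^o *:%R (dev_fun x) (dev_fun_is_linear x).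
Definition dev x : 'Hom(D, k^o) := linfun (dev_fun x).
Lemma devE x f : dev x f = f x. Proof. exact: lfunE. Qed.

(* The transpose of the multiplication, under D ⊗ D = (H ⊗ H)^*. *)
Definition dcomul_fun (f : D) : tens D D :=
  \sum_(i < \dim {:H}) \sum_(j < \dim {:H}) f ((vbasis {:H})`_i * (vbasis {:H})`_j) *:
    tpure (U := D) (V := D) (vcoord i) (vcoord j).
Fact dcomul_fun_is_linear : linear dcomul_fun.
Proof.
move=> a f g; rewrite /dcomul_fun scaler_sumr -big_split; apply: eq_bigr => i _ /=.
rewrite scaler_sumr -big_split; apply: eq_bigr => j _ /=.
by rewrite lfunPl scalePl.
Qed.
HB.instance Definition _ :=
  GRing.isLinear.Build k D (tens D D) *:%R dcomul_fun dcomul_fun_is_linear.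
Definition dcomul : 'Hom(D, tens D D) := linfun dcomul_fun.

Fact dantipode_is_linear : linear (fun f : D => (f \o antipode)%VF : D).
Proof. by move=> a f g; apply/lfunP=> x; rewrite lfunPl !comp_lfunE lfunPl. Qed.
Definition dantipode_fun (f : D) : D := (f \o antipode)%VF.
HB.instance Definition _ :=
  GRing.isLinear.Build k D D *:%R dantipode_fun dantipode_is_linear.
Definition dantipode : 'Hom(D, D) := linfun dantipode_fun.
Definition dcounit : 'Hom(D, k^o) := dev 1.

Lemma dcomulE f x y : tpair (dev x) (dev y) (dcomul f) = f (x * y).
Proof.
rewrite [dcomul f]lfunE /= /dcomul_fun.
rewrite {2}(coord_vbasis (memvf x)) {2}(coord_vbasis (memvf y)).
rewrite mulr_suml !linear_sum; apply: eq_bigr => i _.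
rewrite mulr_sumr !linear_sum; apply: eq_bigr => j _.
rewrite linearZ /= tpairE !devE !vcoordE -scalerAl -scalerAr !linearZ /=.
by rewrite /GRing.scale /=; congr (_ * _); apply: mulrC.
Qed.

Lemma dsep1 (f : D) : (forall x, dev x f = 0) -> f = 0.
Proof. by move=> f0; apply/lfunP=> x; rewrite lfunE -devE f0. Qed.

Lemma dsep2 (t : tens D D) : (forall x y, tpair (dev x) (dev y) t = 0) -> t = 0.
Proof. exact: tpair_sep dsep1 dsep1 t. Qed.

Lemma dsep3 (t : tens D (tens D D)) :
  (forall x y z, tpair (dev x) (tpair (dev y) (dev z)) t = 0) -> t = 0.
Proof.
move=> t0; apply: (@tpair_sep _ _ _ _ (H * H)%type dev
  (fun p => tpair (dev p.1) (dev p.2)) dsep1) => [s s0|x p]; last exact: t0.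
by apply: dsep2 => y z; apply: (s0 (y, z)).
Qed.

Lemma dext2 (s t : tens D D) :
  (forall x y, tpair (dev x) (dev y) s = tpair (dev x) (dev y) t) -> s = t.
Proof.
by move=> E; apply/eqP; rewrite -subr_eq0; apply/eqP/dsep2 => x y; rewrite linearB /= E subrr.
Qed.

Lemma dev_dcomul x y : (tpair (dev x) (dev y) \o dcomul)%VF = dev (x * y).
Proof. by apply/lfunP=> f; rewrite comp_lfunE dcomulE devE. Qed.

Fact dcomulA f : tassoc _ _ _ (tmap dcomul \1%VF (dcomul f))
  = tmap \1%VF dcomul (dcomul f).
Proof.
apply/eqP; rewrite -subr_eq0; apply/eqP/dsep3 => x y z.
rewrite linearB /= tpair_tassoc !tpair_tmap !dev_dcomul !comp_lfun1r.
by rewrite !dcomulE mulrA subrr.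
Qed.

Fact dcounitl f : tlift (fun a b => dcounit a *: b) (dcomul f) = f.
Proof.
apply/lfunP=> x; rewrite -devE lfun_tlift -[in RHS](mul1r x) -dcomulE.
by apply: eq_tlift => a b; rewrite linearZ.
Qed.

Fact dcounitr f : tlift (fun a b => dcounit b *: a) (dcomul f) = f.
Proof.
apply/lfunP=> x; rewrite -devE lfun_tlift -[in RHS](mulr1 x) -dcomulE.
by apply: eq_tlift => a b; rewrite linearZ /= mulrC.
Qed.

Fact dcomul1 : dcomul 1 = 1 ⊗ 1.
Proof. by apply: dext2 => x y; rewrite dcomulE tpairE !devE counitM. Qed.

Lemma dev_tmul x y s t : tpair (dev x) (dev y) (tmul s t) =
  tlift (fun x1 x2 => tlift (fun y1 y2 =>
    tpair (dev x1) (dev y1) s * tpair (dev x2) (dev y2) t : k^o) (comul y)) (comul x).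
Proof.
move: s; apply: tens_ind => [a b|e s s' Hs Hs']; last first.
  rewrite tmulPl lfun_lin Hs Hs'; symmetry; apply: tlift_linf => x1 x2.
  by apply: tlift_linf => y1 y2; rewrite lfun_lin mulPl.
move: t; apply: tens_ind => [c d|e s s' Hs Hs']; last first.
  rewrite tmulPr lfun_lin Hs Hs'; symmetry; apply: tlift_linf => x1 x2.
  by apply: tlift_linf => y1 y2; rewrite lfun_lin mulPr.
rewrite tmulE tpairE !devE !dmulE /= [LHS]mulrC.
have Z (e : k) (h : H -> H -> k^o) r :
    e * tlift h r = tlift (fun u v => e * h u v : k^o) r.
  exact: (esym (tliftZ e h r)).
rewrite {1}/tpair Z; apply: eq_tlift => x1 x2; rewrite [LHS]mulrC {1}/tpair Z.
by apply: eq_tlift => y1 y2; rewrite !tpairE !devE; apply: mulrACA.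
Qed.

Fact dcomulM f g : dcomul (f * g) = tmul (dcomul f) (dcomul g).
Proof.
apply: dext2 => x y; rewrite dcomulE [LHS]dmulE comulM dev_tmul !lfun_tlift.
apply: eq_tlift => x1 x2; rewrite lfun_tlift; apply: eq_tlift => y1 y2.
by rewrite tpairE !dcomulE.
Qed.

Fact dcounit1 : dcounit 1 = 1.
Proof. by rewrite devE counit1. Qed.

Fact dcounitM f g : dcounit (f * g) = dcounit f * dcounit g.
Proof. by rewrite !devE [LHS]dmulE comul1 tpairE. Qed.

Lemma dantipodeE f x : dantipode f x = f (antipode x).
Proof. by rewrite [dantipode f]lfunE /= comp_lfunE. Qed.

Fact dantipodel f : tlift (fun a b => dantipode a * b) (dcomul f) = dcounit f *: 1.
Proof.
have E x t : dev x (tlift (fun a b => dantipode a * b) t) =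
    tlift (fun y z => tpair (dev (antipode y)) (dev z) t) (comul x).
  move: t; apply: tens_ind => [a b|e s s' Hs Hs']; last first.
    by rewrite !lfun_lin Hs Hs'; symmetry; apply: tlift_linf => y z; rewrite lfun_lin.
  rewrite tliftE; last by bilin_tac.
  rewrite devE [LHS]dmulE; apply: eq_tlift => y z.
  by rewrite tpairE dantipodeE !devE.
apply/lfunP=> x; rewrite -devE E.
under eq_tlift do rewrite dcomulE.
by rewrite -lfun_tlift antipodel linearZ /= scale_lfunE devE /GRing.scale /= mulrC.
Qed.

Fact dantipoder f : tlift (fun a b => a * dantipode b) (dcomul f) = dcounit f *: 1.
Proof.
have E x t : dev x (tlift (fun a b => a * dantipode b) t) =
    tlift (fun y z => tpair (dev y) (dev (antipode z)) t) (comul x).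
  move: t; apply: tens_ind => [a b|e s s' Hs Hs']; last first.
    by rewrite !lfun_lin Hs Hs'; symmetry; apply: tlift_linf => y z; rewrite lfun_lin.
  rewrite tliftE; last by bilin_tac.
  rewrite devE [LHS]dmulE; apply: eq_tlift => y z.
  by rewrite tpairE dantipodeE !devE.
apply/lfunP=> x; rewrite -devE E.
under eq_tlift do rewrite dcomulE.
by rewrite -lfun_tlift antipoder linearZ /= scale_lfunE devE /GRing.scale /= mulrC.
Qed.

HB.instance Definition _ := Falgebra_isHopf.Build k D
  dcomulA dcounitl dcounitr dcomul1 dcomulM dcounit1 dcounitM
  dantipodel dantipoder.
End Dual.

Section HopfMaps.
Variable k : fieldType.
Implicit Types H K : hopfAlgType k.

Record hopf_map H K (f : 'Hom(H, K)) : Prop := HopfMap {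
  hopf_map1 : f 1 = 1;
  hopf_mapM : {morph f : x y / x * y};
  hopf_map_comul : forall x, comul (f x) = tmap f f (comul x);
  hopf_map_counit : forall x, counit (f x) = counit x;
  hopf_map_antipode : {morph f : x / antipode x}
}.

Definition hopf_isomorphic H K :=
  exists f : 'Hom(H, K), hopf_map f /\ bijective f.

Definition trivial_hopf H :=
  exists gT : finGroupType, hopf_isomorphic H (group_algebra k gT)
                         \/ hopf_isomorphic H (dual_hopf (group_algebra k gT)).

Definition normal_hopf_subalgebra H (A : {vspace H}) :=
  hopf_subalgebra A /\ forall h a : H, a \in A ->
    tlift (fun h1 h2 => h1 * a * antipode h2) (comul h) \in A /\
    tlift (fun h1 h2 => antipode h1 * a * h2) (comul h) \in A.

Definition augmentation H (A : {vspace H}) : {vspace H} := (A :&: lker counit)%VS.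

(* "H / I is trivial": the quotient Hopf algebra H / I is given by a surjective
   Hopf algebra map with kernel I, and is unique up to isomorphism. *)
Definition trivial_quotient H (I : {vspace H}) :=
  exists (Q : hopfAlgType k) (pi : 'Hom(H, Q)),
    [/\ hopf_map pi, limg pi = fullv, lker pi = I & trivial_hopf Q].

Definition right_coinv H K (pi : 'Hom(H, K)) : {vspace H} :=
  lker (tmap \1%VF pi \o comul - linfun (fun h : H => h ⊗ (1 : K)))%VF.

Definition left_coinv H K (pi : 'Hom(H, K)) : {vspace H} :=
  lker (tmap pi \1%VF \o comul - linfun (fun h : H => (1 : K) ⊗ h))%VF.

Lemma right_coinvP H K (pi : 'Hom(H, K)) h :
  reflect (tmap \1%VF pi (comul h) = h ⊗ 1) (h \in right_coinv pi).
Proof.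
pose f (x : H) := x ⊗ (1 : K).
have fL : linear f by move=> a x y; apply: tpurePl.
pose lf : {linear H -> tens H K} :=
  HB.pack f (GRing.isLinear.Build k H (tens H K) *:%R f fL).
have E : linfun f h = f h := lfunE lf h.
by rewrite memv_ker add_lfunE opp_lfunE comp_lfunE subr_eq0 E; apply: eqP.
Qed.

Lemma left_coinvP H K (pi : 'Hom(H, K)) h :
  reflect (tmap pi \1%VF (comul h) = 1 ⊗ h) (h \in left_coinv pi).
Proof.
pose f (x : H) := (1 : K) ⊗ x.
have fL : linear f by move=> a x y; apply: tpurePr.
pose lf : {linear H -> tens K H} :=
  HB.pack f (GRing.isLinear.Build k H (tens K H) *:%R f fL).
have E : linfun f h = f h := lfunE lf h.
by rewrite memv_ker add_lfunE opp_lfunE comp_lfunE subr_eq0 E; apply: eqP.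
Qed.

Definition normal_hopf_map H K (pi : 'Hom(H, K)) := right_coinv pi = left_coinv pi.

(* The chain k = H_(n+1) ⊆ ... ⊆ H_2 ⊆ H_1 = H, read from the top: A is H_2, and
   the rest of the chain lies in A regarded as a Hopf algebra. *)
Inductive lower_semisolvable : hopfAlgType k -> Prop :=
| LowerBase H of \dim {:H} = 1%N : lower_semisolvable H
| LowerStep H (A : {vspace H}) (hA : hopf_subalgebra A) of
    normal_hopf_subalgebra A &
    trivial_quotient (fullv * augmentation A)%VS &
    lower_semisolvable (sub_hopf hA) : lower_semisolvable H.

(* The chain H = H_(0) -> H_(1) -> ... -> H_(n) = k, read from the left. *)
Inductive upper_semisolvable : hopfAlgType k -> Prop :=
| UpperBase H of \dim {:H} = 1%N : upper_semisolvable H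
| UpperStep H (B : hopfAlgType k) (pi : 'Hom(H, B)) (hC : hopf_subalgebra (right_coinv pi)) of
    hopf_map pi & limg pi = fullv & normal_hopf_map pi &
    trivial_hopf (sub_hopf hC) &
    upper_semisolvable B : upper_semisolvable H.

Definition semisolvable H := upper_semisolvable H \/ lower_semisolvable H.
End HopfMaps.

(* The regular left module is semisimple: every left ideal is a direct summand. *)
Definition left_ideal (k : fieldType) (A : falgType k) (U : {vspace A}) :=
  (fullv * U <= U)%VS.

Definition semisimple_algebra (k : fieldType) (A : falgType k) :=
  forall U : {vspace A}, left_ideal U ->
    exists W : {vspace A},
      [/\ left_ideal W, (U + W)%VS = fullv & (U :&: W)%VS = 0%VS].

(* Main.v *)
(* Every semisimple [H] of dimension [n > 1] dividing [p^2 q^2] has a central grouplike element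
   [g <> 1].  The quotient of [H] by [g - 1] is again semisimple, of dimension [n] divided by the
   order of [g], and its coinvariants are the group algebra of the cyclic group generated by [g];
   so by induction [H] is upper semisolvable.

   To find [g], first show that [S^2 = 1] (Larson and Radford).  Decompose [H] into simple modules
   over its Drinfeld double, which acts by the adjoint action and by left translations; their
   dimensions divide [n].  Let [K] be the sum of those of dimension less than [q].  These
   dimensions are powers of [p], at most [p^2], and since [p^4 < q] the space [K] is a subalgebra.
   Being a coideal subalgebra, it has dimension dividing [n], and [\dim K = n] modulo [q].  The
   one-dimensional summands are spanned by central grouplikes; if [1] were the only one, then
   [\dim K = 1] modulo [p], so [\dim K] would be [q] or [q^2], and [p] would divide [q^2 - 1]. *)

From HB Require Import structures.
From Stdlib Require Import Classical.
From mathcomp Require Import all_boot all_order all_algebra all_fingroup all_solvable all_field.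
From mathcomp Require Import zify ring.
Require Import Defs.

Set Implicit Arguments.
Unset Strict Implicit.
Unset Printing Implicit Defensive.

Import Order.TTheory GRing.Theory Num.Theory.
Local Open Scope ring_scope.

(* Sweedler notation: [\sw_(a, b <- x) F a b] is [F x_1 x_2], for a bilinear [F]. *)
Notation "'\sw_' ( a , b <- x ) E" := (tlift (fun a b => E) (comul x))
  (at level 41, a name, b name, x at level 60, E at level 41,
   format "'\sw_' ( a , b  <-  x )  E") : ring_scope.

(** * Multilinear maps and linear maps out of tensor products *)

Section Linear.
Variable k : fieldType.
Implicit Types U V W X : vectType k.

(** No category of modules is set up: traces and dimensions are computed from operators on $H$ and
    $H\otimes H$. The dual bases given by the integral [Lam] and the functional [coint] turn a trace
    into a Sweedler sum, and a dimension is the trace of an idempotent.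

    That $S^2=1$ rests on $\mathrm{tr}(S^2)\neq 0$, a positivity statement. As $k$ need not embed in
    the complex numbers, it is reduced to whether an integer polynomial vanishes at a root of unity,
    a question with the same answer in [k] and in [algC].

    Once $S^2=1$, every submodule over the double is the image of right translation by an idempotent
    tracial functional $f$, so minimal submodules are governed by the character algebra of $H$. The
    dimension is $n f(\Lambda)$ with $n=\dim H$, and its quotient into $n$ is an eigenvalue of an
    integer matrix made of structure constants of characters, hence an integer.

    The divisibility for $K$ comes from comparing two traces on $H\otimes K$, applied to an integral
    of $K$. *)

Definition islin U V (f : U -> V) := linear f.

Lemma linear_id_fun U : islin (fun x : U => x). Proof. by []. Qed.

Lemma linear_app U V W (A : 'Hom(V, W)) (f : U -> V) :
  islin f -> islin (fun x => A (f x)).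
Proof. by move=> fL a x y; rewrite fL linearP. Qed.

Lemma linear_at U V W (f : U -> 'Hom(V, W)) v :
  islin f -> islin (fun x => f x v).
Proof. by move=> fL a x y; rewrite fL lfunPl. Qed.

Lemma linear_mulr (A : falgType k) U (f : U -> A) c :
  islin f -> islin (fun x => f x * c).
Proof. by move=> fL a x y; rewrite fL mulPl. Qed.

Lemma linear_mull (A : falgType k) U (f : U -> A) c :
  islin f -> islin (fun x => c * f x).
Proof. by move=> fL a x y; rewrite fL mulPr. Qed.

Lemma linear_mulkr U (f : U -> k^o) (c : k) :
  islin f -> islin (fun x => (f x : k) * c : k^o).
Proof. by move=> fL a x y; rewrite fL mulrDl /GRing.scale /= mulrA. Qed.

Lemma linear_mulkl U (f : U -> k^o) (c : k) :
  islin f -> islin (fun x => c * (f x : k) : k^o).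
Proof. by move=> fL a x y; rewrite fL mulrDr /GRing.scale /= mulrCA. Qed.

Lemma linear_tensl U V W (f : U -> V) (w : W) :
  islin f -> islin (fun x => f x ⊗ w).
Proof. by move=> fL a x y; rewrite fL tpurePl. Qed.

Lemma linear_tensr U V W (f : U -> V) (w : W) :
  islin f -> islin (fun x => w ⊗ f x).
Proof. by move=> fL a x y; rewrite fL tpurePr. Qed.

Lemma linear_scalel U V (f : U -> k^o) (v : V) :
  islin f -> islin (fun x => (f x : k) *: v).
Proof. by move=> fL a x y; rewrite fL scalePl. Qed.

Lemma linear_scaler U V (f : U -> V) (c : k) :
  islin f -> islin (fun x => c *: f x).
Proof. by move=> fL a x y; rewrite fL scalePr. Qed.

Lemma linear_tlift U V W X (F : U -> V -> W -> X) t :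
  (forall v w, islin (fun x => F x v w)) -> islin (fun x => tlift (F x) t).
Proof. by move=> FL a x y; apply: tlift_linf => v w; apply: FL. Qed.

Lemma linear_sum_fun U V I (r : seq I) (P : pred I) (f : I -> U -> V) :
  (forall i, islin (f i)) -> islin (fun x => \sum_(i <- r | P i) f i x).
Proof.
move=> fL a x y; rewrite scaler_sumr -big_split; apply: eq_bigr => i _.
exact: fL.
Qed.

Lemma lin_tlift U V W X (h : W -> X) (F : U -> V -> W) t :
  islin h -> h (tlift F t) = tlift (fun u v => h (F u v)) t.
Proof.
move=> hL; pose lh : {linear W -> X} := HB.pack h (GRing.isLinear.Build k W X *:%R h hL).
have E x : linfun h x = h x := lfunE lh x.
by rewrite -E lfun_tlift; apply: eq_tlift => u v; rewrite E.
Qed.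

(** With one summation over pairs of indices, exchanging two Sweedler sums becomes [exchange_big];
    no bilinearity of [F] is involved. *)
Lemma tliftE_pair U V W (F : U -> V -> W) t :
  tlift F t = \sum_p t p.1 p.2 *: F (vbasis {:U})`_p.1 (vbasis {:V})`_p.2.
Proof. by rewrite lfunE /= /tlift_fun pair_big. Qed.

Lemma tlift_swap U V U' V' W (F : U -> V -> U' -> V' -> W) s t :
  tlift (fun a b => tlift (fun c d => F a b c d) t) s =
  tlift (fun c d => tlift (fun a b => F a b c d) s) t.
Proof.
rewrite !tliftE_pair; under eq_bigr => i _ do rewrite tliftE_pair scaler_sumr.
under [RHS]eq_bigr => i _ do rewrite tliftE_pair scaler_sumr.
rewrite exchange_big; apply: eq_bigr => i _; apply: eq_bigr => j _.
by rewrite !scalerA mulrC.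
Qed.

Lemma tlift_sum U V W I (r : seq I) (P : pred I) (F : I -> U -> V -> W) t :
  tlift (fun a b => \sum_(i <- r | P i) F i a b) t = \sum_(i <- r | P i) tlift (F i) t.
Proof.
rewrite tliftE_pair; under eq_bigr => p _ do rewrite scaler_sumr.
by rewrite exchange_big; apply: eq_bigr => i _; rewrite tliftE_pair.
Qed.

Lemma tlift_0 U V W (t : tens U V) : tlift (fun _ _ => 0 : W) t = 0.
Proof. by rewrite tliftE_pair big1 // => p _; rewrite scaler0. Qed.

Lemma linear_comp U V W (g : V -> W) (f : U -> V) :
  islin g -> islin f -> islin (fun x => g (f x)).
Proof. by move=> gL fL a x y; rewrite fL gL. Qed.

Definition trilin U V W X (F : U -> V -> W -> X) :=
  [/\ forall v w, islin (fun u => F u v w), forall u w, islin (fun v => F u v w)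
    & forall u v, islin (F u v)].

Lemma trilin1 U V W X (F : U -> V -> W -> X) v w : trilin F -> islin (fun u => F u v w).
Proof. by case. Qed.
Lemma trilin2 U V W X (F : U -> V -> W -> X) u w : trilin F -> islin (fun v => F u v w).
Proof. by case. Qed.
Lemma trilin3 U V W X (F : U -> V -> W -> X) u v : trilin F -> islin (fun w => F u v w).
Proof. by case. Qed.
Lemma bilin1 U V W (F : U -> V -> W) v : bilin F -> islin (fun u => F u v).
Proof. by case=> _ /(_ v). Qed.
Lemma bilin2 U V W (F : U -> V -> W) u : bilin F -> islin (fun v => F u v).
Proof. by case=> /(_ u). Qed.
End Linear.

(** Linearity is read off the syntax of the function body. The alias [islin] of [linear] gives all
    such goals one recognisable head. *)
Ltac lin_step :=
  match goal with
  | |- islin (fun x => x) => exact: linear_id_fun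
  | |- islin (fun x => fun_of_lfun ?A x) => exact: (linear_app A (@linear_id_fun _ _))
  | |- islin (fun x => fun_of_lfun ?A (@?f x)) => apply: (linear_app A (f := f))
  | |- islin (fun x => fun_of_lfun (tlift _) _) =>
      apply: linear_tlift => ? ?
  | |- islin (fun x => fun_of_lfun (@?f x) ?v) => apply: (linear_at (f := f))
  | |- islin (fun x => @?f x ⊗ ?w) => apply: (linear_tensl (f := f))
  | |- islin (fun x => ?w ⊗ @?f x) => apply: (linear_tensr (f := f))
  | |- islin (fun x => ?w *: @?f x) => apply: (linear_scaler (f := f))
  | |- islin (fun x => @?f x *: ?w) => apply: (linear_scalel (f := f))
  | |- islin (fun x => @?f x * ?w) =>
      first [apply: (linear_mulr (f := f)) | apply: (linear_mulkr (f := f))]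
  | |- islin (fun x => ?w * @?f x) =>
      first [apply: (linear_mull (f := f)) | apply: (linear_mulkl (f := f))]
  | |- islin (fun x => \sum_(i <- _ | _) _) => apply: linear_sum_fun => ?
  | h : islin ?g |- islin (fun x => ?g (@?f x)) => apply: (linear_comp (g := g) (f := f)) => //
  | h : linear ?g |- islin (fun x => ?g (@?f x)) => apply: (linear_comp (g := g) (f := f)) => //
  | h : bilin ?F |- islin (fun x => ?F (@?f x) ?b) =>
      apply: (linear_comp (f := f) (bilin1 b h))
  | h : bilin ?F |- islin (fun x => ?F ?b (@?f x)) =>
      apply: (linear_comp (f := f) (bilin2 b h))
  | h : trilin ?F |- islin (fun x => ?F (@?f x) ?b ?c) =>
      apply: (linear_comp (f := f) (trilin1 b c h))
  | h : trilin ?F |- islin (fun x => ?F ?b (@?f x) ?c) =>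
      apply: (linear_comp (f := f) (trilin2 b c h))
  | h : trilin ?F |- islin (fun x => ?F ?b ?c (@?f x)) =>
      apply: (linear_comp (f := f) (trilin3 b c h))
  end.
Ltac to_islin := lazymatch goal with |- @islin _ _ _ _ => idtac | _ => refine (_ : islin _) end.
Ltac eta_islin := lazymatch goal with
  | |- islin (fun x => _) => idtac | |- islin ?f => change (islin (fun x => f x)) end.
Ltac lin_tac := to_islin; rewrite /=; repeat (cbv beta; eta_islin; lin_step).
Ltac bil_tac := by split=> [?|?]; lin_tac.
Ltac tri_tac := by split=> [? ?|? ?|? ?]; lin_tac.

(** * Sweedler calculus and multiplicativity of the antipode *)

Section Sweedler.
Variables (k : fieldType) (H : hopfAlgType k).
Implicit Types (V W : vectType k) (x y : H).
Local Notation S := (@antipode k H).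

(** Both iterated sums are values of linear maps [G] and [G'] on the two bracketings of the triple
    tensor product, and [tassoc] exchanges these maps. *)
Lemma sw_coassoc V (F : H -> H -> H -> V) x : trilin F ->
  \sw_(a, b <- x) \sw_(c, d <- a) F c d b = \sw_(a, b <- x) \sw_(c, d <- b) F a c d.
Proof.
move=> F3.
pose G := tlift (fun (s : tens H H) b => tlift (fun c d => F c d b) s).
pose G' := tlift (fun a (s : tens H H) => tlift (F a) s).
have BG : bilin (fun (s : tens H H) b => tlift (fun c d => F c d b) s).
  by bil_tac.
have BG' : bilin (fun a (s : tens H H) => tlift (F a) s).
  by bil_tac.
have GE t : G' (tassoc H H H t) = G t.
  move: t; apply: tens_ind => [s b|a s t Hs Ht]; last by rewrite !lfun_lin Hs Ht.
  move: s; apply: tens_ind => [u v|a s t Hs Ht]; last by rewrite !linPE Hs Ht.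
  by rewrite tassocE /G /G' !tliftE //; bil_tac.
have E1 t : G (tmap comul \1%VF t) = tlift (fun a b => \sw_(c, d <- a) F c d b) t.
  move: t; apply: tens_ind => [u v|a s t Hs Ht]; last by rewrite !lfun_lin Hs Ht.
  by rewrite tmapE /G !tliftE ?id_lfunE //; bil_tac.
have E2 t : G' (tmap \1%VF comul t) = tlift (fun a b => \sw_(c, d <- b) F a c d) t.
  move: t; apply: tens_ind => [u v|a s t Hs Ht]; last by rewrite !lfun_lin Hs Ht.
  by rewrite tmapE /G' !tliftE ?id_lfunE //; bil_tac.
by rewrite -E1 -E2 -comulA GE.
Qed.

Lemma sw_mul V (F : H -> H -> V) x y : bilin F ->
  \sw_(a, b <- x * y) F a b = \sw_(a, b <- x) \sw_(c, d <- y) F (a * c) (b * d).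
Proof.
move=> F2; rewrite comulM; move: (comul x) (comul y).
apply: tens_ind => [a b|e s s' Hs Hs'] t; last first.
  by rewrite tmulPl !lfun_lin Hs Hs'.
rewrite [RHS]tliftE; last by bil_tac.
move: t; apply: tens_ind => [c d|e s s' Hs Hs']; last first.
  by rewrite tmulPr !lfun_lin Hs Hs'.
by rewrite tmulE !tliftE //; bil_tac.
Qed.

Lemma sw_1 V (F : H -> H -> V) : bilin F -> \sw_(a, b <- 1) F a b = F 1 1.
Proof. by move=> F2; rewrite comul1 tliftE. Qed.

Lemma sw_counitl V (F : H -> V) x : islin F ->
  \sw_(a, b <- x) (counit a *: F b) = F x.
Proof.
move=> FL; rewrite -[in RHS](counitl x) (lin_tlift _ _ FL); apply: eq_tlift => a b.
by have := FL (counit a) b 0; have := FL (-1) 0 0; rewrite !scaleN1r oppr0 addr0 addNr => ->; rewrite !addr0.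
Qed.

Lemma sw_counitr V (F : H -> V) x : islin F ->
  \sw_(a, b <- x) (counit b *: F a) = F x.
Proof.
move=> FL; rewrite -[in RHS](counitr x) (lin_tlift _ _ FL); apply: eq_tlift => a b.
by have := FL (counit b) a 0; have := FL (-1) 0 0; rewrite !scaleN1r oppr0 addr0 addNr => ->; rewrite !addr0.
Qed.

Lemma linear_Z V W (F : V -> W) c v : islin F -> F (c *: v) = c *: F v.
Proof.
move=> FL; have := FL c v 0; have := FL (-1) 0 0.
by rewrite !scaleN1r oppr0 addr0 addNr => ->; rewrite !addr0.
Qed.

Lemma sw_antipodel V (F : H -> V) x : islin F ->
  \sw_(a, b <- x) F (S a * b) = counit x *: F 1.
Proof. by move=> FL; rewrite -(lin_tlift _ _ FL) antipodel linear_Z. Qed.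

Lemma sw_antipoder V (F : H -> V) x : islin F ->
  \sw_(a, b <- x) F (a * S b) = counit x *: F 1.
Proof. by move=> FL; rewrite -(lin_tlift _ _ FL) antipoder linear_Z. Qed.

Lemma swZ (c : k) (F : H -> H -> H) t : tlift (fun a b => c *: F a b) t = c *: tlift F t.
Proof. exact: tliftZ. Qed.

Lemma antipode1 : S 1 = 1.
Proof.
have := antipodel (1 : H); rewrite comul1 tliftE ?counit1 ?scale1r ?mulr1 //.
by bil_tac.
Qed.

(** Uniqueness of convolution inverses: [S (x * y)] is a left inverse and [S y * S x] a right
    inverse of the multiplication. The sum of [G] over the triple coproducts of [x] and [y]
    collapses to either of them. *)
Lemma antipodeM x y : S (x * y) = S y * S x.
Proof.
pose G (a a' b b' c c' : H) := S (a * a') * (b * (b' * S c') * S c).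
transitivity (\sw_(a, b <- x) \sw_(c, d <- b) \sw_(a', b' <- y) \sw_(c', d' <- b')
    G a a' c c' d d').
  symmetry; under eq_tlift => a b.
    under eq_tlift => c d.
      under eq_tlift => a' b'.
        rewrite (sw_antipoder (F := fun u => S (a * a') * (c * u * S d))); last by lin_tac.
        rewrite mulr1.
      over.
      rewrite /= (sw_counitr (F := fun u => S (a * u) * (c * S d))); last by lin_tac.
    over.
    rewrite /= (sw_antipoder (F := fun u => S (a * y) * u)); last by lin_tac.
    rewrite mulr1.
  over.
  by rewrite /= (sw_counitr (F := fun u => S (u * y))); last by lin_tac.
transitivity (\sw_(a, b <- x) \sw_(a', b' <- y) \sw_(c, d <- a) \sw_(c', d' <- a')
    (S (c * c') * (d * d') * (S b' * S b))).
  rewrite -(sw_coassoc (F := fun a c d =>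
     \sw_(a', b' <- y) \sw_(c', d' <- b') G a a' c c' d d')); last by rewrite /G; tri_tac.
  apply: eq_tlift => a b; rewrite -[RHS]tlift_swap; apply: eq_tlift => c d.
  rewrite -(sw_coassoc (F := fun a' c' d' => G c a' d c' b d')); last by rewrite /G; tri_tac.
  apply: eq_tlift => a' b'; apply: eq_tlift => c' d'; rewrite /G !mulrA //.
under eq_tlift => a b.
  under eq_tlift => a' b'.
    rewrite -(sw_mul (F := fun u v => S u * v * (S b' * S b))); last by bil_tac.
    rewrite (sw_antipodel (F := fun u => u * (S b' * S b))); last by lin_tac.
    rewrite mul1r counitM -scalerA.
  over.
  rewrite /= swZ.
  rewrite (sw_counitl (F := fun u => S u * S b)); last by lin_tac.
over.
by rewrite /= (sw_counitl (F := fun u => S y * S u)); last by lin_tac.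
Qed.

End Sweedler.

(** * The antipode and the coproduct, by duality *)

Section Antipode.
Variables (k : fieldType) (H : hopfAlgType k).
Implicit Types (V W : vectType k) (x y : H).
Local Notation S := (@antipode k H).

Lemma dual_antipodeE (f : dual_hopf H) x : (antipode f : dual_hopf H) x = f (S x).
Proof. exact: dantipodeE. Qed.

Lemma dual_mulE (f g : dual_hopf H) x :
  (f * g : dual_hopf H) x = \sw_(a, b <- x) (f a * g b : k^o).
Proof. exact: dmulE. Qed.

Lemma dual_oneE x : (1 : dual_hopf H) x = counit x. Proof. by []. Qed.

Lemma dual_counitE (f : dual_hopf H) : counit f = f 1. Proof. exact: devE. Qed.

Lemma counit_antipode x : counit (S x) = counit x.
Proof.
have := congr1 (fun h : dual_hopf H => h x) (antipode1 (dual_hopf H)).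
by rewrite dual_antipodeE.
Qed.

Lemma functional_sep V (v : V) : (forall f : 'Hom(V, k^o), f v = 0) -> v = 0.
Proof.
move=> f0; rewrite (coord_vbasis (memvf v)) big1 // => i _.
by rewrite -vcoordE f0 scale0r.
Qed.

Lemma tens_sep V W (s t : tens V W) :
  (forall (f : 'Hom(V, k^o)) (g : 'Hom(W, k^o)), tpair f g s = tpair f g t) -> s = t.
Proof.
move=> E; apply/eqP; rewrite -subr_eq0; apply/eqP.
apply: (tpair_sep (f := id) (g := id)) => [u|v|f g]; try exact: functional_sep.
by rewrite linearB /= E subrr.
Qed.

(** This is [antipodeM] for the dual Hopf algebra, tested against pairs of functionals. *)
Lemma comul_antipode x : comul (S x) = \sw_(a, b <- x) (S b ⊗ S a).
Proof.
apply: tens_sep => f g.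
have := congr1 (fun h : dual_hopf H => h x) (antipodeM (f : dual_hopf H) g).
rewrite dual_antipodeE !dual_mulE => E; rewrite lfun_tlift.
rewrite [LHS]E; apply: eq_tlift => a b.
by rewrite tpairE !dual_antipodeE mulrC.
Qed.

Lemma sw_antipode V (F : H -> H -> V) x : bilin F ->
  \sw_(a, b <- S x) F a b = \sw_(a, b <- x) F (S b) (S a).
Proof.
move=> F2; rewrite comul_antipode lfun_tlift; apply: eq_tlift => a b.
by rewrite tliftE.
Qed.
End Antipode.

(** * Traces of endomorphisms *)

Section Trace.
Variable k : fieldType.
Implicit Types U V W : vectType k.

Definition lftr V (A : 'End(V)) : k :=
  \sum_(i < \dim {:V}) coord (vbasis {:V}) i (A (vbasis {:V})`_i).

(** Only the reconstruction identity matters, so the family [w] may be redundant. This is the case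
    for the families obtained from the coproduct of an integral. *)
Lemma lftr_dual V (I : finType) (phi : I -> 'Hom(V, k^o)) (w : I -> V) (A : 'End(V)) :
  (forall x, x = \sum_i phi i x *: w i) -> lftr A = \sum_i phi i (A (w i)).
Proof.
move=> E; rewrite /lftr.
under eq_bigr => j _ do rewrite [X in A X]E !linear_sum /=.
rewrite exchange_big /=; apply: eq_bigr => i _.
rewrite [in RHS](coord_vbasis (memvf (A (w i)))) linear_sum; apply: eq_bigr => j _.
by rewrite !linearZ /= [LHS]mulrC.
Qed.

Lemma lftr_tens U V (B : V -> U -> k^o) (t : tens U V) (A : 'End(V)) :
    bilin B -> (forall x, x = tlift (fun a b => B x a *: b) t) ->
  lftr A = tlift (fun a b => B (A b) a) t.
Proof.
move=> BB E.
pose phi (p : 'I_(\dim {:U}) * 'I_(\dim {:V})) : 'Hom(V, k^o) :=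
  linfun (fun x => t p.1 p.2 *: B x (vbasis {:U})`_p.1).
have phiE p x : phi p x = t p.1 p.2 *: B x (vbasis {:U})`_p.1.
  have L : linear (fun x => t p.1 p.2 *: B x (vbasis {:U})`_p.1 : k^o) by lin_tac.
  pose lf : {linear V -> k^o} := HB.pack (fun x => t p.1 p.2 *: B x (vbasis {:U})`_p.1)
    (GRing.isLinear.Build k V k^o *:%R _ L).
  exact: (lfunE lf).
rewrite (lftr_dual (phi := phi) (w := fun p => (vbasis {:V})`_p.2)) => [|x].
  by rewrite tliftE_pair; apply: eq_bigr => p _; rewrite phiE.
by rewrite {1}[x]E tliftE_pair; apply: eq_bigr => p _; rewrite phiE scalerA.
Qed.

Lemma lftrP V a (A B : 'End(V)) : lftr (a *: A + B) = a * lftr A + lftr B.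
Proof.
rewrite /lftr mulr_sumr -big_split; apply: eq_bigr => i _ /=.
by rewrite lfunPl linearP.
Qed.

Lemma lftr0 V : lftr (0 : 'End(V)) = 0.
Proof. by rewrite /lftr big1 // => i _; rewrite zero_lfunE linear0. Qed.

Lemma lftrD V (A B : 'End(V)) : lftr (A + B) = lftr A + lftr B.
Proof. by have := lftrP 1 A B; rewrite scale1r mul1r. Qed.

Lemma lftrZ V a (A : 'End(V)) : lftr (a *: A) = a * lftr A.
Proof. by have := lftrP a A 0; rewrite !addr0 lftr0 addr0. Qed.

Lemma lftr_sum V I (r : seq I) (P : pred I) (A : I -> 'End(V)) :
  lftr (\sum_(i <- r | P i) A i) = \sum_(i <- r | P i) lftr (A i).
Proof. by elim/big_rec2: _ => [|i x B _ <-]; rewrite ?lftr0 ?lftrD. Qed.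

Lemma lftrC U V (A : 'Hom(U, V)) (B : 'Hom(V, U)) : lftr (A \o B)%VF = lftr (B \o A)%VF.
Proof.
rewrite /lftr; under eq_bigr => i _.
  rewrite comp_lfunE (coord_vbasis (memvf (B _))) !linear_sum /=; over.
rewrite exchange_big; apply: eq_bigr => i _ /=; rewrite comp_lfunE.
rewrite [in RHS](coord_vbasis (memvf (A _))) !linear_sum; apply: eq_bigr => j _ /=.
by rewrite !linearZ /= [LHS]mulrC.
Qed.

Lemma lftr_rank1 V (A : 'End(V)) (f : 'Hom(V, k^o)) v :
  (forall x, A x = f x *: v) -> lftr A = f v.
Proof.
move=> E; rewrite [in RHS](coord_vbasis (memvf v)) linear_sum; apply: eq_bigr => i _.
by rewrite E !linearZ /= [RHS]mulrC.
Qed.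

Lemma lftr_id V : lftr (\1%VF : 'End(V)) = (\dim {:V})%:R.
Proof.
rewrite /lftr (eq_bigr (fun => 1)) ?sumr_const ?card_ord // => i _.
by rewrite id_lfunE coord_free ?eqxx ?(basis_free (vbasisP _)).
Qed.

(** The source of every dimension below: in characteristic 0 the trace of an idempotent determines
    its rank. Bases of the image and of the kernel serve together as the reconstructing family. *)
Lemma lftr_idem V (A : 'End(V)) : (A \o A = A)%VF -> lftr A = (\dim (limg A))%:R.
Proof.
move=> AA; have AAE x : A (A x) = A x by rewrite -comp_lfunE AA.
set n := \dim (limg A); set m := \dim (lker A).
pose phi (i : 'I_n + 'I_m) : 'Hom(V, k^o) := match i with
  | inl i => (linfun (coord (vbasis (limg A)) i : V -> k^o) \o A)%VF
  | inr j => (linfun (coord (vbasis (lker A)) j : V -> k^o) \o (\1 - A))%VF end.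
pose w (i : 'I_n + 'I_m) : V := match i with
  | inl i => (vbasis (limg A))`_i | inr j => (vbasis (lker A))`_j end.
have mA i : (vbasis (limg A))`_i \in limg A.
  have [lt_i|le_i] := ltnP i (size (vbasis (limg A))); last by rewrite nth_default // mem0v.
  by rewrite vbasis_mem // mem_nth.
have mK i : A (vbasis (lker A))`_i = 0.
  have [lt_i|le_i] := ltnP i (size (vbasis (lker A))).
    by apply/eqP; rewrite -memv_ker vbasis_mem // mem_nth.
  by rewrite nth_default // linear0.
rewrite (lftr_dual (phi := phi) (w := w)) => [|x]; last first.
  have e1 : A x \in limg A by rewrite memv_img ?memvf.
  have e2 : x - A x \in lker A by rewrite memv_ker linearB /= AAE subrr.
  rewrite big_sumType /= -[LHS](subrK (A x)) addrC; congr (_ + _).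
    rewrite {1}(coord_vbasis e2); apply: eq_bigr => i _.
    by rewrite comp_lfunE lfunE /= add_lfunE opp_lfunE id_lfunE.
  rewrite {1}(coord_vbasis e1); apply: eq_bigr => i _.
  by rewrite comp_lfunE lfunE.
rewrite big_sumType /= [X in _ + X]big1 ?addr0 => [|j _]; last by rewrite mK linear0.
rewrite (eq_bigr (fun => 1)) ?sumr_const ?card_ord // => i _.
have /memv_imgP[y _ E] := mA i.
rewrite comp_lfunE lfunE /= E !AAE -E.
by rewrite coord_free ?eqxx ?(basis_free (vbasisP _)).
Qed.

Lemma lftr_tmap U V (A : 'End(U)) (B : 'End(V)) : lftr (tmap A B) = lftr A * lftr B.
Proof.
pose phi (p : 'I_(\dim {:U}) * 'I_(\dim {:V})) := tpair (vcoord (V := U) p.1) (vcoord (V := V) p.2).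
rewrite (lftr_dual (phi := phi)
  (w := fun p => (vbasis {:U})`_p.1 ⊗ (vbasis {:V})`_p.2)) => [|t].
  rewrite /lftr mulr_suml; under [RHS]eq_bigr => i _ do rewrite mulr_sumr.
  rewrite pair_big; apply: eq_bigr => -[i j] _ /=.
  by rewrite tmapE tpairE !vcoordE.
rewrite {1}[t]tens_expand pair_big; apply: eq_bigr => -[i j] _ /=; congr (_ *: _).
rewrite /phi /= {2}[t]tens_expand linear_sum (bigD1 i) //= linear_sum (bigD1 j) //=.
rewrite linearZ /= tpairE !vcoordE !coord_free ?(basis_free (vbasisP _)) // !eqxx mulr1.
rewrite [X in _ + X + _]big1 => [|j' /negPf nj]; last first.
  rewrite linearZ /= tpairE !vcoordE !coord_free ?(basis_free (vbasisP _)) //.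
  by rewrite nj mulr0 scaler0.
rewrite [X in _ + _ + X]big1 ?addr0 => [|i' /negPf ni]; first by rewrite [RHS]mulr1.
rewrite linear_sum big1 // => j' _.
rewrite linearZ /= tpairE !vcoordE !coord_free ?(basis_free (vbasisP _)) //.
by rewrite ni mul0r scaler0.
Qed.
End Trace.

(** * Subspaces stable under a family of operators *)

Section Stable.
Variables (k : fieldType) (V : vectType k) (I : Type) (op : I -> 'End(V)).
Implicit Types U W M : {vspace V}.

Definition stable U := forall i u, u \in U -> op i u \in U.

Definition minimal M :=
  [/\ stable M, M != 0%VS & forall W, stable W -> (W <= M)%VS -> W != 0%VS -> W = M].

Definition complemented :=
  forall U, stable U -> exists W, [/\ stable W, (U + W)%VS = fullv & (U :&: W)%VS = 0%VS].

Lemma stable_add U W : stable U -> stable W -> stable (U + W).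
Proof.
move=> sU sW i x /memv_addP[u Uu [w Ww ->]].
by rewrite linearD memv_add ?sU ?sW.
Qed.

Lemma stable_cap U W : stable U -> stable W -> stable (U :&: W).
Proof.
move=> sU sW i x /memv_capP[Ux Wx].
by rewrite memv_cap sU ?sW.
Qed.

Lemma stable0 : stable 0.
Proof. by move=> i x; rewrite memv0 => /eqP->; rewrite linear0 mem0v. Qed.

Lemma stableT : stable fullv. Proof. by move=> i x _; apply: memvf. Qed.

Lemma exists_minimal U : stable U -> U != 0%VS -> exists2 M, minimal M & (M <= U)%VS.
Proof.
elim: {U}(\dim U).+1 {-2}U (ltnSn (\dim U)) => [|n IHn] U; [by rewrite ltn0|move=> leUn]; move=> sU nzU.
have [[W [sW leWU nzW neWU]]|noW] :=
  classic (exists W, [/\ stable W, (W <= U)%VS, W != 0%VS & W != U]); last first.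
  exists U => //; split=> // W sW leWU nzW; have [//|neWU] := eqVneq W U.
  by case: noW; exists W.
have ltWU : (\dim W < \dim U)%N.
  by rewrite ltn_neqAle dimvS // andbT; apply/eqP=> E; case: neWU; apply/eqP; rewrite eqEdim leWU E leqnn.
have [M minM leMW] := IHn W (leq_trans ltWU leUn) sW nzW.
by exists M => //; apply: subv_trans leWU.
Qed.

Lemma minimal_capP M U : minimal M -> stable U -> (M :&: U)%VS != 0%VS -> (M <= U)%VS.
Proof.
case=> sM _ minM sU nz; rewrite -(minM _ (stable_cap sM sU) (capvSl _ _) nz).
exact: capvSr.
Qed.

Lemma complement_in U W : complemented -> stable U -> stable W -> (U <= W)%VS ->
  exists U', [/\ stable U', (U' <= W)%VS, (U + U')%VS = W & (U :&: U')%VS = 0%VS].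
Proof.
move=> C sU sW leUW; have [X [sX UX UX0]] := C _ sU.
exists (X :&: W)%VS; split; [exact: stable_cap|exact: capvSr| |].
  apply/eqP; rewrite eqEsubv subv_add leUW capvSr /=; apply/subvP=> w Ww.
  have: w \in (U + X)%VS by rewrite UX memvf.
  case/memv_addP=> u Uu [x Xx E]; rewrite E memv_add // memv_cap Xx.
  by rewrite -[x](addKr u) -E addrC memvB // (subvP leUW).
by rewrite capvA UX0 cap0v.
Qed.

(** Minimal subspaces are split off from [U] one at a time. [Z] is an arbitrary subspace because
    containments of products are later checked through preimages under multiplication by one
    element. *)
Lemma stable_sub U Z : complemented -> stable U ->
  (forall M, minimal M -> (M <= U)%VS -> (M <= Z)%VS) -> (U <= Z)%VS.
Proof.
move=> C; have [d] := ubnP (\dim U); elim: d U => // d IHd U ltUd sU sUZ.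
have [->|nzU] := eqVneq U 0%VS; first exact: sub0v.
have [M minM leMU] := exists_minimal sU nzU; have [sM nzM _] := minM.
have [X [sX leXU MX MX0]] := complement_in C sM sU leMU.
rewrite -MX subv_add sUZ // IHd // => [|M' minM' leM'X].
  have : (0 < \dim M)%N by rewrite lt0n dimv_eq0.
  by move: ltUd; rewrite -MX dimv_disjoint_sum //; lia.
by apply: sUZ => //; apply: subv_trans leXU.
Qed.

Lemma dvdn_dim_stable d W : complemented -> stable W ->
  (forall M, minimal M -> (M <= W)%VS -> (d %| \dim M)%N) -> (d %| \dim W)%N.
Proof.
move=> C; elim: {W}(\dim W).+1 {-2}W (ltnSn (\dim W)) => [|n IHn] W; [by rewrite ltn0|move=> leWn]; move=> sW dM.
have [->|nzW] := eqVneq W 0%VS; first by rewrite dimv0 dvdn0.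
have [M minM leMW] := exists_minimal sW nzW.
have [sM nzM _] := minM; have [X [sX leXW MX MX0]] := complement_in C sM sW leMW.
have E : \dim W = (\dim M + \dim X)%N.
  by rewrite -MX dimv_disjoint_sum.
have M_gt0 : (0 < \dim M)%N by rewrite lt0n dimv_eq0.
rewrite E; apply: dvdn_add; first exact: dM.
apply: IHn => // [|M' minM' leM'X]; last exact/dM/(subv_trans leM'X).
by rewrite -ltnS; apply: leq_trans leWn; rewrite ltnS E -[X in (X < _)%N]add0n ltn_add2r.
Qed.

(** Grow a stable subspace [W] whose minimal subspaces are all small. A missing small [M] meets [W]
    trivially, and a minimal subspace of [W + M] either lies in [W] or embeds in the sum modulo [W],
    so its dimension is at most that of [M]. *)
Lemma small_socle d : exists K, [/\ stable K,
  forall M, minimal M -> (\dim M < d)%N -> (M <= K)%VS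
  & forall M, minimal M -> (M <= K)%VS -> (\dim M < d)%N].
Proof.
pose good W := stable W /\ forall M, minimal M -> (M <= W)%VS -> (\dim M < d)%N.
suff: exists2 K, good K & forall M, minimal M -> (\dim M < d)%N -> (M <= K)%VS.
  by case=> K [sK K2] K1; exists K.
have: good 0%VS.
  by split=> [|M [_ nzM _]]; [exact: stable0 | rewrite subv0 (negPf nzM)].
move: 0%VS => W.
elim: {W}(\dim {:V} - \dim W).+1 {-2}W (ltnSn (\dim {:V} - \dim W)) => [|n IHn] W; [by rewrite ltn0|move=> ltW]; move=> gW.
have [[M [minM ltMd nMW]]|noM] :=
  classic (exists M, [/\ minimal M, (\dim M < d)%N & ~~ (M <= W)%VS]); last first.
  by exists W => // M minM ltMd; apply: contra_notT noM => nMW; exists M.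
have [sW W2] := gW.
have [sM nzM _] := minM.
have MW0 : (W :&: M)%VS = 0%VS.
  by apply/eqP; apply: contraR nMW => nz; apply: minimal_capP; rewrite // capvC.
apply: (IHn (W + M)%VS).
  have /dimvS : (W + M <= {:V})%VS by apply: subvf.
  have : (0 < \dim M)%N by rewrite lt0n dimv_eq0.
  by rewrite dimv_disjoint_sum //; lia.
split=> [|M' minM' leM']; first exact: stable_add.
have [z|nz] := eqVneq (M' :&: W)%VS 0%VS; last exact/W2/(minimal_capP minM').
apply: leq_ltn_trans ltMd; rewrite -(leq_add2l (\dim W)) -[leqRHS]dimv_disjoint_sum //.
rewrite -dimv_disjoint_sum ?dimvS ?subv_add ?leM' ?addvSl //.
by rewrite capvC.
Qed.
End Stable.

(** * Eigenvectors and Schur's lemma *)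

Section Eigenvector.
Variables (k : closedFieldType) (V : vectType k).
Implicit Types U W M : {vspace V}.

Lemma exists_eigenvector (A : 'End(V)) U : U != 0%VS ->
    (forall u, u \in U -> A u \in U) ->
  exists (c : k) (u : V), [/\ u \in U, u != 0 & A u = c *: u].
Proof.
move=> nzU sA; set b := vbasis U.
pose M := \matrix_(i < \dim U, j < \dim U) coord b j (A b`_i).
have dimU : (0 < \dim U)%N by rewrite lt0n dimv_eq0.
have /closed_rootP[c] : size (char_poly M) != 1%N by rewrite size_char_poly eqSS -lt0n.
rewrite -eigenvalue_root_char => /eigenvalueP[x xM nzx].
have memb i : (i < \dim U)%N -> b`_i \in U by move=> lti; rewrite vbasis_mem ?mem_nth ?size_tuple.
exists c, (\sum_i x 0 i *: b`_i); split.
- by rewrite memv_suml // => i _; rewrite memvZ // memb.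
- apply: contra nzx => /eqP/freeP x0; apply/eqP/rowP=> i.
  by rewrite mxE; apply: x0; apply: basis_free (vbasisP U).
rewrite linear_sum scaler_sumr.
transitivity (\sum_i \sum_j (x 0 i * M i j) *: b`_j).
  apply: eq_bigr => i _; rewrite linearZ /= (coord_vbasis (sA _ (memb _ _))) //.
  by rewrite scaler_sumr; apply: eq_bigr => j _; rewrite mxE scalerA.
rewrite exchange_big; apply: eq_bigr => j _ /=; rewrite -scaler_suml scalerA; congr (_ *: _).
by have := congr1 (fun y : 'rV_(\dim U) => y 0 j) xM; rewrite !mxE.
Qed.

Lemma schur (I : Type) (op : I -> 'End(V)) M (A : 'End(V)) : minimal op M ->
    (forall u, u \in M -> A u \in M) ->
    (forall i u, u \in M -> A (op i u) = op i (A u)) ->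
  exists c, forall u, u \in M -> A u = c *: u.
Proof.
move=> [sM nzM minM] sA cA; have [c [u [Mu nzu Au]]] := exists_eigenvector nzM sA.
exists c; set W := (M :&: lker (A - c *: \1)%VF)%VS.
have WE x : (x \in W) = (x \in M) && (A x == c *: x).
  by rewrite memv_cap memv_ker add_lfunE opp_lfunE scale_lfunE id_lfunE subr_eq0.
have sW : stable op W.
  move=> i x; rewrite !WE => /andP[Mx /eqP Ax].
  by rewrite sM // cA // Ax linearZ eqxx.
have nzW : W != 0%VS.
  by apply: contra nzu => /eqP W0; rewrite -memv0 -W0 WE Mu Au eqxx.
move=> x Mx; apply/eqP.
by have: x \in W; [rewrite (minM W) ?capvSl | rewrite WE Mx].
Qed.
End Eigenvector.

(** * Idempotents and characters of a semisimple algebra *)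

Section SemisimpleAlgebra.
Variables (k : closedFieldType) (A : falgType k).
Hypothesis char0 : [pchar k] =i pred0.
Hypothesis ssA : semisimple_algebra A.
Implicit Types (x y e f : A) (U W : {vspace A}).

Lemma amullE x y : amull x y = x * y. Proof. by rewrite lfunE. Qed.
Lemma amulrE x y : amulr x y = y * x. Proof. by rewrite lfunE. Qed.

Lemma natr_eq0_char0 n : ((n%:R : k) == 0) = (n == 0)%N.
Proof. by rewrite (pcharf0P k).1. Qed.

Lemma left_idealP U : reflect (stable (@amull _ A) U) (left_ideal U).
Proof.
apply: (iffP prodvP) => [sU x u Uu|sU x u _ Uu]; last by rewrite -amullE sU.
by rewrite amullE sU ?memvf.
Qed.

Lemma left_ideal_complemented : complemented (@amull _ A).
Proof.
move=> U /left_idealP/ssA[W [/left_idealP sW UW UW0]].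
by exists W.
Qed.

(** The idempotent is the component of 1 in [U] along a complementary left ideal [W]: for [x] in
    [U], the difference [x - x * u = x * w] lies in both. *)
Lemma left_ideal_idem U : stable (@amull _ A) U ->
  exists e, [/\ e \in U, e * e = e & forall x, x \in U -> x * e = x].
Proof.
move=> sU; have [W [sW UW UW0]] := left_ideal_complemented sU.
have: 1 \in (U + W)%VS by rewrite UW memvf.
case/memv_addP=> u Uu [w Ww E].
have xu x : x \in U -> x * u = x.
  move=> Ux; apply/eqP; rewrite eq_sym -subr_eq0 -memv0 -UW0 memv_cap.
  rewrite memvB //=; last by rewrite -amullE sU.
  by rewrite -[X in X - _]mulr1 E mulrDr addrC addKr -amullE sW.
by exists u; split=> //; apply: xu.
Qed.

Lemma principal_idem x : exists e b, [/\ e * e = e, e = b * x & x * e = x].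
Proof.
have sU : stable (@amull _ A) (limg (amulr x)).
  move=> a _ /memv_imgP[y _ ->]; rewrite !amulrE amullE mulrA -amulrE.
  exact/memv_img/memvf.
have [e [/memv_imgP[b _ ->] ee xe]] := left_ideal_idem sU.
have Ux : x \in limg (amulr x) by rewrite -[X in X \in _]mul1r -amulrE memv_img ?memvf.
by exists (amulr x b), b; rewrite amulrE; move: ee (xe x Ux); rewrite amulrE.
Qed.

(** Semiprimeness: the idempotent [e = b * x] generating the left ideal of [x] equals its square,
    which contains the factor [x * b * x]. *)
Lemma mulr_mull_eq0 x : (forall a, x * a * x = 0) -> x = 0.
Proof.
move=> x0; have [e [b [ee Ee xe]]] := principal_idem x.
suff e0 : e = 0 by rewrite -xe e0 mulr0.
by rewrite -ee Ee mulrA -[b * x * b]mulrA -mulrA x0 mulr0.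
Qed.

(** The right ideal property gives [e * h = e * h * e] and [e * a * (1 - e) = 0]. The remaining
    defect [(1 - e) * h * e] then vanishes by semiprimeness. *)
Lemma ideal_central_idem U : stable (@amull _ A) U -> stable (@amulr _ A) U ->
  exists e, [/\ e \in U, forall x, e * x = x * e & forall x, x \in U -> x * e = x].
Proof.
move=> sL sR; have [e [Ue ee xe]] := left_ideal_idem sL.
exists e; split=> // h.
have Eeh : e * h * e = e * h by rewrite xe // -amulrE sR.
rewrite -Eeh; apply/eqP; rewrite eq_sym -subr_eq0; apply/eqP.
have -> : h * e - e * h * e = (1 - e) * h * e by rewrite mulrBl mul1r mulrBl.
apply: mulr_mull_eq0 => a.
have -> : (1 - e) * h * e * a * ((1 - e) * h * e) = (1 - e) * h * (e * a * (1 - e)) * h * e.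
  by rewrite !mulrA.
have -> : e * a * (1 - e) = 0.
  by rewrite mulrBr mulr1 xe ?subrr // -amulrE sR.
by rewrite mulr0 !mul0r.
Qed.

Definition mulLR x y : 'End(A) := (amull x \o amulr y)%VF.

Lemma mulLRE x y z : mulLR x y z = x * z * y.
Proof. by rewrite comp_lfunE amullE amulrE mulrA. Qed.

Definition tracial (f : 'Hom(A, k^o)) := forall x y, f (x * y) = f (y * x).

Lemma mulLR_idem e f : e * e = e -> f * f = f -> lftr (mulLR e f) = (\dim (limg (mulLR e f)))%:R.
Proof.
move=> ee ff; apply: lftr_idem; apply/lfunP=> x.
by rewrite [LHS]comp_lfunE !mulLRE !mulrA ee -mulrA ff.
Qed.

Lemma lftr_mulLR_tracial e x y : lftr (mulLR (x * y) e) = lftr (mulLR (y * x) e).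
Proof.
have -> : mulLR (x * y) e = (amull x \o mulLR y e)%VF.
  by apply/lfunP=> z; rewrite [RHS]comp_lfunE !mulLRE ?amullE ?mulLRE !mulrA.
have -> : mulLR (y * x) e = (mulLR y e \o amull x)%VF.
  by apply/lfunP=> z; rewrite [RHS]comp_lfunE !mulLRE ?amullE ?mulLRE !mulrA.
exact: lftrC.
Qed.

Fact lftr_mulLR_linear e : linear (fun x => lftr (mulLR x e) : k^o).
Proof.
move=> a x y; rewrite /= -lftrP; congr lftr; apply/lfunP=> z.
by rewrite lfunPl !mulLRE !mulPl.
Qed.

(* The character of the left ideal generated by an idempotent [e]. *)
Definition idem_char e : 'Hom(A, k^o) :=
  linfun (HB.pack_for {linear A -> k^o} (fun x => lftr (mulLR x e) : k^o)
    (GRing.isLinear.Build k A k^o *:%R _ (lftr_mulLR_linear e))).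

Lemma idem_charE e x : idem_char e x = lftr (mulLR x e).
Proof. by rewrite /idem_char lfunE. Qed.

Lemma idem_char_tracial e : tracial (idem_char e).
Proof. by move=> x y; rewrite !idem_charE lftr_mulLR_tracial. Qed.

(** Primitivity is expressed by a scalar corner [e A e], which is its usual consequence over an
    algebraically closed field and the form used in computations. *)
Definition primitive_idem e := [/\ e != 0, e * e = e & forall x, exists c : k, e * x * e = c *: e].

(** A minimal left ideal inside [A f] is generated by an idempotent [e0]. Replacing it by [f * e0]
    keeps the ideal and makes [f] act as a unit on both sides; Schur's lemma makes the corner
    scalar. *)
Lemma exists_primitive f : f != 0 -> f * f = f ->
  exists e, [/\ primitive_idem e, e * f = e & f * e = e].
Proof.
move=> nzf ff.
have sU : stable (@amull _ A) (limg (amulr f)).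
  move=> a _ /memv_imgP[y _ ->]; rewrite !amulrE amullE mulrA -amulrE.
  exact/memv_img/memvf.
have nzU : limg (amulr f) != 0%VS.
  apply: contra nzf => /eqP U0; rewrite -memv0 -U0 -[X in X \in _]mul1r -amulrE.
  exact/memv_img/memvf.
have [M minM leMU] := exists_minimal sU nzU; have [sM nzM MM] := minM.
have [e0 [Me0 ee0 xe0]] := left_ideal_idem sM.
have Mf x : x \in M -> x * f = x.
  by move=> /(subvP leMU)/memv_imgP[y _ ->]; rewrite amulrE -mulrA ff.
pose e := f * e0.
have Me : e \in M by rewrite /e -amullE sM.
have e0e : e0 * e = e0 by rewrite /e mulrA Mf.
have ee : e * e = e by rewrite {1}/e -mulrA e0e.
exists e; split; [split=> // | exact: Mf | by rewrite /e mulrA ff].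
  apply: contra nzM => e00; rewrite -subv0; apply/subvP=> x Mx.
  by rewrite -(xe0 x Mx) -e0e (eqP e00) !mulr0 mem0v.
move=> x.
have [c cP] : exists c : k, forall u, u \in M -> amulr (x * e) u = c *: u.
  apply: (schur minM) => [u Mu|a u Mu]; first by rewrite amulrE mulrA -amullE sM.
  by rewrite !amulrE !amullE !mulrA.
by exists c; rewrite -cP // amulrE mulrA.
Qed.

Lemma primitive_sum : exists s : seq A,
  (forall e, e \in s -> primitive_idem e) /\ 1 = \sum_(e <- s) e.
Proof.
suff S f : f * f = f -> exists s : seq A,
  (forall e, e \in s -> primitive_idem e) /\ f = \sum_(e <- s) e by apply: S; rewrite mulr1.
elim: {f}(\dim (limg (amulr f))).+1 {-2}f (ltnSn (\dim (limg (amulr f)))) => [|n IHn] f.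
  by rewrite ltn0.
move=> ltf ff; have [->|nzf] := eqVneq f 0; first by exists [::]; rewrite big_nil.
have [e [pe ef fe]] := exists_primitive nzf ff; have [nze ee _] := pe.
have gg : (f - e) * (f - e) = f - e.
  by rewrite mulrBl !mulrBr ff ef fe ee subrr subr0.
have [|s [ps Es]] := IHn (f - e) _ gg; last first.
  exists (e :: s); rewrite big_cons -Es addrC subrK; split=> // e'.
  by rewrite inE => /orP[/eqP->|/ps].
rewrite -ltnS; apply: leq_trans ltf; rewrite ltnS.
have le : (limg (amulr (f - e)) <= limg (amulr f))%VS.
  apply/subvP=> _ /memv_imgP[y _ ->]; rewrite amulrE.
  have -> : y * (f - e) = amulr f (y * (f - e)) by rewrite amulrE -mulrA mulrBl ff ef.
  exact/memv_img/memvf.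
rewrite ltn_neqAle dimvS // andbT; apply: contra nze => /eqP E.
have: e \in limg (amulr f) by rewrite -ef -amulrE memv_img ?memvf.
have -> : limg (amulr f) = limg (amulr (f - e)) by apply/eqP; rewrite eq_sym eqEdim le E leqnn.
case/memv_imgP=> y _; rewrite amulrE => Ey.
by rewrite -ee {1}Ey -mulrA mulrBl fe ee subrr mulr0.
Qed.

(** A non-zero [e * x * f] is an isomorphism between the simple modules [A e] and [A f], and [a],
    [b] are this map and its inverse. Tracial functionals therefore agree on [e] and [f]. *)
Lemma primitive_linked e f x : primitive_idem e -> primitive_idem f -> e * x * f != 0 ->
  exists a b, a * b = e /\ b * a = f.
Proof.
move=> [nze ee pe] [nzf ff pf] nzx.
have [u Eu] : exists u, u = e * x * f by exists (e * x * f).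
rewrite -Eu in nzx *.
have eu : e * u = u by rewrite Eu !mulrA ee.
have uf : u * f = u by rewrite Eu -mulrA ff.
have [g [b [_ Eg ug]]] := principal_idem u.
have uvu : u * (f * b * e) * u = u.
  have -> : u * (f * b * e) * u = u * f * (b * (e * u)) by rewrite !mulrA.
  by rewrite eu uf -Eg.
have scal (c : k) : c *: u = u -> c = 1.
  move/eqP; rewrite -subr_eq0 -{2}[u]scale1r -scalerBl scaler_eq0 (negPf nzx) orbF.
  by rewrite subr_eq0 => /eqP.
exists u, (f * b * e); split.
  have [c Ec] := pe (x * f * f * b); have Euv : u * (f * b * e) = c *: e by rewrite -Ec Eu !mulrA.
  by rewrite Euv (scal c) ?scale1r //; move: uvu; rewrite Euv -scalerAl eu.
have [c Ec] := pf (b * e * e * x); have Evu : f * b * e * u = c *: f by rewrite -Ec Eu !mulrA.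
by rewrite Evu (scal c) ?scale1r //; move: uvu; rewrite -mulrA Evu -scalerAr uf.
Qed.

Lemma primitive_link_sym e f x : primitive_idem e -> primitive_idem f -> e * x * f != 0 ->
  exists y, f * y * e != 0.
Proof.
move=> pe pf nz; have [a [b [ab ba]]] := primitive_linked pe pf nz.
have [nze ee _] := pe; have [_ ff _] := pf.
exists b; apply: contra nze => /eqP fbe.
have -> : e = a * (f * b * e).
  by rewrite -ba !mulrA ab -[e * a * b]mulrA ab !ee.
by rewrite fbe mulr0.
Qed.

Lemma tracial_linked e f x phi : primitive_idem e -> primitive_idem f -> e * x * f != 0 ->
  tracial phi -> phi e = phi f.
Proof.
move=> pe pf nz tr_phi; have [a [b [<- <-]]] := primitive_linked pe pf nz.
exact: tr_phi.
Qed.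

Lemma tracial_primitive e phi : primitive_idem e -> tracial phi ->
  forall x, exists c : k, phi (x * e) = c * phi e.
Proof.
move=> [_ ee pe] tr_phi x; have [c Ec] := pe x; exists c.
by rewrite -[X in x * X]ee mulrA tr_phi mulrA Ec linearZ.
Qed.

Lemma idem_char_primitive e : primitive_idem e -> idem_char e e = 1.
Proof.
move=> [nze ee pe]; rewrite idem_charE mulLR_idem //.
suff -> : limg (mulLR e e) = <[e]>%VS by rewrite dim_vline nze.
apply/eqP; rewrite eqEsubv; apply/andP; split.
  apply/subvP=> _ /memv_imgP[x _ ->]; rewrite mulLRE.
  by have [c ->] := pe x; rewrite memvZ ?memv_line.
by rewrite -memvE; apply/memv_imgP; exists e; rewrite ?memvf // mulLRE !ee.
Qed.

Lemma idem_char_unlinked e f : (forall x, e * x * f = 0) -> idem_char f e = 0.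
Proof.
move=> ef; rewrite idem_charE (_ : mulLR e f = 0) ?lftr0 //.
by apply/lfunP=> x; rewrite mulLRE ef zero_lfunE.
Qed.

(** One primitive idempotent is kept for each class of simple modules, so the [idem_char (e i)] are
    the irreducible characters. They span the tracial functionals, because such a functional is
    determined by its values at the [e i], and characters take the values 0 and 1 there. *)
Lemma primitive_representatives : exists r (e : 'I_r -> A), [/\ forall i, primitive_idem (e i),
   forall i j, i != j -> forall x, e i * x * e j = 0
 & forall phi, tracial phi -> forall x, phi x = \sum_i phi (e i) * idem_char (e i) x].
Proof.
have [s [ps Es]] := primitive_sum.
have [t [pt ut lt]] : exists t : seq A, [/\ forall e, e \in t -> primitive_idem e,
    forall i j, (i < size t)%N -> (j < size t)%N -> i != j -> forall x, t`_i * x * t`_j = 0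
  & forall e, e \in s -> exists f x, f \in t /\ e * x * f != 0].
  elim: s ps {Es} => [|e s IHs] ps; first by exists [::]; split=> // e; rewrite in_nil.
  have [|t [pt ut lt]] := IHs; first by move=> f sf; apply: ps; rewrite inE sf orbT.
  have pe : primitive_idem e by apply: ps; rewrite mem_head.
  have [[f [x [tf nz]]]|no] := classic (exists f x, f \in t /\ e * x * f != 0).
    exists t; split=> // g; rewrite inE => /orP[/eqP->|]; last exact: lt.
    by exists f, x.
  have no1 f x : f \in t -> e * x * f = 0.
    by move=> tf; apply/eqP; apply: contra_notT no => nz; exists f, x.
  have no2 f x : f \in t -> f * x * e = 0.
    move=> tf; apply/eqP; apply: contra_notT no => nz.
    by have [y] := primitive_link_sym (pt f tf) pe nz; exists f, y.
  exists (e :: t); split=> [f|[|i] [|j] //= lti ltj neij x|f].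
  - by rewrite inE => /orP[/eqP->|/pt].
  - by rewrite no1 // mem_nth.
  - by rewrite no2 // mem_nth.
  - exact: ut.
  rewrite inE => /orP[/eqP->|/lt[g [x [tg nz]]]].
    exists e, 1; rewrite mem_head mulr1; case: pe => nze -> _; split=> //.
  by exists g, x; rewrite inE tg orbT.
exists (size t), (fun i => t`_i); split=> [i|i j neij x|phi tr_phi].
- by apply: pt; rewrite mem_nth.
- exact: ut.
pose psi := phi - \sum_(i < size t) phi t`_i *: idem_char t`_i.
have psiE y : psi y = phi y - \sum_(i < size t) phi t`_i * idem_char t`_i y.
  rewrite /psi add_lfunE opp_lfunE sum_lfunE; congr (_ - _).
  by apply: eq_bigr => i _; rewrite scale_lfunE.
have tr_psi : tracial psi.
  move=> y z; rewrite !psiE tr_phi; congr (_ - _); apply: eq_bigr => i _.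
  by rewrite idem_char_tracial.
have psi_t (i : 'I_(size t)) : psi t`_i = 0.
  rewrite psiE (bigD1 i) //= idem_char_primitive ?mulr1; last by apply: pt; rewrite mem_nth.
  rewrite big1 ?addr0 ?subrr // => j neji.
  rewrite idem_char_unlinked ?mulr0 // => y; apply: ut => //.
  by rewrite eq_sym.
suff psi0 y : psi y = 0 by move=> x; apply/eqP; rewrite -subr_eq0 -psiE psi0.
rewrite -[y]mulr1 Es mulr_sumr linear_sum big_seq big1 //= => e se.
have [c ->] := tracial_primitive (ps e se) tr_psi y.
have [f [x [tf nz]]] := lt e se.
rewrite (tracial_linked (ps e se) (pt f tf) nz tr_psi).
have := psi_t (Ordinal (_ : index f t < size t)%N); rewrite /= nth_index //.
by rewrite index_mem => /(_ tf) ->; rewrite mulr0.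
Qed.

(** The idempotent generating the left ideal of [x] would have trace 0, hence rank 0 in
    characteristic 0. *)
Lemma regular_trace_nondeg x : (forall y, lftr (amull (x * y)) = 0) -> x = 0.
Proof.
move=> x0; have [e [b [ee Eb xe]]] := principal_idem x.
have : lftr (amull e) = 0.
  rewrite Eb -(x0 b); have E (u v : A) : amull (u * v) = (amull u \o amull v)%VF.
    by apply/lfunP=> z; rewrite [RHS]comp_lfunE !amullE mulrA.
  by rewrite !E lftrC.
rewrite lftr_idem; last by apply/lfunP=> z; rewrite [LHS]comp_lfunE !amullE mulrA ee.
move/eqP; rewrite natr_eq0_char0 dimv_eq0 => /eqP E0.
suff e0 : e = 0 by rewrite -xe e0 mulr0.
by apply/eqP; rewrite -memv0 -E0 -[X in X \in _]mulr1 -amullE memv_img ?memvf.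
Qed.

End SemisimpleAlgebra.

(** * Grouplike elements *)

Section Grouplike.
Variables (k : fieldType) (H : hopfAlgType k).
Implicit Types (x y g h : H).
Local Notation S := (@antipode k H).

Definition grouplike g := comul g = g ⊗ g /\ counit g = 1.

Lemma sw_grouplike (V : vectType k) (F : H -> H -> V) g : grouplike g -> bilin F ->
  \sw_(a, b <- g) F a b = F g g.
Proof. by case=> -> _ F2; rewrite tliftE. Qed.

Lemma grouplike1 : grouplike (1 : H).
Proof. by split; [exact: comul1 | exact: counit1]. Qed.

Lemma grouplikeM g h : grouplike g -> grouplike h -> grouplike (g * h).
Proof.
move=> [cg eg] [ch eh]; split; first by rewrite comulM cg ch tmulE.
by rewrite counitM eg eh mulr1.
Qed.

Lemma grouplikeX g m : grouplike g -> grouplike (g ^+ m).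
Proof.
move=> gg; elim: m => [|m IHm]; first by rewrite expr0; apply: grouplike1.
by rewrite exprS; apply: grouplikeM.
Qed.

Lemma grouplike_mulV g : grouplike g -> g * S g = 1.
Proof.
move=> gg; have := antipoder g; rewrite sw_grouplike //; last by bil_tac.
by case: gg => _ ->; rewrite scale1r.
Qed.

Lemma grouplike_mulVl g : grouplike g -> S g * g = 1.
Proof.
move=> gg; have := antipodel g; rewrite sw_grouplike //; last by bil_tac.
by case: gg => _ ->; rewrite scale1r.
Qed.

Lemma grouplike_neq0 g : grouplike g -> g != 0.
Proof.
by case=> _ eg; apply: contra_eq_neq eg => ->; rewrite linear0 eq_sym oner_eq0.
Qed.

(** If [g] is a combination of the others, contracting its coproduct with the [i]-th coordinate [c]
    in two ways gives [c g *: g = c g *: s_i]. A non-zero coefficient would make [g] equal to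
    [s_i]. *)
Lemma grouplike_free (s : seq H) : uniq s -> (forall g, g \in s -> grouplike g) -> free s.
Proof.
elim: s => [|g s IHs] /=; first by rewrite nil_free.
case/andP=> ngs us gs; have gg := gs g (mem_head _ _).
have fs : free s by apply: IHs => // h sh; apply: gs; rewrite inE sh orbT.
rewrite free_cons fs andbT; apply/negP=> spang.
have Eg : g = \sum_(i < size s) coord (in_tuple s) i g *: s`_i := coord_span (X := in_tuple s) spang.
have nzg := grouplike_neq0 gg.
suff c0 (i : 'I_(size s)) : coord (in_tuple s) i g = 0.
  by move: nzg; rewrite Eg big1 ?eqxx // => i _; rewrite c0 scale0r.
pose c : 'Hom(H, k^o) := linfun (coord (in_tuple s) i : H -> k^o).
have cE x : c x = coord (in_tuple s) i x by rewrite lfunE.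
have cj (j : 'I_(size s)) : c s`_j = (j == i)%:R by rewrite cE (coord_free j i (X := in_tuple s)).
have gj (j : 'I_(size s)) : grouplike s`_j.
  by apply: gs; rewrite inE mem_nth ?orbT.
have E1 : \sw_(a, b <- g) ((c a : k) *: b) = (c g : k) *: g by rewrite sw_grouplike //; bil_tac.
have E2 : \sw_(a, b <- g) ((c a : k) *: b) = (c g : k) *: s`_i.
  rewrite [in LHS]Eg !linear_sum (bigD1 i) //= linearZ /= linearZ /= sw_grouplike //; last by bil_tac.
  rewrite cj eqxx scale1r big1 ?addr0 ?cE // => j /negPf nji.
  by rewrite linearZ /= linearZ /= sw_grouplike ?cj ?nji ?scale0r ?scaler0 //; bil_tac.
apply/eqP; rewrite -cE; apply: contraNT ngs => nzc.
have /(scalerI nzc) -> : (c g : k) *: g = (c g : k) *: s`_i by rewrite -E1 E2.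
exact: mem_nth.
Qed.

Lemma grouplike_order g : grouplike g -> exists2 m, (0 < m)%N & g ^+ m = 1.
Proof.
move=> gg; pose n := \dim {:H}; pose s := [seq g ^+ i | i <- iota 0 n.+1].
have : ~~ uniq s.
  apply/negP=> /grouplike_free free_s.
  have /free_s : forall h, h \in s -> grouplike h.
    by move=> _ /mapP[i _ ->]; apply: grouplikeX.
  rewrite /free => /eqP E; have := dimvS (subvf <<s>>%VS).
  by rewrite E size_map size_iota ltnn.
case/(uniqPn 0) => i [j [ltij ltj]].
rewrite size_map size_iota in ltj.
rewrite !(nth_map 0%N) ?size_iota ?nth_iota ?add0n // 1?(ltn_trans ltij) // => E.
exists (j - i)%N; first by rewrite subn_gt0.
have := congr1 (fun x => S (g ^+ i) * x) E.
rewrite grouplike_mulVl; last exact: grouplikeX.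
move=> ->; rewrite -[in g ^+ j](subnKC (ltnW ltij)) exprD mulrA.
by rewrite grouplike_mulVl ?mul1r //; apply: grouplikeX.
Qed.
End Grouplike.

(** * Integrals of a semisimple Hopf algebra and of its dual *)

Section Integral.
Variables (k : closedFieldType) (H : hopfAlgType k).
Hypothesis ssH : semisimple_algebra H.
Implicit Types (V : vectType k) (x y g h : H).
Local Notation S := (@antipode k H).

Definition integral (Lam : H) :=
  [/\ counit Lam = 1, forall h, h * Lam = counit h *: Lam & forall h, Lam * h = counit h *: Lam].

(** The augmentation ideal has a central idempotent [e] as unit, and [1 - e] is the integral. *)
Lemma exists_integral : exists Lam, integral Lam.
Proof.
have [||e [Ke ce Ue]] := ideal_central_idem ssH (U := lker counit).
- by move=> a x; rewrite !memv_ker amullE counitM => /eqP->; rewrite mulr0.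
- by move=> a x; rewrite !memv_ker amulrE counitM => /eqP->; rewrite mul0r.
have hL h : h * (1 - e) = counit h *: (1 - e).
  have: h - counit h *: 1 \in lker counit.
    by rewrite memv_ker linearB linearZ /= counit1 /GRing.scale /= mulr1 subrr.
  move/Ue; rewrite mulrBl -scalerAl mul1r mulrBr mulr1 scalerBr => /eqP.
  by rewrite subr_eq => /eqP->; rewrite !opprD opprK !addrA subrr add0r.
exists (1 - e); split=> // [|h].
  by move: Ke; rewrite memv_ker linearB /= counit1 => /eqP->; rewrite subr0.
by rewrite -hL mulrBl mul1r ce mulrBr mulr1.
Qed.

Variable Lam : H.
Hypothesis intL : integral Lam.

Lemma counit_integral : counit Lam = 1. Proof. by case: intL. Qed.
Lemma integral_mull h : h * Lam = counit h *: Lam. Proof. by case: intL. Qed.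
Lemma integral_mulr h : Lam * h = counit h *: Lam. Proof. by case: intL. Qed.

(** Up to the antipode, the coproduct of [Lam] is a Casimir element: a factor crosses from one leg
    to the other. The sum over [h] with [S c] in front and [d * Lam] inside is evaluated by the
    integral property and by the antipode axiom. *)
Lemma casimirl V (F : H -> H -> V) h : bilin F ->
  \sw_(a, b <- Lam) F a (h * b) = \sw_(a, b <- Lam) F (S h * a) b.
Proof.
move=> F2; pose G c x := \sw_(a, b <- x) F (c * a) b.
transitivity (\sw_(c, d <- h) G (S c) (d * Lam)); last first.
  under eq_tlift => c d do rewrite integral_mull /G !linearZ /=.
  by rewrite /= (sw_counitr (F := fun c => G (S c) Lam)) // /G; lin_tac.
symmetry; under eq_tlift => c d.
  rewrite /G sw_mul; last by bil_tac.
  under eq_tlift => c' d' do under eq_tlift => a b do rewrite mulrA.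
  over.
rewrite /= -(sw_coassoc (F := fun c c' d' => \sw_(a, b <- Lam) F (S c * c' * a) (d' * b))); last by tri_tac.
under eq_tlift => c d.
  rewrite (sw_antipodel (F := fun u => \sw_(a, b <- Lam) F (u * a) (d * b))); last by lin_tac.
  under eq_tlift => a b do rewrite mul1r.
  over.
by rewrite /= (sw_counitl (F := fun d => \sw_(a, b <- Lam) F a (d * b))) //; lin_tac.
Qed.

Lemma casimirr V (F : H -> H -> V) h : bilin F ->
  \sw_(a, b <- Lam) F (a * h) b = \sw_(a, b <- Lam) F a (b * S h).
Proof.
move=> F2; pose G c x := \sw_(a, b <- x) F a (b * c).
transitivity (\sw_(c, d <- h) G (S d) (Lam * c)); last first.
  under eq_tlift => c d do rewrite integral_mulr /G !linearZ /=.
  by rewrite /= (sw_counitl (F := fun c => G (S c) Lam)) // /G; lin_tac.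
symmetry; under eq_tlift => c d.
  rewrite /G sw_mul; last by bil_tac.
  rewrite tlift_swap; under eq_tlift => c' d' do under eq_tlift => a b do rewrite -mulrA.
  over.
rewrite /= (sw_coassoc (F := fun c c' d' => \sw_(a, b <- Lam) F (a * c) (b * (c' * S d')))); last by tri_tac.
under eq_tlift => c d.
  rewrite (sw_antipoder (F := fun u => \sw_(a, b <- Lam) F (a * c) (b * u))); last by lin_tac.
  under eq_tlift => a b do rewrite mulr1.
  over.
by rewrite /= (sw_counitr (F := fun c => \sw_(a, b <- Lam) F (a * c) b)) //; lin_tac.
Qed.

(** The kernel is a two-sided ideal with central unit [e]. The sum of [S a * (e * b)] over the
    coproduct of [Lam] is [e], while [casimirl] turns its factor [e] into [S e = 0]. *)
Lemma antipode_inj : lker S == 0%VS.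
Proof.
have [||e [Ke ce Ue]] := ideal_central_idem ssH (U := lker S).
- by move=> a x; rewrite !memv_ker amullE antipodeM => /eqP->; rewrite mul0r.
- by move=> a x; rewrite !memv_ker amulrE antipodeM => /eqP->; rewrite mulr0.
have e0 : e = 0.
  transitivity (\sw_(a, b <- Lam) (S a * (e * b))).
    symmetry; under eq_tlift => a b do rewrite mulrA -ce -mulrA.
    rewrite (sw_antipodel (F := fun u => e * u)); last by lin_tac.
    by rewrite mulr1 counit_integral scale1r.
  rewrite (casimirl (F := fun a b => S a * b)); last by bil_tac.
  move: Ke; rewrite memv_ker => /eqP->.
  under eq_tlift => a b do rewrite mul0r linear0 mul0r.
  exact: tlift_0.
by rewrite -subv0; apply/subvP=> x /Ue <-; rewrite e0 mulr0 mem0v.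
Qed.

Definition antipodeV := (S^-1)%VF.
Local Notation T := antipodeV.

Lemma antipodeVK x : S (T x) = x.
Proof. by rewrite /antipodeV (lker0_lfunVK antipode_inj). Qed.

Lemma antipodeKV x : T (S x) = x.
Proof. by rewrite /antipodeV (lker0_lfunK antipode_inj). Qed.

Lemma antipodeI : injective S. Proof. exact: can_inj antipodeKV. Qed.

Lemma antipodeVM x y : T (x * y) = T y * T x.
Proof. by apply: antipodeI; rewrite antipodeM !antipodeVK. Qed.

Lemma antipodeV1 : T 1 = 1.
Proof. by apply: antipodeI; rewrite antipode1 antipodeVK. Qed.

Lemma counit_antipodeV x : counit (T x) = counit x.
Proof. by rewrite -[RHS](congr1 _ (antipodeVK x)) counit_antipode. Qed.

Lemma sw_antipodeVl V (F : H -> V) x : islin F ->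
  \sw_(a, b <- x) F (b * T a) = counit x *: F 1.
Proof.
move=> FL; rewrite -[in RHS]antipodeV1 -(sw_antipoder (F := fun u => F (T u))); last by lin_tac.
by apply: eq_tlift => a b; rewrite antipodeVM antipodeKV.
Qed.

Lemma sw_antipodeVr V (F : H -> V) x : islin F ->
  \sw_(a, b <- x) F (T b * a) = counit x *: F 1.
Proof.
move=> FL; rewrite -[in RHS]antipodeV1 -(sw_antipodel (F := fun u => F (T u))); last by lin_tac.
by apply: eq_tlift => a b; rewrite antipodeVM antipodeKV.
Qed.

Lemma antipode_integral : S Lam = Lam.
Proof.
have E h : S Lam * h = counit h *: S Lam.
  by rewrite -{1}(antipodeVK h) -antipodeM integral_mull linearZ counit_antipodeV.
rewrite -[LHS]scale1r -[1 in LHS]counit_integral -E integral_mull.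
by rewrite counit_antipode counit_integral scale1r.
Qed.

(** An explicit integral of the dual Hopf algebra, as the trace of multiplication twisted by the
    inverse of $S^2$. It becomes the regular character once $S^2=1$. *)
Definition coint_fun x : k^o := lftr (amull x \o (T \o T))%VF.
Fact coint_fun_is_linear : linear coint_fun.
Proof.
move=> a x y; rewrite /coint_fun /= -lftrP; congr lftr; apply/lfunP=> z.
by rewrite lfunPl !comp_lfunE !amullE mulPl.
Qed.
HB.instance Definition _ := GRing.isLinear.Build k H k^o *:%R coint_fun coint_fun_is_linear.
Definition coint : 'Hom(H, k^o) := linfun coint_fun.

Lemma cointE x : coint x = \sum_i vcoord i (x * T (T (vbasis {:H})`_i)).
Proof.
rewrite [LHS]lfunE /= /coint_fun /lftr; apply: eq_bigr => i _.
by rewrite !comp_lfunE amullE vcoordE.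
Qed.

(** The two factors [T] in [coint_fun] are chosen for this: [casimirr] applies [S], cancelling one
    of them, and summing over the basis leaves [b * T a], which contracts to the counit. *)
Lemma coint_integral : \sw_(a, b <- Lam) ((coint a : k) *: b) = 1.
Proof.
under eq_tlift => a b do rewrite cointE scaler_suml.
rewrite tlift_sum; under eq_bigr => i _.
  rewrite (casimirr (F := fun a b => (vcoord i a : k) *: b)) ?antipodeVK; last by bil_tac.
  over.
rewrite -tlift_sum /=.
transitivity (\sw_(a, b <- Lam) (b * T a)); last first.
  by rewrite (sw_antipodeVl (F := fun u => u)) ?counit_integral ?scale1r.
apply: eq_tlift => a b; rewrite [in RHS](coord_vbasis (memvf a)) linear_sum mulr_sumr.
by apply: eq_bigr => i _; rewrite linearZ /= -scalerAr vcoordE.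
Qed.

Lemma coint_mulr h : \sw_(a, b <- Lam) ((coint (a * h) : k) *: b) = S h.
Proof.
rewrite (casimirr (F := fun a b => (coint a : k) *: b)); last by bil_tac.
under eq_tlift => a b do rewrite scalerAl.
by rewrite -(lin_tlift (h := fun u => u * S h)) ?coint_integral ?mul1r //; lin_tac.
Qed.

Lemma coint_mull h : \sw_(a, b <- Lam) ((coint (S h * a) : k) *: b) = h.
Proof.
rewrite -(casimirl (F := fun a b => (coint a : k) *: b)); last by bil_tac.
under eq_tlift => a b do rewrite scalerAr.
by rewrite -(lin_tlift (h := fun u => h * u)) ?coint_integral ?mulr1 //; lin_tac.
Qed.

Lemma coint_nondegl h : (forall x, coint (h * x) = 0) -> h = 0.
Proof.
move=> h0; rewrite -[h]antipodeVK -[T h]coint_mull antipodeVK.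
by under eq_tlift => a b do rewrite h0 scale0r; rewrite tlift_0 linear0.
Qed.

Lemma coint_nondegr h : (forall x, coint (x * h) = 0) -> h = 0.
Proof.
move=> h0; apply: antipodeI; rewrite linear0 -[S h]coint_mulr.
by under eq_tlift => a b do rewrite h0 scale0r; rewrite tlift_0.
Qed.

(** Contraction with [Lam] reaches every [h], as the image of [coint (S h * _)]; it is injective
    because the dual has the same dimension. *)
Lemma integral_functional_inj (f : 'Hom(H, k^o)) :
  \sw_(a, b <- Lam) ((f a : k) *: b) = 0 -> f = 0.
Proof.
pose theta_fun (f : 'Hom(H, k^o)) := \sw_(a, b <- Lam) ((f a : k) *: b).
have thL : linear theta_fun by rewrite /theta_fun; lin_tac.
pose theta := linfun (HB.pack_for {linear 'Hom(H, k^o) -> H} theta_fun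
  (GRing.isLinear.Build k 'Hom(H, k^o) H *:%R _ thL)).
have thE (u : 'Hom(H, k^o)) : theta u = theta_fun u by rewrite lfunE.
have thT : limg theta = fullv.
  apply/eqP; rewrite eqEsubv subvf; apply/subvP=> h _.
  rewrite -(coint_mull h); apply/memv_imgP; exists (coint \o amull (S h))%VF; first exact: memvf.
  by rewrite thE; apply: eq_tlift => a b; rewrite comp_lfunE amullE.
have dimD : \dim {: 'Hom(H, k^o)} = \dim {:H} by rewrite !dimvf; apply: muln1.
have := limg_ker_dim theta fullv; rewrite thT dimD -[RHS]add0n => /addIn/eqP.
rewrite dimv_eq0 capfv => /eqP K0 f0; apply/eqP.
by rewrite -memv0 -K0 memv_ker thE; apply/eqP.
Qed.

Lemma integral_functional_ext (f f' : 'Hom(H, k^o)) :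
  \sw_(a, b <- Lam) ((f a : k) *: b) = \sw_(a, b <- Lam) ((f' a : k) *: b) -> f = f'.
Proof.
move=> E; apply/eqP; rewrite -subr_eq0; apply/eqP/integral_functional_inj.
pose F (u : 'Hom(H, k^o)) := \sw_(a, b <- Lam) ((u a : k) *: b).
have FL : linear F by rewrite /F; lin_tac.
have EF : F (f - f') = F f - F f' by rewrite addrC -scaleN1r FL scaleN1r addrC.
by rewrite -[LHS]/(F _) EF /F E subrr.
Qed.

Lemma coint_Lam : coint Lam = 1.
Proof.
have := congr1 counit coint_integral; rewrite counit1 lfun_tlift => <-.
rewrite -[in LHS](counitr Lam) lfun_tlift; apply: eq_tlift => a b.
by rewrite !linearZ; apply: mulrC.
Qed.

(** The Nakayama automorphism of the Frobenius form [coint] is [S^2]: as functions of [x], both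
    sides contract with [Lam] to [S y]. *)
Lemma coint_mulC x y : coint (x * y) = coint (S (S y) * x).
Proof.
have E : (coint \o amulr y = coint \o amull (S (S y)))%VF.
  apply: integral_functional_ext.
  under eq_tlift => a b do rewrite comp_lfunE amulrE.
  under [RHS]eq_tlift => a b do rewrite comp_lfunE amullE.
  by rewrite coint_mulr coint_mull.
by have /lfunP/(_ x) := E; rewrite !comp_lfunE amulrE amullE.
Qed.

(* The trace formula coming from the dual bases [coint (S _ * Lam_1)] and [Lam_2]. *)
Lemma lftr_integral (A : 'End(H)) : lftr A = \sw_(a, b <- Lam) (coint (S (A b) * a) : k^o).
Proof.
apply: (lftr_tens (B := fun x a => coint (S x * a))) => [|x]; first by bil_tac.
by rewrite coint_mull.
Qed.

Lemma coint1 : coint 1 = lftr (S \o S)%VF.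
Proof.
rewrite lftr_integral; under eq_tlift => a b do rewrite comp_lfunE -coint_mulC.
rewrite (sw_antipoder (F := coint)); last by lin_tac.
by rewrite counit_integral scale1r.
Qed.
End Integral.

(** * The distinguished grouplike element and the fourth power of the antipode *)

Section Distinguished.
Variables (k : closedFieldType) (H : hopfAlgType k).
Hypothesis ssH : semisimple_algebra H.
Implicit Types (V : vectType k) (x y h : H).
Local Notation S := (@antipode k H).
Local Notation T := (@antipodeV k H).
Local Notation D := (dual_hopf H).
Variable Lam : H.
Hypothesis intL : integral Lam.
Local Notation lam := (coint H : D).

Lemma sw_dual_mul (u f : D) x :
  \sw_(a, b <- x) (((u * f) a : k) *: b) =
  \sw_(c, d <- \sw_(a, b <- x) ((u a : k) *: b)) ((f c : k) *: d).
Proof.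
under eq_tlift => a b do rewrite dual_mulE.
rewrite (lin_tlift (h := fun y => \sw_(c, d <- y) ((f c : k) *: d))); last by lin_tac.
transitivity (\sw_(a, b <- x) \sw_(c, d <- a) (((u c : k) * (f d : k)) *: b)).
  apply: eq_tlift => a b.
  by rewrite (lin_tlift (h := fun c : k^o => (c : k) *: b)) //; lin_tac.
rewrite (sw_coassoc (F := fun c d b => ((u c : k) * (f d : k)) *: b)); last by tri_tac.
apply: eq_tlift => a b; rewrite !linearZ /= -swZ.
by apply: eq_tlift => c d; rewrite scalerA.
Qed.

Lemma coint_left (f : D) : lam * f = (f 1 : k) *: lam.
Proof.
apply: (integral_functional_ext ssH intL); rewrite sw_dual_mul (coint_integral ssH intL).
rewrite sw_1; last by bil_tac.
under [RHS]eq_tlift => a b do rewrite scale_lfunE -scalerA.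
by rewrite swZ (coint_integral ssH intL).
Qed.

(** Integrals of the dual form a line: the contraction [y] of [Lam] with [mu] is shown to be the
    scalar [counit y], which is [mu Lam]. *)
Lemma coint_unique (mu : D) : (forall f : D, mu * f = (f 1 : k) *: mu) ->
  mu = (mu Lam : k) *: lam.
Proof.
move=> muP; apply: (integral_functional_ext ssH intL).
under [RHS]eq_tlift => a b do rewrite scale_lfunE -scalerA.
rewrite swZ (coint_integral ssH intL); set y := tlift _ _.
have ey : counit y = mu Lam.
  rewrite /y lfun_tlift -[in RHS](counitr Lam) lfun_tlift; apply: eq_tlift => a b.
  by rewrite !linearZ; apply: mulrC.
rewrite -ey; apply/eqP; rewrite -subr_eq0; apply/eqP/functional_sep => f.
have := congr1 counit (esym (sw_dual_mul mu (f : D) Lam)); rewrite -/y muP.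
rewrite lfun_tlift; under eq_tlift => c d do rewrite linearZ.
have -> : tlift (fun c d => f c *: counit d) (comul y) = f y.
  rewrite -[in RHS](counitr y) [RHS]lfun_tlift; apply: eq_tlift => c d.
  by rewrite linearZ; apply: mulrC.
under eq_tlift => a b do rewrite scale_lfunE -scalerA.
rewrite swZ linearZ /= -/y linearB linearZ /= => ->.
by apply/eqP; rewrite subr_eq0; apply/eqP/mulrC.
Qed.

(** The modular element of the dual: by [coint_right] it measures how far the one-sided integral
    [lam] is from being two-sided. *)
Definition distinguished := \sw_(a, b <- Lam) ((lam b : k) *: a).
Local Notation g := distinguished.

Lemma coint_right (f : D) : f * lam = (f g : k) *: lam.
Proof.
rewrite [LHS]coint_unique => [|f']; last by rewrite -mulrA coint_left scalerAr.
have -> // : (f * lam : D) Lam = f g.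
rewrite dual_mulE /distinguished [RHS]lfun_tlift; apply: eq_tlift => a b.
by rewrite linearZ; apply: mulrC.
Qed.

Lemma sw_coint_right x : \sw_(a, b <- x) ((lam b : k) *: a) = (lam x : k) *: g.
Proof.
apply/eqP; rewrite -subr_eq0; apply/eqP/functional_sep => f.
have /lfunP/(_ x) := coint_right f; rewrite dual_mulE scale_lfunE linearB linearZ /= => E.
apply/eqP; rewrite subr_eq0; apply/eqP.
transitivity ((f g : k) *: (lam x : k^o)); last exact: mulrC.
rewrite -E lfun_tlift.
by apply: eq_tlift => a b; rewrite linearZ; apply: mulrC.
Qed.

Lemma lam_neq0 : lam != 0.
Proof.
apply/eqP=> l0; have /eqP := coint_Lam ssH intL; rewrite [coint H]l0 zero_lfunE eq_sym.
by rewrite oner_eq0.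
Qed.

Lemma scale_lam_inj (c d : k) : c *: lam = d *: lam -> c = d.
Proof.
by move/eqP; rewrite -subr_eq0 -scalerBl scaler_eq0 (negPf lam_neq0) orbF subr_eq0 => /eqP.
Qed.

Lemma distinguished_grouplike : grouplike g.
Proof.
split.
  apply: tens_sep => f f'; rewrite tpairE.
  have := coint_right ((f : D) * (f' : D)); rewrite -mulrA coint_right -scalerAr coint_right.
  by rewrite scalerA => /scale_lam_inj; rewrite mulrC dual_mulE => <-.
by have := coint_right 1; rewrite mul1r -{1}[lam]scale1r => /scale_lam_inj.
Qed.

Local Notation gg := distinguished_grouplike.

(* Both functionals are left cointegrals; composing with the antipode reduces to [coint_unique]. *)
Lemma coint_antipode x : coint H (S x) = coint H (x * g).
Proof.
have key (mu : D) : (forall f : D, f * mu = (f 1 : k) *: mu) -> mu (S Lam) = 1 ->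
    forall y, mu (S y) = lam y.
  move=> muP muL y; rewrite -dual_antipodeE [antipode mu]coint_unique => [|f].
    by rewrite dual_antipodeE muL scale1r.
  have fE : f = antipode ((f \o T)%VF : D).
    apply/lfunP=> z; rewrite dual_antipodeE comp_lfunE (antipodeKV ssH intL) //.
  rewrite {1}fE -antipodeM muP linearZ comp_lfunE (antipodeV1 ssH intL) //.
have L1 : lam (S (S Lam)) = 1.
  by rewrite !(antipode_integral ssH intL) (coint_Lam ssH intL).
have E1 y : lam (S (S y)) = lam y.
  have := key (antipode lam : D); rewrite dual_antipodeE => /(_ _ L1 y).
  rewrite dual_antipodeE => -> // f.
  have fE : f = antipode ((f \o T)%VF : D).
    apply/lfunP=> z; rewrite dual_antipodeE comp_lfunE (antipodeKV ssH intL) //.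
  by rewrite {1}fE -antipodeM coint_left linearZ comp_lfunE (antipodeV1 ssH intL).
pose mu : D := (lam \o amulr g)%VF.
have muE y : mu y = lam (y * g) by rewrite comp_lfunE amulrE.
have E2 y : mu (S y) = lam y.
  apply: key => [f|]; last first.
    rewrite muE (antipode_integral ssH intL) (integral_mulr intL).
    by case: gg => _ ->; rewrite scale1r (coint_Lam ssH intL).
  apply/lfunP=> z; rewrite scale_lfunE muE dual_mulE.
  pose f' : D := (f \o amulr (S g))%VF.
  have f'E w : f' w = f (w * S g) by rewrite comp_lfunE amulrE.
  have := congr1 (fun u : D => u (z * g)) (coint_right f'); rewrite dual_mulE.
  rewrite sw_mul; last by bil_tac.
  rewrite scale_lfunE f'E (grouplike_mulV gg) => <-.
  apply: eq_tlift => a b; rewrite (sw_grouplike gg); last by bil_tac.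
  by rewrite f'E -mulrA (grouplike_mulV gg) mulr1 muE.
by rewrite -muE -[x](antipodeVK ssH intL) E2 E1.
Qed.

Lemma antipode2_distinguished : S (S g) = g.
Proof.
have := congr1 S (grouplike_mulV gg); rewrite antipodeM antipode1 => E.
by rewrite -[LHS]mulr1 -(grouplike_mulVl gg) mulrA E mul1r.
Qed.

(** Radford's formula, with a single modular element because [Lam] is two-sided. The value of
    [lam \o S] at [x * y] and at [y * S (S x)] is the same, and [coint_antipode] rewrites both. *)
Lemma antipode4 x : S (S (S (S x))) * g = g * x.
Proof.
apply/eqP; rewrite eq_sym -subr_eq0; apply/eqP/(coint_nondegr ssH intL) => z.
rewrite -[z](antipodeVK ssH intL) -[T z](antipodeVK ssH intL); move: (T (T z)) => y.
have mulC := coint_mulC ssH intL.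
have : coint H (S (x * y)) = coint H (S (y * S (S x))).
  by rewrite !antipodeM -mulC.
rewrite !coint_antipode -[x * y * g]mulrA mulC -[y * _ * g]mulrA [in RHS]mulC.
rewrite !antipodeM antipode2_distinguished => E.
by rewrite mulrBr linearB /= -[X in _ - X]mulC mulrA E subrr.
Qed.

Lemma antipode4_finite : exists2 m, (0 < m)%N & iter m (fun x => S (S (S (S x)))) =1 id.
Proof.
have [m m0 gm] := grouplike_order gg; exists m => // x.
have E i y : iter i (fun x => S (S (S (S x)))) y * g ^+ i = g ^+ i * y.
  elim: i => [|i IHi] /=; first by rewrite expr0 mulr1 mul1r.
  by rewrite {1}exprS mulrA antipode4 -mulrA IHi exprS mulrA.
by have := E m x; rewrite gm mulr1 mul1r.
Qed.
End Distinguished.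

(** * Integer polynomials at roots of unity, in [k] and in [algC] *)

Section CyclotomicTransfer.
Variables (k : fieldType) (N : nat) (zeta : k) (z : algC).
Hypothesis char0 : [pchar k] =i pred0.
Hypotheses (prim_zeta : N.-primitive_root zeta) (prim_z : N.-primitive_root z).
Local Notation pZto F := (map_poly (intr : int -> F)).

Lemma intr_eq0_char0 (a : int) : ((a%:~R : k) == 0) = (a == 0).
Proof.
have n0 n : ((n%:R : k) == 0) = (n == 0)%N by rewrite (pcharf0P k).1.
case: a => n; first exact: n0.
by rewrite NegzE mulrNz oppr_eq0 oppr_eq0 -[_%:~R]/(n.+1%:R) n0.
Qed.

Lemma root_Cyclotomic_prim : ((pZto k) 'Phi_N).[zeta] = 0.
Proof.
have N0 := prim_order_gt0 prim_zeta.
have E : \prod_(d <- divisors N) ((pZto k) 'Phi_d).[zeta] = 0.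
  rewrite -horner_prod -rmorph_prod prod_Cyclotomic // rmorphB /= map_polyXn rmorph1.
  by rewrite !hornerE (prim_expr_order prim_zeta) subrr.
have [d] : exists2 d, d \in divisors N & ((pZto k) 'Phi_d).[zeta] == 0.
  have /eqP := E; rewrite prodf_seq_eq0 => /hasP[d dN /= d0].
  by exists d.
rewrite -dvdn_divisors // => dN /eqP d0.
have d_gt0 : (0 < d)%N by apply: dvdn_gt0 dN.
have zd : zeta ^+ d = 1.
  have := congr1 (fun p => ((pZto k) p).[zeta]) (prod_Cyclotomic d_gt0).
  rewrite (big_rem d) /= -?dvdn_divisors // rmorphM hornerM d0 mul0r.
  rewrite rmorphB /= map_polyXn rmorph1 !hornerE => /esym/eqP.
  by rewrite subr_eq0 => /eqP.
have : (N %| d)%N by rewrite (prim_order_dvd prim_zeta) zd.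
by move=> Nd; have -> : N = d by apply/eqP; rewrite eqn_dvd Nd dN.
Qed.

(** Both sides say that the cyclotomic polynomial divides [P] over the rationals. If it does not,
    the two are coprime, and a Bezout identity with cleared denominators would make a non-zero
    integer vanish in [k]. *)
Lemma cyclotomic_transfer (P : {poly int}) :
  (((pZto k) P).[zeta] == 0) = (((pZto algC) P).[z] == 0).
Proof.
have ZQ (p : {poly int}) : map_poly (ratr : rat -> algC) ((pZto rat) p) = (pZto algC) p.
  by rewrite -map_poly_comp; apply: eq_map_poly => b; rewrite /= rmorph_int.
have [p [Dp mon_p] pP] := minCpolyP z.
have Ep : p = (pZto rat) 'Phi_N.
  apply: (map_inj_poly (fmorph_inj (ratr : rat -> algC)) (rmorph0 _)).
  by rewrite ZQ (Cintr_Cyclotomic prim_z) -(minCpoly_cyclotomic prim_z) Dp.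
have rootE (r : {poly int}) : (((pZto algC) r).[z] == 0) = (p %| (pZto rat) r).
  by rewrite -pP ZQ.
have Phi0 := root_Cyclotomic_prim.
rewrite rootE; apply/eqP/idP => [P0|]; last first.
  case/dvdpP=> r0 Dr0; have [r [a nz_a Dr]] := rat_poly_scale r0.
  have : a *: P = r * 'Phi_N.
    apply: (map_inj_poly (intr_inj : injective (intr : int -> rat))) => //.
    by rewrite map_polyZ Dr0 Dr Ep -scalerAl scalerKV ?intr_eq0 // rmorphM.
  move/(congr1 (fun q => ((pZto k) q).[zeta])); rewrite map_polyZ hornerZ rmorphM hornerM Phi0 mulr0.
  by move/eqP; rewrite mulf_eq0 intr_eq0_char0 (negPf nz_a) => /eqP.
apply: contraT => ndiv.
have co : coprimep p ((pZto rat) P).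
  rewrite coprimep_def; set D := gcdp _ _.
  have /dvdpP[E DE] : D %| p by apply: dvdp_gcdl.
  have nzp : p != 0 by apply: monic_neq0.
  have nzE : E != 0 by apply: contra_neq nzp => E0; rewrite DE E0 mul0r.
  have nzD : D != 0 by apply: contra_neq nzp => D0; rewrite DE D0 mulr0.
  have : root (map_poly (ratr : rat -> algC) p) z by rewrite pP dvdpp.
  rewrite DE rmorphM rootM !pP => /orP[pE|pD].
    have := dvdp_leq nzE pE; rewrite DE size_mul //.
    have := size_poly_eq0 D; have := size_poly_eq0 E; rewrite (negPf nzD) (negPf nzE).
    by move: (size D) (size E) => [|[|d]] [|e] //=; lia.
  by case/negP: ndiv; apply: dvdp_trans pD (dvdp_gcdr _ _).
have /Bezout_eq1_coprimepP[[u v] /= uv] := co.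
have [r [a nz_a Dr]] := rat_poly_scale u; have [s [b nz_b Ds]] := rat_poly_scale v.
have : (b *: r) * 'Phi_N + (a *: s) * P = (a * b)%:P.
  apply: (map_inj_poly (intr_inj : injective (intr : int -> rat))) => //.
  rewrite rmorphD !rmorphM /= !map_polyZ map_polyC /= -Ep.
  have -> : (pZto rat) r = a%:~R *: u by rewrite Dr scalerKV ?intr_eq0.
  have -> : (pZto rat) s = b%:~R *: v by rewrite Ds scalerKV ?intr_eq0.
  rewrite !scalerA -!scalerAl [X in X *: _ + _]mulrC -scalerDr uv.
  by rewrite map_polyC -polyCM -alg_polyC.
move/(congr1 (fun q => ((pZto k) q).[zeta])); rewrite rmorphD !rmorphM hornerD !hornerM Phi0 P0.
rewrite !mulr0 addr0 /= !map_polyC !hornerC /= => /esym/eqP.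
by rewrite mulf_eq0 !intr_eq0_char0 (negPf nz_a) (negPf nz_b).
Qed.
End CyclotomicTransfer.

(** * Traces of representations of a finite cyclic group *)

Section PeriodicTrace.
Variables (k : closedFieldType) (N : nat) (zeta : k).
Hypothesis char0 : [pchar k] =i pred0.
Hypothesis prim_zeta : N.-primitive_root zeta.

Let N_gt0 : (0 < N)%N := prim_order_gt0 prim_zeta.
Let nzN : (N%:R : k) != 0.
Proof. by rewrite (pcharf0P k).1 // -lt0n. Qed.
Let nz_zeta : zeta != 0.
Proof. by rewrite (prim_root_eq0 prim_zeta) -lt0n. Qed.

Lemma sum_shift_periodic (V : zmodType) (f : nat -> V) (j : nat) :
  (forall i, f (i + N)%N = f i) -> \sum_(i < N) f (j + i)%N = \sum_(i < N) f i.
Proof.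
move=> fN; elim: j => [//|j <-]; case: N N_gt0 fN => // n _ fN.
rewrite big_ord_recr [RHS]big_ord_recl /= addrC; congr (_ + _).
  by rewrite addSnnS fN addn0.
by apply: eq_bigr => i _; rewrite addSnnS.
Qed.

Lemma sum_prim_root_powers (j l : nat) : (j < N)%N -> (l < N)%N ->
  \sum_(i < N) (zeta ^+ j / zeta ^+ l) ^+ i = (N%:R * (j == l)%:R : k).
Proof.
move=> ltj ltl; have nzl : zeta ^+ l != 0 by rewrite expf_neq0.
have [<-|nejl] := eqVneq j l.
  rewrite divff ?expf_neq0 // mulr1 (eq_bigr (fun => 1)) ?sumr_const ?card_ord // => i _.
  exact: expr1n.
set x := _ / _; rewrite mulr0; have nzx : x - 1 != 0.
  rewrite subr_eq0; apply: contra nejl => /eqP x1.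
  have : zeta ^+ j == zeta ^+ l by rewrite -[zeta ^+ j](divfK nzl) -/x x1 mul1r.
  by rewrite (eq_prim_root_expr prim_zeta) !modn_small.
apply: (mulfI nzx); rewrite mulr0 -subrX1 /x expr_div_n -!exprM mulnC [(l * N)%N]mulnC.
by rewrite !exprM (prim_expr_order prim_zeta) !expr1n divr1 subrr.
Qed.

(* If [A] is a representation of Z/N up to the idempotent [A 0], then its traces are
   the values of a sum of characters of Z/N. *)
Lemma periodic_trace (V : vectType k) (A : nat -> 'End(V)) :
    (forall i j, (A i \o A j)%VF = A (i + j)%N) -> (forall i, A (i + N)%N = A i) ->
  exists m : 'I_N -> nat, forall j, (j < N)%N -> lftr (A j) = \sum_(i < N) (m i)%:R * zeta ^+ (i * j).
Proof.
(* The Fourier transform of the family: [P i] projects onto the part where [A 1] acts as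
   [zeta ^+ i], and its rank is the multiplicity [m i]. *)
move=> AM AN; pose P (i : nat) := (N%:R^-1 : k) *: \sum_(l < N) (zeta ^- (i * l)) *: A l.
have PP i : (P i \o P i = P i)%VF.
  rewrite /P -comp_lfunZl -comp_lfunZr; congr (_ *: _).
  pose f l := zeta ^- (i * l) *: A l.
  have fN l : f (l + N)%N = f l.
    by rewrite /f AN mulnDr exprD [(i * N)%N]mulnC [zeta ^+ (N * i)]exprM (prim_expr_order prim_zeta) expr1n mulr1.
  have -> : ((\sum_(l < N) f l) \o (\sum_(l < N) f l))%VF = \sum_(j < N) \sum_(l < N) f (j + l)%N.
    apply/lfunP=> v; rewrite comp_lfunE !sum_lfunE; apply: eq_bigr => j _.
    rewrite linear_sum sum_lfunE; apply: eq_bigr => l _.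
    rewrite /f scale_lfunE linearZ /= !scale_lfunE scalerA -comp_lfunE AM mulnDr exprD invfM.
    by rewrite mulrC.
  under eq_bigr => j _ do rewrite sum_shift_periodic //.
  by rewrite sumr_const card_ord -scaler_nat scalerA mulVf // scale1r.
exists (fun i => \dim (limg (P i))) => j ltj.
transitivity (lftr (\sum_(i < N) zeta ^+ (i * j) *: P i)); last first.
  by rewrite lftr_sum; apply: eq_bigr => i _; rewrite lftrZ lftr_idem // mulrC.
congr lftr; rewrite /P.
transitivity ((N%:R^-1 : k) *: \sum_(l < N) (N%:R * (j == l)%:R : k) *: A l).
  rewrite (bigD1 (Ordinal ltj)) //= eqxx mulr1 big1 ?addr0 => [|l nlj].
    by rewrite scalerA mulVf // scale1r.
  by rewrite -[X in (X == _)%N]/(val (Ordinal ltj)) val_eqE eq_sym (negPf nlj) mulr0 scale0r.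
under [RHS]eq_bigr => i _ do rewrite scalerA mulrC -scalerA scaler_sumr.
rewrite -scaler_sumr exchange_big; congr (_ *: _); apply: eq_bigr => l _ /=.
rewrite -sum_prim_root_powers // scaler_suml; apply: eq_bigr => i _.
by rewrite scalerA expr_div_n -!exprM mulnC [(i * l)%N]mulnC.
Qed.
End PeriodicTrace.

Lemma closed_prim_root (k : closedFieldType) N :
  [pchar k] =i pred0 -> (0 < N)%N -> exists zeta : k, N.-primitive_root zeta.
Proof.
move=> char0 N0; pose p : {poly k} := 'X^N - 1; have [r Dp] := closed_field_poly_normal p.
rewrite (monicP _) ?monicXnsubC // scale1r in Dp.
have rn1 : all N.-unity_root r by apply/allP=> z; rewrite -root_prod_XsubC -Dp.
have sz_r : (N < (size r).+1)%N by rewrite -(size_prod_XsubC r id) -Dp size_XnsubC.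
have [|z] := hasP (has_prim_root N0 rn1 _ sz_r); last by exists z.
by rewrite -separable_prod_XsubC -Dp separable_Xn_sub_1 // (pcharf0P k).1 // -lt0n.
Qed.

(** * Traces of inner automorphisms *)

Section TraceForm.
Variables (k : closedFieldType) (A : falgType k).
Hypothesis char0 : [pchar k] =i pred0.
Hypothesis ssA : semisimple_algebra A.

(** The trace form of the decomposition of [A], as a bimodule, into blocks $V_i\otimes V_i^*$.
    Tracial functionals are expanded first in [a], then in [b]. *)
Lemma mulLR_trace r (e : 'I_r -> A) a b :
    (forall i, primitive_idem (e i)) -> (forall i j, i != j -> forall x, e i * x * e j = 0) ->
    (forall phi : 'Hom(A, k^o), tracial phi ->
       forall x, phi x = \sum_i phi (e i) * idem_char (e i) x) ->
  lftr (mulLR a b) = \sum_i idem_char (e i) a * idem_char (e i) b.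
Proof.
move=> pe oe te; rewrite -idem_charE te; last exact: idem_char_tracial.
apply: eq_bigr => i _; rewrite [LHS]mulrC; congr (_ * _).
have L : linear (fun b => lftr (mulLR (e i) b) : k^o).
  move=> c x y; rewrite /= -lftrP; congr lftr; apply/lfunP=> z.
  by rewrite lfunPl !mulLRE !mulPr.
pose psi : 'Hom(A, k^o) := linfun (HB.pack_for {linear A -> k^o}
  (fun b => lftr (mulLR (e i) b) : k^o) (GRing.isLinear.Build k A k^o *:%R _ L)).
have psiE x : psi x = lftr (mulLR (e i) x) by rewrite lfunE.
have tr_psi : tracial psi.
  move=> x y; rewrite !psiE.
  have -> : mulLR (e i) (x * y) = (amulr y \o mulLR (e i) x)%VF.
    by apply/lfunP=> z; rewrite [RHS]comp_lfunE !mulLRE amulrE !mulrA.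
  have -> : mulLR (e i) (y * x) = (mulLR (e i) x \o amulr y)%VF.
    by apply/lfunP=> z; rewrite [RHS]comp_lfunE !mulLRE amulrE !mulrA.
  exact: lftrC.
rewrite idem_charE -psiE te // (bigD1 i) //= psiE -idem_charE idem_char_primitive // mul1r.
rewrite big1 ?addr0 // => j nji; rewrite psiE -idem_charE idem_char_unlinked ?mul0r //.
by apply: oe; rewrite eq_sym.
Qed.

(* The traces of [w] and of its inverse on a simple module are, up to reciprocal scalars, the
   values of one polynomial at conjugate roots of unity, so their product is a squared modulus. *)
Lemma inner_trace_neq0 (w w' : A) N (eps : 'Hom(A, k^o)) : w * w' = 1 -> w' * w = 1 ->
    (0 < N)%N -> (forall x, w ^+ N * x = x * w ^+ N) ->
    eps 1 = 1 -> (forall x y, eps (x * y) = eps x * eps y) ->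
  lftr (mulLR w w') != 0.
Proof.
move=> ww' w'w.
(* Doubling [N] makes the period exceed 1, so that the exponent 1 is an index below the period. *)
suff main M : (1 < M)%N -> (forall x, w ^+ M * x = x * w ^+ M) ->
    eps 1 = 1 -> (forall x y, eps (x * y) = eps x * eps y) -> lftr (mulLR w w') != 0.
  move=> N0 wN; apply: (main N.*2); first by rewrite -addnn; lia.
  by move=> x; rewrite -addnn exprD -mulrA wN wN -mulrA.
move=> M1 wM eps1 epsM; have M0 : (0 < M)%N by apply: ltn_trans M1.
have [r [e [pe oe te]]] := primitive_representatives ssA.
have [zeta prim_zeta] := closed_prim_root char0 M0.
have [z prim_z] := C_prim_root_exists M0.
have block i : exists m : 'I_M -> nat, exists c : k, c != 0 /\
    idem_char (e i) w = c * \sum_(j < M) (m j)%:R * zeta ^+ j /\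
    idem_char (e i) w' = c^-1 * \sum_(j < M) (m j)%:R * zeta ^+ (j * M.-1).
  have [nze ee pei] := pe i; set f := e i in nze ee pei *.
  have [s Es] := pei (w ^+ M).
  have wMf : w ^+ M * f = s *: f by rewrite -Es -wM -mulrA ee.
  have w'wM j : w' ^+ j * w ^+ j = 1.
    elim: j => [|j IHj]; first by rewrite !expr0 mulr1.
    by rewrite exprSr exprS mulrA -[w' ^+ j * w' * w]mulrA w'w mulr1.
  have nzs : s != 0.
    apply: contra nze => /eqP s0; rewrite -[f]mul1r -(w'wM M) -mulrA wMf s0 scale0r mulr0 //.
  (* Dividing [w] by a root of the scalar by which [w ^+ M] acts on the block gives an element [v]
     of period [M] there. *)
  have [c cM] : exists c : k, c ^+ M = s.
    have : size ('X^M - s%:P) != 1%N by rewrite size_XnsubC // eqSS -lt0n.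
    case/closed_rootP=> c; rewrite rootE !hornerE subr_eq0 => /eqP <-.
    by exists c.
  have nzc : c != 0 by apply: contra_neq nzs => c0; rewrite -cM c0 expr0n gtn_eqF.
  pose v := c^-1 *: w.
  have vM : v ^+ M * f = f.
    by rewrite /v exprZn -scalerAl wMf scalerA exprVn cM mulVf // scale1r.
  have vMC x : v ^+ M * x = x * v ^+ M.
    by rewrite /v exprZn -scalerAl -scalerAr wM.
  pose B j := mulLR (v ^+ j) f.
  have BM i' j : (B i' \o B j)%VF = B (i' + j)%N.
    apply/lfunP=> x; rewrite [LHS]comp_lfunE /B !mulLRE exprD.
    by rewrite !mulrA -[LHS]mulrA ee.
  have BN j : B (j + M)%N = B j.
    apply/lfunP=> x; rewrite /B !mulLRE exprD -[v ^+ j * _ * x]mulrA vMC.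
    by rewrite -!mulrA vM.
  have [m mP] := periodic_trace char0 prim_zeta BM BN.
  exists m, c; split=> //; split.
    have := mP 1%N M1; under eq_bigr => j _ do rewrite muln1.
    move=> <-; rewrite idem_charE -lftrZ; congr lftr; apply/lfunP=> x.
    by rewrite scale_lfunE /B !mulLRE expr1 /v -!scalerAl scalerA divff // scale1r.
  have ltM : (M.-1 < M)%N by rewrite prednK.
  rewrite -(mP _ ltM) idem_charE -lftrZ; congr lftr; apply/lfunP=> x.
  rewrite scale_lfunE /B !mulLRE.
  have -> : w' * x * f = w' * (v ^+ M) * x * f.
    by rewrite -[w' * _ * x]mulrA vMC -!mulrA vM.
  have w'v : w' * v = c^-1 *: 1 by rewrite /v -scalerAr w'w.
  by rewrite -[X in v ^+ X](prednK M0) exprS mulrA w'v -!scalerAl mul1r.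
have [m mP] : exists m : 'I_r -> 'I_M -> nat, forall i, exists c : k, c != 0 /\
    idem_char (e i) w = c * \sum_(j < M) (m i j)%:R * zeta ^+ j /\
    idem_char (e i) w' = c^-1 * \sum_(j < M) (m i j)%:R * zeta ^+ (j * M.-1).
  have [m mP] : exists m : 'I_r -> {ffun 'I_M -> nat}, forall i, exists c : k, c != 0 /\
      idem_char (e i) w = c * \sum_(j < M) (m i j)%:R * zeta ^+ j /\
      idem_char (e i) w' = c^-1 * \sum_(j < M) (m i j)%:R * zeta ^+ (j * M.-1).
    have blockf i : exists m : {ffun 'I_M -> nat}, exists c : k, c != 0 /\
        idem_char (e i) w = c * \sum_(j < M) (m j)%:R * zeta ^+ j /\
        idem_char (e i) w' = c^-1 * \sum_(j < M) (m j)%:R * zeta ^+ (j * M.-1).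
      have [m [c [nzc [E1 E2]]]] := block i; exists [ffun j => m j], c; split=> //.
      by split; [rewrite E1|rewrite E2]; congr (_ * _); apply: eq_bigr => j _; rewrite ffunE.
    elim: r e {pe oe te block} blockf => [|r' IHr] e blockf.
      by exists (fun=> [ffun=> 0%N]) => -[].
    have [i|m mP] := IHr (fun i => e (lift ord0 i)); first exact: blockf.
    have [m0 m0P] := blockf ord0.
    exists (fun i => if unlift ord0 i is Some j then m j else m0) => i.
    by case: unliftP => [j ->|->]; [exact: mP | exact: m0P].
  by exists (fun i j => m i j).
pose Pm i : {poly int} := \sum_(j < M) (m i j)%:R *: 'X^j.
pose Pm' i : {poly int} := \sum_(j < M) (m i j)%:R *: 'X^(j * M.-1).
have PmE (F : fieldType) i (x : F) : (map_poly intr (Pm i)).[x] = \sum_(j < M) (m i j)%:R * x ^+ j.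
  rewrite /Pm rmorph_sum horner_sum; apply: eq_bigr => j _.
  by rewrite /= map_polyZ map_polyXn hornerZ hornerXn rmorph_nat.
have PmE' (F : fieldType) i (x : F) : (map_poly intr (Pm' i)).[x] = \sum_(j < M) (m i j)%:R * x ^+ (j * M.-1).
  rewrite /Pm' rmorph_sum horner_sum; apply: eq_bigr => j _.
  by rewrite /= map_polyZ map_polyXn hornerZ hornerXn rmorph_nat.
have conj_z : z ^+ M.-1 = z^*.
  have nzz : z != 0 by rewrite (prim_root_eq0 prim_z) -lt0n.
  have z1 : `|z| = 1.
    by apply/eqP; rewrite -(pexpr_eq1 M0) ?normr_ge0 // -normrX (prim_expr_order prim_z) normr1.
  apply: (mulfI nzz); rewrite -exprS prednK // (prim_expr_order prim_z).
  by rewrite -normCK z1 expr1n.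
have Pconj i : (map_poly intr (Pm' i)).[z] = ((map_poly intr (Pm i)).[z])^*.
  rewrite PmE PmE' rmorph_sum; apply: eq_bigr => j _.
  by rewrite rmorphM rmorph_nat rmorphXn /= -conj_z -!exprM mulnC.
rewrite (mulLR_trace w w' pe oe te).
have -> : \sum_i idem_char (e i) w * idem_char (e i) w' =
    (map_poly intr (\sum_i Pm i * Pm' i)).[zeta].
  rewrite rmorph_sum horner_sum; apply: eq_bigr => i _.
  have [c [nzc [-> ->]]] := mP i.
  by rewrite rmorphM hornerM PmE PmE' mulrACA divff // mul1r.
rewrite (cyclotomic_transfer char0 prim_zeta prim_z) rmorph_sum horner_sum.
(* A vanishing sum of squared moduli kills every irreducible character at [w], hence every tracial
   functional. But [eps] is multiplicative, so it is tracial and cannot vanish at the invertible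
   [w]. *)
apply/negP=> S0.
have Pm0 i : (map_poly intr (Pm i)).[zeta] = 0.
  apply/eqP; rewrite (cyclotomic_transfer char0 prim_zeta prim_z).
  move: S0; rewrite psumr_eq0 => [/allP/(_ i (mem_index_enum i))|j _].
    by rewrite rmorphM hornerM Pconj -normCK expf_eq0 normr_eq0.
  by rewrite rmorphM hornerM Pconj -normCK exprn_ge0.
have eps0 : eps w = 0.
  rewrite te; last by move=> x y; rewrite !epsM mulrC.
  rewrite big1 // => i _; have [c [_ [-> _]]] := mP i.
  by rewrite -PmE Pm0 !mulr0.
by move: eps1 => /eqP; rewrite -ww' epsM eps0 mul0r eq_sym oner_eq0.
Qed.
End TraceForm.

(** * Translations by functionals *)

Section Translation.
Variables (k : fieldType) (H : hopfAlgType k).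
Implicit Types (x y : H) (f : dual_hopf H).

Definition rtrans (f : 'Hom(H, k^o)) : 'End(H) := (tlift (fun a b => (f b : k) *: a) \o comul)%VF.
Definition ltrans (f : 'Hom(H, k^o)) : 'End(H) := (tlift (fun a b => (f a : k) *: b) \o comul)%VF.

Lemma rtransE f x : rtrans f x = \sw_(a, b <- x) ((f b : k) *: a).
Proof. exact: comp_lfunE. Qed.

Lemma ltransE f x : ltrans f x = \sw_(a, b <- x) ((f a : k) *: b).
Proof. exact: comp_lfunE. Qed.

Lemma rtransM f f' : (rtrans f \o rtrans f')%VF = rtrans (f * f').
Proof.
apply/lfunP=> x; rewrite [LHS]comp_lfunE [RHS]rtransE [rtrans f' x]rtransE lfun_tlift.
under eq_tlift => a b do rewrite linearZ /= rtransE -swZ.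
under eq_tlift => a b do under eq_tlift => c d do rewrite scalerA.
rewrite (sw_coassoc (F := fun c d b => ((f' b : k) * (f d : k)) *: c)); last by tri_tac.
apply: eq_tlift => a b; rewrite dual_mulE.
rewrite (lin_tlift (h := fun c : k^o => (c : k) *: a)) //; last by lin_tac.
by apply: eq_tlift => c d; rewrite mulrC.
Qed.

Lemma counit_rtrans f x : counit (rtrans f x) = f x.
Proof.
rewrite rtransE lfun_tlift -[in RHS](counitl x) [RHS]lfun_tlift; apply: eq_tlift => a b.
by rewrite !linearZ; apply: mulrC.
Qed.

Lemma counit_ltrans f x : counit (ltrans f x) = f x.
Proof.
rewrite ltransE lfun_tlift -[in RHS](counitr x) [RHS]lfun_tlift; apply: eq_tlift => a b.
by rewrite !linearZ; apply: mulrC.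
Qed.

Lemma rtrans_ltrans f f' x : rtrans f (ltrans f' x) = ltrans f' (rtrans f x).
Proof.
rewrite [ltrans f' x]ltransE [rtrans f x]rtransE !lfun_tlift.
under eq_tlift => a b do rewrite linearZ /= rtransE -swZ.
under [RHS]eq_tlift => a b do rewrite linearZ /= ltransE -swZ.
rewrite [RHS](sw_coassoc (F := fun c d b => (f b : k) *: ((f' c : k) *: d))); last by tri_tac.
apply: eq_tlift => a b; apply: eq_tlift => c d.
by rewrite !scalerA mulrC.
Qed.

Lemma rtrans_inj f f' : rtrans f = rtrans f' -> f = f'.
Proof. by move=> E; apply/lfunP=> x; rewrite -(counit_rtrans f) -(counit_rtrans f') E. Qed.

Lemma rtransZ (c : k) (f : 'Hom(H, k^o)) : rtrans (c *: f) = c *: rtrans f.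
Proof.
apply/lfunP=> x; rewrite scale_lfunE !rtransE -swZ.
by apply: eq_tlift => a b; rewrite scale_lfunE -scalerA.
Qed.
End Translation.

(** * The antipode of a semisimple Hopf algebra is an involution *)

Section Involution.
Variables (k : closedFieldType) (H : hopfAlgType k).
Hypothesis char0 : [pchar k] =i pred0.
Hypothesis ssH : semisimple_algebra H.
Implicit Types (x y h : H).
Local Notation S := (@antipode k H).
Local Notation lam := (coint H).

Fact lftr_amull_linear : linear (fun x => lftr (amull x) : k^o).
Proof. by move=> a x y; rewrite /= linearP -lftrP. Qed.
Definition regular_char : 'Hom(H, k^o) := linfun (HB.pack_for {linear H -> k^o}
  (fun x => lftr (amull x) : k^o) (GRing.isLinear.Build k H k^o *:%R _ lftr_amull_linear)).

Lemma regular_charE x : regular_char x = lftr (amull x).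
Proof. by rewrite lfunE. Qed.

Lemma amull_comp x y : amull (x * y) = (amull x \o amull y)%VF.
Proof. by apply/lfunP=> z; rewrite [RHS]comp_lfunE !amullE mulrA. Qed.

Lemma regular_char_tracial : tracial regular_char.
Proof. by move=> x y; rewrite !regular_charE !amull_comp lftrC. Qed.

Lemma left_inverse_right (x y : H) : x * y = 1 -> y * x = 1.
Proof.
move=> xy; have K0 : lker (amull y) == 0%VS.
  apply/lker0P=> u v; rewrite !amullE => E.
  by rewrite -[u]mul1r -xy -mulrA E mulrA xy mul1r.
have : 1 \in limg (amull y) by rewrite (lker0_limgf K0) memvf.
case/memv_imgP=> z _; rewrite amullE => Ez.
by rewrite Ez -[z]mul1r -xy -[x * y * z]mulrA -Ez mulr1.
Qed.

(** Write the regular character as [lam (w * _)]. It is tracial while [lam] has Nakayama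
    automorphism [S^2], so [w] implements [S^2]; nondegeneracy of the trace form makes [w]
    invertible. *)
Lemma antipode2_inner : exists w w', [/\ w * w' = 1, w' * w = 1
  & forall x, S (S x) = w * x * w'].
Proof.
have [Lam intL] := exists_integral ssH.
pose w := S (\sw_(a, b <- Lam) ((regular_char a : k) *: b)).
have wE x : regular_char x = lam (w * x).
  have -> : regular_char = (lam \o amull w)%VF.
    apply: (integral_functional_ext ssH intL).
    under [RHS]eq_tlift => a b do rewrite comp_lfunE amullE.
    by rewrite (coint_mull ssH intL).
  by rewrite comp_lfunE amullE.
have w_comm x : w * x = S (S x) * w.
  apply/eqP; rewrite -subr_eq0; apply/eqP/(coint_nondegl ssH intL) => y.
  rewrite mulrBl linearB /= -mulrA -wE regular_char_tracial wE mulrA.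
  by rewrite (coint_mulC ssH intL) !mulrA subrr.
have : lker (amull w) == 0%VS.
  rewrite -subv0; apply/subvP=> x; rewrite memv_ker amullE memv0 => /eqP wx0.
  apply/eqP/(regular_trace_nondeg char0 ssH) => y.
  by rewrite -regular_charE wE mulrA wx0 mul0r linear0.
move=> K0; have : 1 \in limg (amull w) by rewrite (lker0_limgf K0) memvf.
case/memv_imgP=> w' _; rewrite amullE => /esym ww'.
exists w, w'; split=> // [|x]; first exact: left_inverse_right.
by rewrite w_comm -mulrA ww' mulr1.
Qed.

(** Since [S^2] is conjugation by [w] and [S^4] has finite order, a power of [w] is central and
    [inner_trace_neq0] applies, with the counit as multiplicative functional. *)
Lemma lftr_antipode2_neq0 : lftr (S \o S)%VF != 0.
Proof.
have [Lam intL] := exists_integral ssH.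
have [w [w' [ww' w'w S2]]] := antipode2_inner.
have -> : (S \o S)%VF = mulLR w w' by apply/lfunP=> x; rewrite [LHS]comp_lfunE mulLRE S2.
have [m m0 mS] := antipode4_finite ssH intL.
have m2 : (0 < m.*2)%N by rewrite double_gt0.
apply: (inner_trace_neq0 char0 ssH (eps := counit) (N := m.*2)) => // [x||]; last 2 first.
- exact: counit1.
- exact: counitM.
have iterE i y : iter i (fun x => S (S (S (S x)))) y = w ^+ i.*2 * y * w' ^+ i.*2.
  elim: i => [|i IHi]; first by rewrite /= !expr0 mul1r mulr1.
  by rewrite iterS IHi !S2 doubleS !(exprS w) !(exprSr w') !mulrA.
have w'n n : w' ^+ n * w ^+ n = 1.
  elim: n => [|n IHn]; first by rewrite !expr0 mulr1.
  by rewrite exprSr exprS mulrA -[w' ^+ n * w' * w]mulrA w'w mulr1.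
have E : w ^+ m.*2 * x * w' ^+ m.*2 = x by rewrite -iterE mS.
by rewrite -[x in RHS]E -[RHS]mulrA w'n mulr1.
Qed.

(* The regular character absorbs every character, by the isomorphism between the tensor
   square of the regular module and a sum of copies of it. *)
Lemma regular_char_mul x :
  \sw_(a, b <- x) (regular_char a * regular_char b : k^o) = (\dim {:H})%:R * regular_char x.
Proof.
pose phi : 'Hom(tens H H, tens H H) := tlift (fun a b => \sw_(c, d <- a) (c ⊗ (d * b))).
pose psi : 'Hom(tens H H, tens H H) := tlift (fun a b => \sw_(c, d <- a) (c ⊗ (S d * b))).
pose L : 'Hom(tens H H, tens H H) := tlift (fun a b => tmap (amull a) (amull b)) (comul x).
have phiE a b : phi (a ⊗ b) = \sw_(c, d <- a) (c ⊗ (d * b)) by rewrite /phi tliftE //; bil_tac.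
have psiE a b : psi (a ⊗ b) = \sw_(c, d <- a) (c ⊗ (S d * b)) by rewrite /psi tliftE //; bil_tac.
have phipsi t : phi (psi t) = t.
  move: t; apply: tens_ind => [a b|e s t Hs Ht]; last by rewrite !lfun_lin Hs Ht.
  rewrite psiE lfun_tlift; under eq_tlift => c d do rewrite phiE.
  rewrite (sw_coassoc (F := fun c d e => c ⊗ (d * (S e * b)))); last by tri_tac.
  under eq_tlift => c d.
    under eq_tlift => e f do rewrite mulrA.
    rewrite (sw_antipoder (F := fun u => c ⊗ (u * b))); last by lin_tac.
    rewrite mul1r; over.
  by rewrite /= (sw_counitr (F := fun c => c ⊗ b)) //; lin_tac.
have LE t u : L (phi (t ⊗ u)) = phi ((x * t) ⊗ u).
  rewrite !phiE lfun_tlift sw_mul; last by bil_tac.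
  rewrite tlift_swap; apply: eq_tlift => c d.
  rewrite /L; set B := fun a b => _.
  have -> : tlift B (comul x) (c ⊗ (d * u)) = \sw_(a, b <- x) (B a b (c ⊗ (d * u))).
    rewrite (lin_tlift (h := fun M : 'End(tens H H) => M (c ⊗ (d * u)))) //.
    by lin_tac.
  by apply: eq_tlift => a b; rewrite /B tmapE !amullE mulrA.
have E : (L \o phi)%VF = (phi \o tmap (amull x) \1)%VF.
  apply/lfunP; apply: tens_ind => [a b|e s t Hs Ht]; last by rewrite !lfun_lin Hs Ht.
  by rewrite [LHS]comp_lfunE [RHS]comp_lfunE LE tmapE amullE id_lfunE.
have : lftr L = lftr (tmap (amull x) (\1 : 'End(H))%VF).
  have -> : L = ((L \o phi) \o psi)%VF.
    by apply/lfunP=> t; rewrite [RHS]comp_lfunE [RHS]comp_lfunE phipsi.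
  rewrite E -comp_lfunA lftrC -comp_lfunA.
  have -> : (psi \o phi)%VF = \1%VF.
    have K0 : lker psi == 0%VS by apply/lker0P; apply: can_inj phipsi.
    have -> : phi = (psi^-1)%VF.
      apply/lfunP=> t; have : t \in limg psi by rewrite (lker0_limgf K0) memvf.
      by case/memv_imgP=> s _ ->; rewrite phipsi (lker0_lfunK K0).
    exact: lker0_compfV.
  by rewrite comp_lfun1r.
rewrite lftr_tmap lftr_id mulrC -regular_charE => <-.
rewrite /L (lin_tlift (W := 'End(tens H H)) (X := k^o) (h := fun M => lftr M : k^o)); last first.
  by move=> a A B; rewrite /= lftrP.
by apply: eq_tlift => a b; rewrite lftr_tmap !regular_charE.
Qed.

Lemma intr_inj_char0 : injective (intr : int -> k).
Proof.
move=> a b E; apply/eqP; rewrite -subr_eq0 -(intr_eq0_char0 char0) rmorphB /= E.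
by rewrite subrr.
Qed.

(** Let [T = S^2] and $n=\dim H$. Non-vanishing of [lam 1], the trace of [T], makes the
    distinguished element 1, so [T] is an involution and its trace is an integer between $-n$ and
    $n$. The idempotent [P] built from the regular character commutes with [T], and the trace of
    [P \o T] is that of [T] divided by $n$, again an integer. Hence the trace of [T] is $n$ or $-n$,
    [T] is a sign, and [T 1 = 1] decides which. *)
Lemma antipodeK x : S (S x) = x.
Proof.
have [Lam intL] := exists_integral ssH.
have [T [TE TD]] : exists T : 'End(H), (forall y, T y = S (S y)) /\ T = (S \o S)%VF.
  by exists (S \o S)%VF; split=> // y; rewrite comp_lfunE.
have lam1 : lam 1 = lftr T by rewrite TD -(coint1 ssH intL).
have nzl : (lam 1 : k) != 0 by rewrite lam1 TD lftr_antipode2_neq0.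
have TT y : T (T y) = y.
  have := antipode4 ssH intL y; have := sw_coint_right ssH intL 1.
  rewrite sw_1; last by bil_tac.
  by move/(scalerI nzl) <-; rewrite mulr1 mul1r !TE.
have TM y z : T (y * z) = T y * T z by rewrite !TE !antipodeM.
have chiT y : regular_char (T y) = regular_char y.
  rewrite !regular_charE; have -> : amull (T y) = ((T \o amull y) \o T)%VF.
    by apply/lfunP=> z; rewrite [RHS]comp_lfunE comp_lfunE !amullE TM TT.
  rewrite lftrC; congr lftr; apply/lfunP=> z.
  by rewrite [LHS]comp_lfunE comp_lfunE TT.
pose n : k := (\dim {:H})%:R; have n_gt0 : (0 < \dim {:H})%N.
  by rewrite lt0n dimv_eq0; apply/eqP=> F0; have := memvf (1 : H); rewrite F0 memv0 oner_eq0.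
have nzn : n != 0 by rewrite (natr_eq0_char0 char0) -lt0n.
have nz2 : (2%:R : k) != 0 by rewrite (natr_eq0_char0 char0).
pose R := rtrans regular_char; pose P := n^-1 *: R.
have RR y : R (R y) = n *: R y.
  rewrite -[LHS]comp_lfunE /R rtransM; have -> : (regular_char : dual_hopf H) * regular_char = n *: regular_char.
    by apply/lfunP=> z; rewrite dual_mulE regular_char_mul scale_lfunE.
  by rewrite rtransZ scale_lfunE.
have PE y : P y = n^-1 *: R y by rewrite scale_lfunE.
have PP y : P (P y) = P y by rewrite !PE linearZ /= RR !scalerA mulrAC mulVf // mul1r.
have PT y : P (T y) = T (P y).
  rewrite !PE linearZ; congr (_ *: _); rewrite /R !rtransE TE sw_antipode; last by bil_tac.
  rewrite sw_antipode; last by bil_tac.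
  by rewrite /= lfun_tlift; apply: eq_tlift => a b; rewrite linearZ /= -!TE chiT.
(* For an idempotent [Q] commuting with [T], this projects onto the fixed vectors of [T] in the
   image of [Q]; the trace of [Q \o T] is twice its rank minus the rank of [Q]. *)
pose pl (Q : 'End(H)) := (2%:R^-1 : k) *: (Q + (Q \o T)%VF).
have plE Q y : pl Q y = (2%:R^-1 : k) *: (Q y + Q (T y)).
  by rewrite scale_lfunE add_lfunE comp_lfunE.
have trQ (Q : 'End(H)) : (forall y, Q (Q y) = Q y) -> (forall y, Q (T y) = T (Q y)) ->
    lftr (Q \o T)%VF = ((2 * (\dim (limg (pl Q)))%:Z - (\dim (limg Q))%:Z)%:~R : k).
  move=> QQ QT; rewrite rmorphB rmorphM /= -!pmulrn.
  have <- : lftr (pl Q) = (\dim (limg (pl Q)))%:R.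
    apply: lftr_idem; apply/lfunP=> y; rewrite [LHS]comp_lfunE !plE.
    rewrite !linearZ !linearD /= !QT !QQ -!QT TT.
    by rewrite [Q (T y) + Q y]addrC -scalerDr -mulr2n -scaler_nat scalerA mulVf // scale1r scalerDr.
  have <- : lftr Q = (\dim (limg Q))%:R.
    by apply: lftr_idem; apply/lfunP=> y; rewrite comp_lfunE QQ.
  by rewrite lftrZ lftrD mulrA divff // mul1r addrC addKr.
have idT : (\1 \o T)%VF = T by rewrite comp_lfun1l.
have trT := trQ \1%VF (fun y => id_lfunE _) (fun y => etrans (id_lfunE _) (congr1 T (esym (id_lfunE _)))).
have trP := trQ P PP PT.
have PTn : lftr (P \o T)%VF = n^-1 * lftr T.
  rewrite -lam1 (_ : (P \o T)%VF = n^-1 *: (R \o T)%VF); last by rewrite comp_lfunZl.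
  rewrite lftrZ; congr (_ * _); rewrite (lftr_integral ssH intL).
  under eq_tlift => a b.
    rewrite comp_lfunE TE /R rtransE sw_antipode; last by bil_tac.
    rewrite sw_antipode; last by bil_tac.
    under eq_tlift => c d do rewrite -!TE chiT.
    rewrite (lin_tlift (X := k^o) (h := fun y => lam (S y * a))); last by lin_tac.
    under eq_tlift => c d.
      rewrite TE linearZ -scalerAl linearZ /= -(coint_mulC ssH intL).
      over.
    over.
  rewrite /= -(sw_coassoc (F := fun a c d => (regular_char d : k) *: (lam (a * S c) : k^o))); last by tri_tac.
  under eq_tlift => a b.
    rewrite (tliftZ (W := k^o)) (sw_antipoder (F := lam)); last by lin_tac.
    over.
  have -> : tlift (fun a b => regular_char b *: (counit a *: lam 1)) (comul Lam) = (regular_char Lam : k) *: lam 1.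
    rewrite -(sw_counitl (F := fun b => (regular_char b : k) *: (lam 1 : k^o))); last by lin_tac.
    by apply: eq_tlift => a b; rewrite !scalerA mulrC.
  have -> : regular_char Lam = 1.
    rewrite regular_charE (lftr_rank1 (f := counit) (v := Lam)) ?(counit_integral intL) // => y.
    by rewrite amullE (integral_mulr intL).
  by rewrite scale1r.
set r := \dim (limg (pl \1%VF)) in trT.
rewrite idT lim1g in trT; rewrite PTn trT in trP.
set z := (2 * _ - (\dim (limg P))%:Z) in trP.
have /(intr_inj_char0) Ez : ((2 * r%:Z - (\dim {:H})%:Z)%:~R : k) = (z * (\dim {:H})%:Z)%:~R.
  by rewrite rmorphM /= -trP mulrAC mulVf // mul1r.
have nz : 2 * r%:Z - (\dim {:H})%:Z != 0.
  by move: nzl; rewrite lam1 trT; apply: contra_neq => ->; rewrite rmorph0.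
have ler : (r <= \dim {:H})%N by apply/dimvS/subvf.
have r_cases : r = 0%N \/ r = \dim {:H}.
  clearbody r z; clear - Ez nz ler n_gt0; move: Ez nz ler n_gt0.
  move: (\dim {:H}) => d Ez nz ler d0.
  have z1 : z < 2%Z by nia.
  have z2 : - 2%Z < z by nia.
  have [z0|[z0|z0]] : z = -1 \/ z = 0 \/ z = 1 by lia.
  - by left; rewrite z0 in Ez; lia.
  - by rewrite z0 mul0r in Ez; rewrite Ez eqxx in nz.
  - by right; rewrite z0 in Ez; lia.
case: r_cases => [r0|rn].
  have : pl \1%VF 1 \in limg (pl \1%VF) by rewrite memv_img ?memvf.
  have /eqP := r0; rewrite dimv_eq0 => /eqP->; rewrite memv0 plE !id_lfunE TE !antipode1.
  by rewrite -mulr2n -scaler_nat scalerA mulVf // scale1r oner_eq0.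
have full : limg (pl \1%VF) = fullv by apply/eqP; rewrite eqEdim subvf -[\dim (limg _)]/r rn leqnn.
have : x \in limg (pl \1%VF) by rewrite full memvf.
case/memv_imgP=> y _ ->; rewrite -TE plE !id_lfunE linearZ linearD /= TT.
by rewrite addrC.
Qed.
End Involution.

(** * The adjoint action, coideals and the action of the double *)

Section Coideal.
Variables (k : fieldType) (H : hopfAlgType k).
Implicit Types (V W : vectType k) (x y h : H) (X Y : {vspace H}).
Local Notation S := (@antipode k H).

Fact adjoint_linear h : linear (fun x => \sw_(a, b <- h) (a * x * S b)).
Proof. by lin_tac. Qed.
Definition adjoint h : 'End(H) := linfun (HB.pack_for {linear H -> H}
  (fun x => \sw_(a, b <- h) (a * x * S b)) (GRing.isLinear.Build k H H *:%R _ (adjoint_linear h))).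

Lemma adjointE h x : adjoint h x = \sw_(a, b <- h) (a * x * S b).
Proof. by rewrite lfunE. Qed.

(* The action of the Drinfeld double of [H] on [H]. *)
Definition double_op (i : H + 'Hom(H, k^o)) : 'End(H) :=
  match i with inl h => adjoint h | inr f => ltrans f end.

(** The sum defining [tlift] runs over basis vectors of [H] and does not show where the second leg
    lies. Here the second legs are [ltrans] of [x], so they stay in any coideal containing [x]. *)
Lemma sw_ltrans V (F : H -> H -> V) x : bilin F ->
  \sw_(a, b <- x) F a b = \sum_(i < \dim {:H}) F (vbasis {:H})`_i (ltrans (vcoord i) x).
Proof.
move=> F2; under eq_bigr => i _.
  rewrite ltransE (lin_tlift (h := F _)); last exact: bilin2 F2.
  over.
rewrite -tlift_sum; apply: eq_tlift => a b; rewrite [in LHS](coord_vbasis (memvf a)).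
have FL : islin (F^~ b) := bilin1 b F2.
rewrite (lin_sum FL); apply: eq_bigr => i _.
by rewrite vcoordE (linear_Z _ _ (bilin2 _ F2)).
Qed.

Lemma memv_tlift (U V W : vectType k) (F : U -> V -> W) (Z : {vspace W}) t :
  (forall a b, F a b \in Z) -> tlift F t \in Z.
Proof. by move=> FZ; rewrite tliftE_pair memv_suml // => p _; rewrite memvZ. Qed.

Definition coideal X := forall f x, x \in X -> ltrans f x \in X.

Lemma sw_coideal_eq V (F G : H -> H -> V) X x : coideal X -> x \in X -> bilin F -> bilin G ->
  (forall a b, b \in X -> F a b = G a b) -> \sw_(a, b <- x) F a b = \sw_(a, b <- x) G a b.
Proof.
move=> cX Xx F2 G2 E; rewrite !sw_ltrans //; apply: eq_bigr => i _.
by rewrite E // cX.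
Qed.

Lemma sw_coideal_mem V (F : H -> H -> V) X (Z : {vspace V}) x : coideal X -> x \in X -> bilin F ->
  (forall a b, b \in X -> F a b \in Z) -> \sw_(a, b <- x) F a b \in Z.
Proof.
move=> cX Xx F2 FZ; rewrite sw_ltrans // memv_suml // => i _.
by rewrite FZ // cX.
Qed.

Lemma double_stable X : stable double_op X <->
  (forall h x, x \in X -> adjoint h x \in X) /\ coideal X.
Proof.
split=> [sX|[aX cX] [h|f]]; [|exact: aX|exact: cX].
by split=> [h|f]; [exact: (sX (inl h)) | exact: (sX (inr f))].
Qed.

Lemma adjoint_mul h x y : adjoint h (x * y) = \sw_(a, b <- h) (adjoint a x * adjoint b y).
Proof.
symmetry; under eq_tlift => a b.
  rewrite adjointE (lin_tlift (h := fun u => u * _)); last by lin_tac.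
  under eq_tlift => c d.
    rewrite adjointE (lin_tlift (h := fun u => _ * u)); last by lin_tac.
    over.
  over.
rewrite /= (sw_coassoc (F := fun c d b => \sw_(e, f <- b) (c * x * S d * (e * y * S f)))); last by tri_tac.
rewrite adjointE; apply: eq_tlift => a b.
rewrite -(sw_coassoc (F := fun c d f => a * x * S c * (d * y * S f))); last by tri_tac.
under eq_tlift => c f.
  under eq_tlift => d e do rewrite !mulrA -[_ * S d * e]mulrA.
  rewrite (sw_antipodel (F := fun u => a * x * u * y * S f)); last by lin_tac.
  rewrite mulr1; over.
by rewrite /= (sw_counitl (F := fun f => a * x * y * S f)) ?mulrA //; lin_tac.
Qed.

Lemma coideal_prod X Y : coideal X -> coideal Y -> coideal (X * Y).
Proof.
move=> cX cY f z XYz; have : z \in (ltrans f @^-1: (X * Y))%VS; last by rewrite -memv_preim.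
move: z XYz; apply/subvP/prodvP => x y Xx Yy; rewrite -memv_preim ltransE sw_mul; last by bil_tac.
apply: (sw_coideal_mem cX Xx); first by bil_tac.
move=> a b Xb; apply: (sw_coideal_mem cY Yy); first by bil_tac.
by move=> c d Yd; rewrite memvZ // memv_mul.
Qed.

Lemma double_stable_prod X Y : stable double_op X -> stable double_op Y -> stable double_op (X * Y).
Proof.
move=> /double_stable[aX cX] /double_stable[aY cY]; apply/double_stable.
split; last exact: coideal_prod.
move=> h z XYz; have : z \in (adjoint h @^-1: (X * Y))%VS; last by rewrite -memv_preim.
move: z XYz; apply/subvP/prodvP => x y Xx Yy; rewrite -memv_preim adjoint_mul.
by apply: memv_tlift => a b; rewrite memv_mul ?aX ?aY.
Qed.
End Coideal.

(** * Invariant projections over the double *)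

Section Involutive.
Variables (k : closedFieldType) (H : hopfAlgType k).
Hypothesis char0 : [pchar k] =i pred0.
Hypothesis ssH : semisimple_algebra H.
Implicit Types (V : vectType k) (x y h : H) (f : 'Hom(H, k^o)) (X : {vspace H}).
Local Notation S := (@antipode k H).
Local Notation lam := (coint H).
Variable Lam : H.
Hypothesis intL : integral Lam.

Lemma antipodeV_antipode x : antipodeV H x = S x.
Proof. by rewrite -[x in LHS](antipodeK char0 ssH) (antipodeKV ssH intL). Qed.

Lemma sw_antipode_opr V (F : H -> V) x : islin F ->
  \sw_(a, b <- x) F (b * S a) = counit x *: F 1.
Proof.
move=> FL; rewrite -(sw_antipodeVl ssH intL x FL).
by apply: eq_tlift => a b; rewrite antipodeV_antipode.
Qed.

Lemma sw_antipode_opl V (F : H -> V) x : islin F ->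
  \sw_(a, b <- x) F (S b * a) = counit x *: F 1.
Proof.
move=> FL; rewrite -(sw_antipodeVr ssH intL x FL).
by apply: eq_tlift => a b; rewrite antipodeV_antipode.
Qed.

Lemma cointC x y : lam (x * y) = lam (y * x).
Proof. by rewrite (coint_mulC ssH intL) (antipodeK char0 ssH). Qed.

Lemma coint_lftr x : lam x = lftr (amull x).
Proof.
rewrite [LHS]lfunE /= /coint_fun; congr lftr; apply/lfunP=> y.
by rewrite !comp_lfunE !antipodeV_antipode (antipodeK char0 ssH).
Qed.

Lemma coint1_dim : lam 1 = (\dim {:H})%:R.
Proof.
rewrite coint_lftr -(lftr_id H); congr lftr; apply/lfunP=> x.
by rewrite amullE mul1r id_lfunE.
Qed.

Lemma dim_neq0 : (\dim {:H})%:R != 0 :> k.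
Proof.
rewrite (natr_eq0_char0 char0) dimv_eq0; apply/eqP=> F0.
by have := memvf (1 : H); rewrite F0 memv0 oner_eq0.
Qed.

Lemma distinguished1 : distinguished Lam = 1.
Proof.
have := sw_coint_right ssH intL 1; rewrite sw_1; last by bil_tac.
by rewrite coint1_dim => /(scalerI dim_neq0).
Qed.

Lemma sw_cointr x : \sw_(a, b <- x) ((lam b : k) *: a) = (lam x : k) *: 1.
Proof. by rewrite (sw_coint_right ssH intL) distinguished1. Qed.

Lemma sw_cointl x : \sw_(a, b <- x) ((lam a : k) *: b) = (lam x : k) *: 1.
Proof.
apply/eqP; rewrite -subr_eq0; apply/eqP/functional_sep => f.
have /lfunP/(_ x) := coint_left ssH intL f; rewrite dual_mulE scale_lfunE linearB linearZ /= => E.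
apply/eqP; rewrite subr_eq0 lfun_tlift; apply/eqP.
by rewrite [RHS]mulrC -[RHS]E; apply: eq_tlift => a b; rewrite linearZ.
Qed.

Lemma coint_antipode_id x : lam (S x) = lam x.
Proof. by rewrite (coint_antipode ssH intL) distinguished1 mulr1. Qed.

Lemma functional_coint f : exists h, forall x, f x = lam (S h * x).
Proof.
exists (\sw_(a, b <- Lam) ((f a : k) *: b)) => x; set h := tlift _ _.
have -> : f = (lam \o amull (S h))%VF; last by rewrite comp_lfunE amullE.
apply: (integral_functional_ext ssH intL).
under [RHS]eq_tlift => a b do rewrite comp_lfunE amullE.
by rewrite (coint_mull ssH intL).
Qed.

(** With $S^2=1$, [lam] is a trace invariant under [S]. Writing [f] as [lam (S h * _)], contraction
    of either leg of [Lam] with [f] gives [h]. *)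
Lemma sw_integralC V (F : H -> H -> V) : bilin F ->
  \sw_(a, b <- Lam) F a b = \sw_(a, b <- Lam) F b a.
Proof.
move=> F2; suff E : comul Lam = \sw_(a, b <- Lam) (b ⊗ a).
  rewrite [in LHS]E lfun_tlift; apply: eq_tlift => a b.
  by rewrite tliftE.
apply: tens_sep => f g; have [h fE] := functional_coint f.
transitivity (g h : k).
  rewrite -[in RHS](coint_mull ssH intL h) lfun_tlift; apply: eq_tlift => a b.
  by rewrite linearZ fE.
rewrite lfun_tlift; under eq_tlift => a b do rewrite tpairE fE.
rewrite -[in RHS](antipode_integral ssH intL) sw_antipode; last by bil_tac.
under [RHS]eq_tlift => a b do rewrite -antipodeM coint_antipode_id.
rewrite -[h in LHS](antipodeK char0 ssH) -(coint_mulr ssH intL h) !lfun_tlift.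
by apply: eq_tlift => a b; rewrite !linearZ.
Qed.

Lemma lftr_rtrans f : lftr (rtrans f) = (\dim {:H})%:R * (f Lam : k).
Proof.
rewrite (lftr_integral ssH intL); under eq_tlift => a b.
  rewrite rtransE (lin_tlift (X := k^o) (h := fun y => lam (S y * a))); last by lin_tac.
  under eq_tlift => c d do rewrite linearZ -scalerAl linearZ /= cointC.
  over.
rewrite /= -(sw_coassoc (F := fun a c d => (f d : k) *: (lam (a * S c) : k^o))); last by tri_tac.
under eq_tlift => a b.
  rewrite (tliftZ (W := k^o)) (sw_antipoder (F := lam)); last by lin_tac.
  rewrite coint1_dim; over.
rewrite /= -(sw_counitl (F := fun b => (\dim {:H})%:R * (f b : k) : k^o)); last by lin_tac.
apply: (@eq_tlift k H H k^o) => a b.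
by rewrite /GRing.scale /= mulrCA [X in _ = _ * X]mulrC.
Qed.

(** Invariance of [lam] expands the scalar [lam (x * S c)] into a double Sweedler sum, after which
    the antipode cancels the spare factor. The effect is to move the free leg from [x] to [y], and
    so into any coideal containing [y]. *)
Lemma sw_coint_antipode x y :
  \sw_(a, b <- x) ((lam (b * S y) : k) *: a) = \sw_(c, d <- y) ((lam (x * S c) : k) *: d).
Proof.
have E c : (lam (x * S c) : k) *: 1 =
    \sw_(a, b <- x) \sw_(e, f <- c) ((lam (b * S e) : k) *: (a * S f)).
  rewrite -sw_cointr sw_mul; last by bil_tac.
  by apply: eq_tlift => a b; rewrite sw_antipode //; bil_tac.
have E' c d : (lam (x * S c) : k) *: d =
    \sw_(a, b <- x) \sw_(e, f <- c) ((lam (b * S e) : k) *: (a * (S f * d))).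
  rewrite -[d in LHS]mul1r scalerAl E (lin_tlift (h := fun u => u * d)); last by lin_tac.
  apply: eq_tlift => a b; rewrite (lin_tlift (h := fun u => u * d)); last by lin_tac.
  by apply: eq_tlift => e f; rewrite -scalerAl -mulrA.
symmetry; under eq_tlift => c d do rewrite E'.
rewrite /= tlift_swap; apply: eq_tlift => a b.
rewrite (sw_coassoc (F := fun e (f : H) d => (lam (b * S e) : k) *: (a * (S f * d)))); last by tri_tac.
under eq_tlift => e d.
  rewrite (sw_antipodel (F := fun u => (lam (b * S e) : k) *: (a * u))); last by lin_tac.
  rewrite mulr1; over.
by rewrite /= (sw_counitr (F := fun e => (lam (b * S e) : k) *: a)) //; lin_tac.
Qed.

Lemma adjoint_lin : islin (@adjoint k H).
Proof.
move=> c a b; apply/lfunP=> x; rewrite lfunPl !adjointE.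
have L : linear (fun h => \sw_(a, b <- h) (a * x * S b)) by lin_tac.
exact: L.
Qed.

Lemma adjointM x y (z : H) : adjoint (x * y) z = adjoint x (adjoint y z).
Proof.
rewrite [LHS]adjointE [adjoint y z]adjointE sw_mul; last by bil_tac.
rewrite adjointE; apply: eq_tlift => a b.
rewrite (lin_tlift (h := fun u => a * u * S b)); last by lin_tac.
by apply: eq_tlift => c d; rewrite antipodeM !mulrA.
Qed.

Lemma adjoint1 (z : H) : adjoint 1 z = z.
Proof.
rewrite adjointE sw_1; last by bil_tac.
by rewrite antipode1 mulr1 mul1r.
Qed.

(** Maschke averaging, with [Lam] in the role of the normalised sum over a group. *)
Definition adjoint_average (P : 'End(H)) : 'End(H) :=
  tlift (fun a b => adjoint a \o P \o adjoint (S b))%VF (comul Lam).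

Lemma adjoint_averageE P x : adjoint_average P x = \sw_(a, b <- Lam) adjoint a (P (adjoint (S b) x)).
Proof.
rewrite /adjoint_average (lin_tlift (h := fun A : 'End(H) => A x)); last by lin_tac.
by apply: eq_tlift => a b; rewrite !comp_lfunE.
Qed.

Lemma adjoint_average_comm (P : 'End(H)) h x : adjoint h (adjoint_average P x) = adjoint_average P (adjoint h x).
Proof.
have aL := adjoint_lin.
rewrite !adjoint_averageE lfun_tlift; under eq_tlift => a b do rewrite -adjointM.
rewrite -[h in LHS](antipodeK char0 ssH).
rewrite -(casimirl intL (F := fun a b => adjoint a (P (adjoint (S b) x)))); last by bil_tac.
by apply: eq_tlift => a b; rewrite antipodeM (antipodeK char0 ssH) adjointM.
Qed.

Lemma adjoint_average_id (P : 'End(H)) X x : stable (@double_op k H) X -> (forall y, y \in X -> P y = y) ->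
  x \in X -> adjoint_average P x = x.
Proof.
have aL := adjoint_lin.
move=> /double_stable[aX _] PX Xx; rewrite adjoint_averageE.
under eq_tlift => a b do rewrite PX ?aX // -adjointM.
rewrite (sw_antipoder (F := fun h => adjoint h x)); last by lin_tac.
by rewrite (counit_integral intL) scale1r adjoint1.
Qed.

Lemma adjoint_average_mem (P : 'End(H)) X x : stable (@double_op k H) X -> (forall y, P y \in X) ->
  adjoint_average P x \in X.
Proof.
by move=> /double_stable[aX _] PX; rewrite adjoint_averageE memv_tlift // => a b; rewrite aX.
Qed.

(** Insert the counit of the first leg of [h] into [f (x * h)] and trade it for the adjoint action.
    Cancelling $h_3\,S(h_2)$, in the order opposite to the antipode axiom, is where $S^2=1$
    enters. *)
Lemma adjoint_tracial (f : 'Hom(H, k^o)) :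
  (forall h x, f (adjoint h x) = counit h *: f x) -> tracial f.
Proof.
move=> fa h x; symmetry.
have aL := adjoint_lin.
rewrite -[in LHS](sw_counitl (F := fun b => f (x * b))); last by lin_tac.
under eq_tlift => a b do rewrite -fa adjointE.
under eq_tlift => a b do rewrite lfun_tlift.
rewrite /= (sw_coassoc (F := fun c d b => f (c * (x * b) * S d))); last by tri_tac.
under eq_tlift => a b.
  under eq_tlift => c d do rewrite -!mulrA.
  rewrite (sw_antipode_opr (F := fun u => f (a * (x * u)))); last by lin_tac.
  rewrite mulr1; over.
by rewrite /= (sw_counitr (F := fun a => f (a * x))) //; lin_tac.
Qed.

Lemma sw_adjoint V (F : H -> H -> V) h x : bilin F ->
  \sw_(u, v <- adjoint h x) F u v =
  \sw_(a, b <- h) \sw_(c, e <- b) \sw_(u, v <- x) F (a * u * S e) (adjoint c v).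
Proof.
move=> F2; have aL := adjoint_lin.
rewrite adjointE (lin_tlift (h := fun z => \sw_(u, v <- z) F u v)); last by lin_tac.
pose K (a c1 c2 e : H) := \sw_(u, v <- x) F (a * u * S e) (c1 * v * S c2).
transitivity (\sw_(a, b <- h) \sw_(a1, a2 <- a) \sw_(b1, b2 <- b) K a1 a2 b1 b2).
  apply: eq_tlift => a b; rewrite sw_mul // sw_mul; last by bil_tac.
  apply: eq_tlift => a1 a2; rewrite /K [RHS]tlift_swap; apply: eq_tlift => u v.
  by rewrite sw_antipode //; bil_tac.
rewrite (sw_coassoc (F := fun a1 a2 b => \sw_(b1, b2 <- b) K a1 a2 b1 b2)); last by rewrite /K; tri_tac.
apply: eq_tlift => a b; rewrite -(sw_coassoc (F := fun a2 b1 b2 => K a a2 b1 b2)); last by rewrite /K; tri_tac.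
apply: eq_tlift => c e; rewrite [LHS]tlift_swap; apply: eq_tlift => u v.
by rewrite adjointE (lin_tlift (h := F _)) //; lin_tac.
Qed.

Lemma coint_adjoint h x y :
  \sw_(a, b <- h) \sw_(c, e <- b) (lam (a * x * S e * S (adjoint c y)) : k^o) =
  counit h *: (lam (x * S y) : k^o).
Proof.
pose K (a c1 c2 e : H) : k^o := lam (S c1 * (a * x * (S e * c2) * S y)).
transitivity (\sw_(a, b <- h) \sw_(c, e <- b) \sw_(c1, c2 <- c) K a c1 c2 e).
  apply: eq_tlift => a b; apply: eq_tlift => c e.
  rewrite adjointE (lin_tlift (h := fun z => lam (a * x * S e * S z) : k^o)); last by lin_tac.
  apply: eq_tlift => c1 c2; rewrite !antipodeM (antipodeK char0 ssH) !mulrA cointC.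
  by rewrite /K !mulrA.
under eq_tlift => a b.
  rewrite (sw_coassoc (F := fun c1 c2 e => K a c1 c2 e)); last by rewrite /K; tri_tac.
  under eq_tlift => c1 c2.
    rewrite (sw_antipode_opl (F := fun z => lam (S c1 * (a * x * z * S y)) : k^o)); last by lin_tac.
    over.
  rewrite (sw_counitr (F := fun c1 => lam (S c1 * (a * x * 1 * S y)) : k^o)); last by lin_tac.
  rewrite mulr1 -!mulrA [S _ * _]mulrA; over.
by rewrite /= (sw_antipode_opl (F := fun z => lam (z * (x * S y)) : k^o)) ?mul1r //; lin_tac.
Qed.

(* Averaging a linear projection onto [X] over the double: such a projection commutes with every
   [ltrans f], hence is [rtrans f] for a functional [f], which is tracial by ad-invariance. *)
Lemma double_projection X : stable (@double_op k H) X ->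
  exists f : 'Hom(H, k^o), [/\ tracial f, forall x, rtrans f x \in X & forall x, x \in X -> rtrans f x = x].
Proof.
move=> sX; have [aX cX] := iffLR (double_stable X) sX.
pose P := adjoint_average (projv X).
have PX x : P x \in X by apply: adjoint_average_mem => // y; apply: memv_proj.
have Pid x : x \in X -> P x = x by apply: adjoint_average_id => // y; apply: projv_id.
pose n : k := (\dim {:H})%:R.
(* The operator [rtrans f] is the average of [P] over the dual Hopf algebra with respect to its
   integral [lam]; the factor [n^-1] normalises [lam 1 = n]. *)
pose f : 'Hom(H, k^o) := n^-1 *: (tlift (fun a b => lam (a * S (P b)) : k^o) \o comul)%VF.
have fE x : f x = n^-1 *: \sw_(a, b <- x) (lam (a * S (P b)) : k^o).
  by rewrite scale_lfunE comp_lfunE.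
exists f; split.
- apply: adjoint_tracial => h x; rewrite !fE scalerA mulrC -scalerA; congr (_ *: _).
  rewrite sw_adjoint; last by bil_tac.
  under eq_tlift => a b do under eq_tlift => c e do under eq_tlift => u v do
    rewrite -adjoint_average_comm.
  under eq_tlift => a b do rewrite tlift_swap.
  rewrite /= tlift_swap; under eq_tlift => u v do rewrite coint_adjoint.
  by rewrite /= (tliftZ (W := k^o)).
- move=> x; rewrite rtransE; under eq_tlift => a b.
    rewrite fE -scalerA (lin_tlift (X := H) (h := fun c : k^o => (c : k) *: a)); last by lin_tac.
    over.
  rewrite /= swZ memvZ // -(sw_coassoc (F := fun a c d => (lam (c * S (P d)) : k) *: a)); last by tri_tac.
  apply: memv_tlift => a b; rewrite sw_coint_antipode.
  apply: (sw_coideal_mem cX (PX b)); first by bil_tac.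
  by move=> c d Xd; rewrite memvZ.
move=> x Xx; rewrite rtransE.
rewrite (sw_coideal_eq (G := fun a b => (counit b : k) *: a) cX Xx); [|by bil_tac|by bil_tac|].
  exact: counitr.
move=> a b Xb; rewrite fE.
rewrite (sw_coideal_eq (G := fun c d => (lam (c * S d) : k^o)) cX Xb); [|by bil_tac|by bil_tac|].
  rewrite (sw_antipoder (F := lam)); last by lin_tac.
  by rewrite coint1_dim /GRing.scale /= mulrCA mulVf ?dim_neq0 // mulr1.
by move=> c d Xd; rewrite Pid.
Qed.
End Involutive.

(** The hypothesis makes [n / d] an eigenvalue of an integer matrix over [k]. The vanishing integer
    determinant says the same over [algC], where a rational algebraic integer is an integer. *)
Lemma dvdn_int_eigenvalue (k : fieldType) (T : finType) (B : T -> T -> int) (w : T -> k) (n d : nat) :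
    [pchar k] =i pred0 -> (0 < d)%N -> (exists t, w t != 0) ->
    (forall t, d%:R * (\sum_s (B t s)%:~R * w s) = n%:R * w t) ->
  (d %| n)%N.
Proof.
move=> char0 d0 [t0 nzt0] Bw.
pose A : 'M[int]_#|T| := \matrix_(i, j) B (enum_val i) (enum_val j).
pose M : 'M[int]_#|T| := n%:R%:M - d%:R *: A.
have detM : \det M = 0.
  apply/eqP; rewrite -(intr_eq0_char0 char0) -det_map_mx -det_tr; apply/det0P.
  exists (\row_i w (enum_val i)).
    apply: contra nzt0 => /eqP/rowP/(_ (enum_rank t0)).
    by rewrite !mxE enum_rankK => ->.
  apply/rowP=> i; rewrite !mxE.
  transitivity (n%:R * w (enum_val i) - d%:R * \sum_s (B (enum_val i) s)%:~R * w s); last first.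
    by rewrite Bw subrr.
  have -> : n%:R * w (enum_val i) = \sum_j w (enum_val j) * ((n%:R *+ (i == j) : int)%:~R).
    rewrite (bigD1 i) //= eqxx mulr1n rmorph_nat mulrC big1 ?addr0 // => j /negPf nji.
    by rewrite eq_sym nji mulr0n mulr0.
  rewrite mulr_sumr [X in _ - X](reindex (enum_val : 'I_#|T| -> T)) /=; last exact/onW_bij/enum_val_bij.
  rewrite -sumrB; apply: eq_bigr => j _; rewrite !mxE rmorphB rmorphM /= rmorph_nat mulrBr.
  by congr (_ - _); rewrite mulrCA; congr (_ * _); apply: mulrC.
have d0C : (d%:R : algC) != 0 by rewrite pnatr_eq0 -lt0n.
pose AC := map_mx (intr : int -> algC) A.
have eig : eigenvalue AC (n%:R / d%:R).
  have /eqP/det0P[v nzv vM] : \det (map_mx (intr : int -> algC) M) = 0 by rewrite det_map_mx detM.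
  apply/eigenvalueP; exists v => //.
  move: vM; rewrite map_mxB map_scalar_mx map_mxZ /= !(rmorph_nat (intr : {rmorphism int -> algC})).
  rewrite mulmxBr mul_mx_scalar -scalemxAr.
  move/eqP; rewrite subr_eq0 => /eqP E.
  by apply: (scalerI d0C); rewrite -E scalerA mulrC divfK.
have nd_Aint : n%:R / d%:R \in Aint.
  apply: (root_monic_Aint (p := char_poly AC)).
  - by rewrite -eigenvalue_root_char.
  - exact: char_poly_monic.
  by rewrite /AC -map_char_poly; apply/polyOverP=> i; rewrite coef_map rpred_int.
have nd_Crat : (n%:R / d%:R : algC) \in Crat by rewrite rpred_div ?rpred_nat.
have nd_int := Cint_rat_Aint nd_Crat nd_Aint.
by rewrite -dvdC_nat; apply/dvdCP; exists (n%:R / d%:R); rewrite ?divfK.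
Qed.

(** * Dimensions of the minimal submodules over the double *)

Section MinimalDimension.
Variables (k : closedFieldType) (H : hopfAlgType k).
Hypothesis char0 : [pchar k] =i pred0.
Hypothesis ssH : semisimple_algebra H.
Implicit Types (V : vectType k) (x y h : H) (f g : 'Hom(H, k^o)) (X : {vspace H}).
Local Notation S := (@antipode k H).
Local Notation lam := (coint H).
Local Notation D := (dual_hopf H).
Variable Lam : H.
Hypothesis intL : integral Lam.

Lemma tracial_adjoint f h x : tracial f -> f (adjoint h x) = counit h *: f x.
Proof.
move=> trf; rewrite adjointE lfun_tlift.
under eq_tlift => a b do rewrite -mulrA trf -mulrA.
rewrite (sw_antipode_opl char0 ssH intL (F := fun u => f (x * u))); last by lin_tac.
by rewrite mulr1.
Qed.

Lemma rtrans_adjoint f h x : tracial f -> rtrans f (adjoint h x) = adjoint h (rtrans f x).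
Proof.
move=> trf; rewrite rtransE sw_adjoint; last by bil_tac.
under eq_tlift => a b do under eq_tlift => c e do under eq_tlift => u v do
  rewrite tracial_adjoint // -scalerA.
under eq_tlift => a b do under eq_tlift => c e do rewrite swZ.
under eq_tlift => a b.
  rewrite (sw_counitl (F := fun e => \sw_(u, v <- x) ((f v : k) *: (a * u * S e)))); last by lin_tac.
  over.
rewrite /= tlift_swap rtransE lfun_tlift; apply: eq_tlift => u v.
by rewrite swZ [RHS]linearZ /= adjointE.
Qed.

Lemma rtrans_double i f x : tracial f -> rtrans f (double_op i x) = double_op i (rtrans f x).
Proof. by case: i => [h|g] trf; [exact: rtrans_adjoint | exact: rtrans_ltrans]. Qed.

Lemma double_complemented : complemented (@double_op k H).
Proof.
move=> U sU; have [f [trf fU fid]] := double_projection char0 ssH intL sU.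
exists (lker (rtrans f)); split.
- move=> i x; rewrite !memv_ker rtrans_double // => /eqP->; by rewrite linear0.
- apply/eqP; rewrite eqEsubv subvf; apply/subvP=> x _.
  rewrite -[x](subrK (rtrans f x)) addrC memv_add ?fU //.
  by rewrite memv_ker linearB /= [rtrans f (rtrans f x)]fid ?subrr.
apply/eqP; rewrite -subv0; apply/subvP=> x /memv_capP[Ux].
by rewrite memv_ker fid // memv0.
Qed.

Lemma tracial_mul (f g : D) : tracial f -> tracial g -> tracial (f * g : D).
Proof.
move=> trf trg x y; rewrite !dual_mulE sw_mul; last by bil_tac.
rewrite sw_mul; last by bil_tac.
rewrite tlift_swap; apply: (@eq_tlift k H H k^o) => a b.
by apply: (@eq_tlift k H H k^o) => c d; rewrite trf trg.
Qed.

Lemma tracial_antipode f : tracial f -> tracial (antipode (f : D) : D).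
Proof. by move=> trf x y; rewrite !dual_antipodeE !antipodeM trf. Qed.

Lemma dual_integralC (f g : D) : (f * g : D) Lam = (g * f : D) Lam.
Proof.
rewrite !dual_mulE (sw_integralC char0 ssH intL); last by bil_tac.
by apply: (@eq_tlift k H H k^o) => a b; rewrite mulrC.
Qed.

(** Character orthogonality: paired through [Lam], [antipode (idem_char x)] represents evaluation at
    [x]. The trace defining the character is expanded with a second copy of [Lam], which the Casimir
    rules then collapse. *)
Lemma idem_char_pairing (g : D) x : tracial g ->
  (g * antipode (idem_char x : D) : D) Lam = g x.
Proof.
move=> trg; rewrite dual_mulE; under eq_tlift => a b.
  rewrite dual_antipodeE idem_charE (lftr_integral ssH intL).
  rewrite -[_ * _]/(g a *: _) -(tliftZ (W := k^o)).
  under eq_tlift => c d do rewrite mulLRE !antipodeM (antipodeK char0 ssH) -!mulrA.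
  over.
rewrite /= tlift_swap.
have E c d : \sw_(a, b <- Lam) ((g a : k) *: (lam (S x * (S d * (b * c))) : k^o)) =
    \sw_(a, b <- Lam) ((g (S c * d * a) : k) *: (lam (S x * b) : k^o)).
  rewrite -[c in LHS](antipodeK char0 ssH).
  rewrite -(casimirr intL (F := fun a b => (g a : k) *: (lam (S x * (S d * b)) : k^o))).
  rewrite (casimirl intL (F := fun a b => (g (a * S c) : k) *: (lam (S x * b) : k^o))).
  - by apply: (@eq_tlift k H H k^o) => a b; rewrite (antipodeK char0 ssH) trg mulrA.
  - by bil_tac.
  - by bil_tac.
under eq_tlift => c d do rewrite E.
rewrite /= (sw_antipodel (F := fun u => \sw_(a, b <- Lam) ((g (u * a) : k) *: (lam (S x * b) : k^o)))); last by lin_tac.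
rewrite (counit_integral intL) scale1r; under eq_tlift => a b do rewrite mul1r.
rewrite /= (sw_integralC char0 ssH intL (F := fun a b => (g a : k) *: (lam (S x * b) : k^o))); last by bil_tac.
rewrite -[in RHS](coint_mull ssH intL x) lfun_tlift; apply: (@eq_tlift k H H k^o) => a b.
by rewrite linearZ; apply: mulrC.
Qed.

Lemma idem_char_nat x e : x * x = x -> e * e = e -> exists m : nat, idem_char e x = m%:R.
Proof. by move=> xx ee; exists (\dim (limg (mulLR x e))); rewrite idem_charE mulLR_idem. Qed.

(** The value is the rank of [x] on the tensor product of the modules [A e] and [A e'], with [A] the
    algebra [H]. Structure constants of characters are thus natural numbers. *)
Lemma idem_char_mul_nat x e e' : x * x = x -> e * e = e -> e' * e' = e' ->
  exists m : nat, ((idem_char e : D) * (idem_char e' : D) : D) x = m%:R.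
Proof.
move=> xx ee ee'.
pose L y : 'End(tens H H) := \sw_(a, b <- y) tmap (mulLR a e) (mulLR b e').
have LE y u v : L y (u ⊗ v) = \sw_(a, b <- y) ((a * u * e) ⊗ (b * v * e')).
  rewrite /L (lin_tlift (h := fun M : 'End(tens H H) => M (u ⊗ v))); last by lin_tac.
  by apply: eq_tlift => a b; rewrite tmapE !mulLRE.
have LL : (L x \o L x = L x)%VF.
  apply/lfunP; apply: tens_ind => [u v|c s t Hs Ht]; last by rewrite !lfun_lin Hs Ht.
  rewrite [LHS]comp_lfunE !LE lfun_tlift; under eq_tlift => a b do rewrite LE.
  rewrite -[x in RHS]xx sw_mul; last by bil_tac.
  rewrite tlift_swap; apply: eq_tlift => a b; apply: eq_tlift => c d.
  by rewrite -!mulrA ee ee'.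
exists (\dim (limg (L x))); rewrite -lftr_idem // dual_mulE.
rewrite (lin_tlift (X := k^o) (h := fun M : 'End(tens H H) => lftr M : k^o)); last first.
  by move=> c A B; rewrite /= lftrP.
by apply: (@eq_tlift k H H k^o) => a b; rewrite lftr_tmap !idem_charE.
Qed.

(** The projection onto [X] is [rtrans f] with [f] idempotent and tracial, and [n * f Lam] is its
    rank. By Schur's lemma [f * c * f = a c *: f] for tracial [c]. The Casimir element of the
    character algebra, seen through [a] on two factors, acts as multiplication by [1 / t], that is
    [n / \dim X], and its matrix on pairs of irreducible characters is integral. *)
Lemma dvdn_minimal X : minimal (@double_op k H) X -> (\dim X %| \dim {:H})%N.
Proof.
move=> minX; have [sX nzX _] := minX.
have [f [trf fX fid]] := double_projection char0 ssH intL sX.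
pose n : k := (\dim {:H})%:R; have nzn : n != 0 := dim_neq0 H char0.
have limgf : limg (rtrans f) = X.
  apply/eqP; rewrite eqEsubv; apply/andP; split; apply/subvP=> x.
    by case/memv_imgP=> y _ ->.
  by move=> Xx; rewrite -(fid x Xx) memv_img ?memvf.
have ff : (f : D) * f = f.
  apply: rtrans_inj; rewrite -rtransM; apply/lfunP=> x.
  by rewrite comp_lfunE fid.
pose t : k := f Lam.
have nt : n * t = (\dim X)%:R.
  rewrite -limgf -lftr_idem ?(lftr_rtrans char0 ssH intL) //.
  by rewrite rtransM ff.
have nzt : t != 0.
  have : n * t != 0 by rewrite nt (natr_eq0_char0 char0) dimv_eq0.
  by rewrite mulf_eq0 negb_or => /andP[].
have fcf (c : D) : tracial c -> (f : D) * c * f = (((c * f : D) Lam : k) / t) *: (f : D).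
  move=> trc; have [s sP] : exists s, forall u, u \in X -> rtrans ((f : D) * c * f) u = s *: u.
    apply: (schur minX) => [u Xu|i u Xu].
      by rewrite -!rtransM comp_lfunE comp_lfunE fX.
    by apply: rtrans_double; do 2?apply: tracial_mul.
  have E : (f : D) * c * f = s *: (f : D).
    have -> : (f : D) * c * f = (f : D) * c * f * f by rewrite -[RHS]mulrA ff.
    apply: rtrans_inj; rewrite -rtransM; apply/lfunP=> x.
    by rewrite comp_lfunE sP // rtransZ scale_lfunE.
  rewrite E; congr (_ *: _); have := congr1 (fun h : D => h Lam : k) E.
  by rewrite /= -mulrA dual_integralC -mulrA ff scale_lfunE => ->; rewrite mulfK.
have [r [e [pe oe te]]] := primitive_representatives ssH.
pose chi i : D := idem_char (e i).
have ee i : e i * e i = e i by have [] := pe i.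
have trchi i : tracial (chi i) by apply: idem_char_tracial.
have chiE (g : D) : tracial g -> g = \sum_i (g (e i) : k) *: chi i.
  move=> trg; apply/lfunP=> x; rewrite te // sum_lfunE; apply: eq_bigr => i _.
  by rewrite scale_lfunE.
pose a (c : D) : k := (c * f : D) Lam / t.
have aL : linear (a : D -> k^o).
  by move=> b c c'; rewrite /a mulrDl -scalerAl lfunPl mulrDl /GRing.scale /= mulrA.
have a_sum (c : 'I_r -> k) : a (\sum_i c i *: chi i) = \sum_i c i * a (chi i) by rewrite (lin_sum aL).
(* The two legs of the Casimir element, the sum of [chi l ⊗ antipode (chi l)], multiplied by [u] and
   [v] and evaluated by [a]. *)
pose Y (u v : D) := \sum_l a (chi l * u) * a (antipode (chi l) * v).
have YE (u v : D) : tracial u -> tracial v -> t * Y u v = a u * a v.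
  move=> tru trv; have E l : t * (a (chi l * u) * a (antipode (chi l) * v)) =
      ((v * f : D) (e l) : k) * ((chi l * (u * f) : D) Lam : k) / t.
    rewrite /a -[in antipode _ * v * f]mulrA (dual_integralC (antipode (chi l))) /chi idem_char_pairing; last exact: tracial_mul.
    rewrite -[chi l * u * f]mulrA; move: (_ Lam : k) (_ (e l) : k) => b c.
    by rewrite mulrA [t * _]mulrC divfK // mulrA [b * c]mulrC.
  rewrite /Y mulr_sumr; under eq_bigr => l _ do rewrite E.
  rewrite -mulr_suml.
  have -> : \sum_l ((v * f : D) (e l) : k) * ((chi l * (u * f) : D) Lam : k) = (v * f * (u * f) : D) Lam.
    have trvf : tracial (v * f : D) by apply: tracial_mul.
    rewrite [in RHS](chiE _ trvf) mulr_suml sum_lfunE; apply: eq_bigr => l _.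
    by rewrite -scalerAl scale_lfunE.
  rewrite -mulrA [(f : D) * (u * f)]mulrA fcf // -scalerAr scale_lfunE /a /GRing.scale /=.
  by rewrite [RHS]mulrA.
have [M ME] : exists M : 'I_r -> 'I_r -> 'I_r -> nat,
    forall l i m, (chi l * chi i : D) (e m) = (M l i m)%:R.
  have Mlim l i m : exists n : nat, (chi l * chi i : D) (e m) == n%:R by have [j ->] := idem_char_mul_nat (ee m) (ee l) (ee i); exists j.
  by exists (fun l i m => xchoose (Mlim l i m)) => l i m; apply/eqP/(xchooseP (Mlim l i m)).
have [N NE] : exists N : 'I_r -> 'I_r -> nat, forall l m, (antipode (chi l) : D) (e m) = (N l m)%:R.
  have Nlm l m : exists n : nat, (antipode (chi l) : D) (e m) == n%:R.
    rewrite dual_antipodeE; have [] := idem_char_nat (x := S (e m)) (e := e l) => [|//|j ->]; last by exists j.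
    by rewrite -antipodeM ee.
  by exists (fun l m => xchoose (Nlm l m)) => l m; apply/eqP/(xchooseP (Nlm l m)).
(* The matrix of [Y] on pairs of irreducible characters: [M] gives products and [N] the antipode. *)
pose B (p s : 'I_r * 'I_r) : int := \sum_l ((M l p.1 s.1)%:Z * \sum_j (N l j)%:Z * (M j p.2 s.2)%:Z).
pose w (p : 'I_r * 'I_r) := a (chi p.1) * a (chi p.2).
have a_mul l i : a (chi l * chi i) = \sum_m (M l i m)%:R * a (chi m).
  rewrite (chiE (chi l * chi i)); last exact: tracial_mul.
  by rewrite a_sum; apply: eq_bigr => m _; rewrite ME.
have a_smul l i : a (antipode (chi l) * chi i) = \sum_m (\sum_j (N l j)%:R * (M j i m)%:R) * a (chi m).
  rewrite {1}(chiE (antipode (chi l))); last exact: tracial_antipode.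
  rewrite mulr_suml; under eq_bigr => j _ do rewrite -scalerAl NE.
  rewrite (lin_sum aL); under eq_bigr => j _ do rewrite a_mul /GRing.scale /= mulr_sumr.
  rewrite exchange_big; apply: eq_bigr => m _; rewrite mulr_suml.
  by apply: eq_bigr => j _; rewrite mulrA.
have dX : (0 < \dim X)%N by rewrite lt0n dimv_eq0.
apply: (dvdn_int_eigenvalue (B := B) (w := w) char0 dX).
  have /existsP[i nzi] : [exists i, a (chi i) != 0].
    apply: contraNT (oner_neq0 k); rewrite negb_exists => /forallP a0.
    have tr1 : tracial (1 : D) by move=> x y; rewrite !dual_oneE !counitM mulrC.
    have : a 1 = 1 by rewrite /a mul1r divff.
    rewrite (chiE _ tr1) a_sum big1 => [<-//|i _].
    by have := a0 i; rewrite negbK => /eqP->; rewrite mulr0.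
  by exists (i, i); rewrite mulf_neq0.
case=> i j; rewrite -nt -mulrA; congr (_ * _).
rewrite {2}/w /= -(YE _ _ (trchi i) (trchi j)); congr (_ * _); rewrite /Y.
under [RHS]eq_bigr => l _ do rewrite a_mul a_smul.
rewrite /B /=; under eq_bigr => s _ do rewrite rmorph_sum mulr_suml.
rewrite exchange_big; apply: eq_bigr => l _ /=.
rewrite mulr_suml; under [RHS]eq_bigr => m _ do rewrite mulr_sumr.
rewrite pair_big; apply: eq_bigr => -[m m'] _ /=.
rewrite rmorphM rmorph_sum /w /= mulrACA; congr (_ * _); congr (_ * _).
by apply: eq_bigr => j' _; rewrite rmorphM.
Qed.
End MinimalDimension.

(** * Idempotents among the polynomials in one element *)

Section PolynomialIdempotent.
Variables (k : fieldType) (A : falgType k).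

Lemma horner_alg_mem (U : {vspace A}) j p : 1 \in U -> (forall x y, x \in U -> y \in U -> x * y \in U) ->
  j \in U -> horner_alg j p \in U.
Proof.
move=> U1 UM Uj; elim/poly_ind: p => [|p c IHp]; first by rewrite rmorph0 mem0v.
by rewrite rmorphD rmorphM /= horner_algX horner_algC memvD ?UM // memvZ.
Qed.

Lemma morph_horner_alg (eps : 'Hom(A, k^o)) j p : eps 1 = 1 -> {morph eps : x y / x * y} ->
  eps (horner_alg j p) = p.[eps j].
Proof.
move=> eps1 epsM; elim/poly_ind: p => [|p c IHp]; first by rewrite rmorph0 linear0 horner0.
by rewrite rmorphD rmorphM /= horner_algX horner_algC linearD linearZ /= eps1 epsM IHp !hornerE [_ *: _]mulr1.
Qed.

Lemma exists_annihilator (j : A) : exists2 p : {poly k}, p != 0 & horner_alg j p = 0.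
Proof.
pose d := (\dim {:A}).+1.
pose phi (v : 'rV[k]_d) : A := horner_alg j (rVpoly v).
have phiL : linear phi by move=> c u v; rewrite /phi linearP rmorphD /= -mul_polyC rmorphM /= horner_algC -scalerAl mul1r.
pose Phi : 'Hom('rV[k]_d, A) := linfun (HB.pack_for {linear 'rV[k]_d -> A} phi
  (GRing.isLinear.Build k 'rV[k]_d A *:%R _ phiL)).
have PhiE v : Phi v = phi v by rewrite lfunE.
have nzK : lker Phi != 0%VS.
  apply/eqP=> K0; have := limg_ker_dim Phi fullv; rewrite K0 capv0 dimv0 add0n.
  have -> : \dim {: 'rV[k]_d} = d by rewrite dimvf /= /dim /= mul1n.
  by move=> E; have := dimvS (subvf (limg Phi)); rewrite E ltnn.
exists (rVpoly (vpick (lker Phi))); last first.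
  by have := memv_pick (lker Phi); rewrite memv_ker PhiE => /eqP.
apply: contraNneq nzK => p0; rewrite -vpick0; apply/eqP.
by apply: (can_inj rVpolyK); rewrite p0 linear0.
Qed.

(** The projection onto the part where [j] is invertible. Write an annihilating polynomial as
    [u * 'X^m] with [u] not vanishing at 0 and split 1 by Bezout. Since [eps j = 1], 1 is a root of
    [u], so [eps] sees only the first summand. *)
Lemma polynomial_idempotent (eps : 'Hom(A, k^o)) j : eps 1 = 1 -> {morph eps : x y / x * y} ->
  eps j = 1 -> exists q, let f := j * horner_alg j q in f * f = f /\ eps f = 1.
Proof.
move=> eps1 epsM epsj; have [p nzp pj] := exists_annihilator j.
have p1 : p.[1] = 0 by rewrite -epsj -morph_horner_alg // pj linear0.
have [m [u]] := multiplicity_XsubC p 0; rewrite nzp subr0 /= => u0 Dp.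
(* The exponent [m.+1] leaves a factor ['X] even when [m] is 0, so that the idempotent is a multiple
   of [j]. *)
have /Bezout_eq1_coprimepP[[a b] /= ab] : coprimep ('X^(m.+1)) u.
  by rewrite coprimep_sym coprimep_expr // -['X]subr0 coprimep_XsubC.
have u1 : u.[1] = 0 by move: p1; rewrite Dp !hornerE expr1n mulr1.
exists (a * 'X^m) => /=; set f := j * _.
have fE : f = horner_alg j (a * 'X^(m.+1)) by rewrite /f -{1}[j]horner_algX -rmorphM mulrCA -exprS.
split; last first.
  rewrite fE morph_horner_alg // epsj; have := congr1 (fun r => r.[1]) ab.
  by rewrite /= !hornerE u1 mulr0 addr0.
have E : a * 'X^(m.+1) * (a * 'X^(m.+1)) = a * 'X^(m.+1) - a * b * 'X * p.
  rewrite -[X in _ = X - _]mulr1 -ab mulrDr Dp.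
  have -> : a * 'X^(m.+1) * (b * u) = a * b * 'X * (u * 'X^m).
    by rewrite exprS; ring.
  by rewrite addrK.
by rewrite fE -rmorphM E rmorphB [X in _ - X]rmorphM /= pj mulr0 subr0.
Qed.
End PolynomialIdempotent.

(** * The dimension of a coideal subalgebra divides that of [H] *)

Section CoidealSubalgebra.
Variables (k : closedFieldType) (H : hopfAlgType k).
Hypothesis char0 : [pchar k] =i pred0.
Hypothesis ssH : semisimple_algebra H.
Implicit Types (V : vectType k) (x y h : H).
Local Notation S := (@antipode k H).
Local Notation lam := (coint H).
Variable Lam : H.
Hypothesis intL : integral Lam.
Variable K : {vspace H}.
Hypotheses (K1 : 1 \in K) (KM : forall x y, x \in K -> y \in K -> x * y \in K) (cK : coideal K).

(** By [sw_coint_antipode] the coproduct of [x] is traded for that of [y], whose second legs stay in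
    [K]. *)
Lemma coint_coideal_ltrans (f : 'Hom(H, k^o)) x : (forall y, y \in K -> lam (x * y) = 0) ->
  forall y, y \in K -> lam (ltrans f x * y) = 0.
Proof.
move=> x0 y Ky; rewrite ltransE (lin_tlift (X := k^o) (h := fun z => lam (z * y))); last by lin_tac.
under eq_tlift => a b do rewrite -scalerAl linearZ /=.
transitivity (f (\sw_(a, b <- x) ((lam (b * S (S y)) : k) *: a))).
  rewrite lfun_tlift; apply: (@eq_tlift k H H k^o) => a b.
  by rewrite (antipodeK char0 ssH) linearZ; apply: mulrC.
rewrite (sw_coint_antipode char0 ssH intL) sw_antipode; last by bil_tac.
rewrite (sw_coideal_eq (G := fun _ _ => 0) cK Ky) ?tlift_0 ?linear0 //; first by bil_tac.
  by split=> ? ? ? ?; rewrite scaler0 addr0.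
by move=> a b Kb; rewrite (antipodeK char0 ssH) x0 // scale0r.
Qed.

(** A non-zero [x] in the radical would yield, after a translation, some [j] in the radical with
    counit 1, then an idempotent [e] in [j K] with counit 1. Orthogonality gives [lam e = 0], but
    [lam e] is the rank of multiplication by [e]. *)
Lemma coint_coideal_nondeg x : x \in K -> (forall y, y \in K -> lam (x * y) = 0) -> x = 0.
Proof.
move=> Kx x0; apply: functional_sep => f; apply/eqP; apply: contraT => nzfx.
pose j := (f x : k)^-1 *: ltrans f x.
have Kj : j \in K by rewrite memvZ // cK.
have ej : counit j = 1 by rewrite linearZ /= counit_ltrans; apply: mulVf.
have [q [/= ff ef]] := polynomial_idempotent (eps := counit : 'Hom(H, k^o)) counit1 counitM ej.
set e := j * _ in ff ef.
have : lam e = 0.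
  rewrite /e /j -scalerAl linearZ /= coint_coideal_ltrans ?scaler0 //.
  exact: horner_alg_mem.
rewrite (coint_lftr char0 ssH intL) lftr_idem; last first.
  by apply/lfunP=> y; rewrite comp_lfunE !amullE mulrA ff.
move/eqP; rewrite natr_eq0_char0 // dimv_eq0 => /eqP L0.
have : e \in limg (amull e) by rewrite -[X in X \in _]mulr1 -amullE memv_img ?memvf.
rewrite L0 memv0 => /eqP e0; move: ef; rewrite e0 linear0 => /esym/eqP.
by rewrite oner_eq0.
Qed.
(* The bijection [h ⊗ y |-> y_1 h ⊗ y_2] of [H ⊗ H] preserves [H ⊗ K] and turns [1 ⊗ x] into
   the diagonal action of [x]. *)
Lemma lftr_coideal x : x \in K ->
  (\dim {:H})%:R * lftr (amull x \o projv K)%VF = (\dim K)%:R * lam x.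
Proof.
move=> Kx; set P := projv K.
have PK y : P y \in K by apply: memv_proj.
have Pid y : y \in K -> P y = y by apply: projv_id.
pose phi : 'End(tens H H) := tlift (fun h y => \sw_(a, b <- y) ((a * h) ⊗ b)).
pose psi : 'End(tens H H) := tlift (fun h y => \sw_(a, b <- y) ((S a * h) ⊗ b)).
have phiE h y : phi (h ⊗ y) = \sw_(a, b <- y) ((a * h) ⊗ b) by rewrite /phi tliftE //; bil_tac.
have psiE h y : psi (h ⊗ y) = \sw_(a, b <- y) ((S a * h) ⊗ b) by rewrite /psi tliftE //; bil_tac.
have psiphi : (psi \o phi = \1)%VF.
  apply/lfunP; apply: tens_ind => [h y|c s t Hs Ht]; last by rewrite !lfun_lin Hs Ht.
  rewrite comp_lfunE id_lfunE phiE lfun_tlift; under eq_tlift => a b do rewrite psiE.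
  rewrite -(sw_coassoc (F := fun a c d => (S c * (a * h)) ⊗ d)); last by tri_tac.
  under eq_tlift => a b.
    under eq_tlift => c d do rewrite mulrA.
    rewrite (sw_antipode_opl char0 ssH intL (F := fun u => (u * h) ⊗ b)); last by lin_tac.
    rewrite mul1r; over.
  by rewrite /= (sw_counitl (F := fun b => h ⊗ b)) //; lin_tac.
have phipsi h y : phi (psi (h ⊗ y)) = h ⊗ y.
  rewrite psiE lfun_tlift; under eq_tlift => a b do rewrite phiE.
  rewrite -(sw_coassoc (F := fun a c d => (c * (S a * h)) ⊗ d)); last by tri_tac.
  under eq_tlift => a b.
    under eq_tlift => c d do rewrite mulrA.
    rewrite (sw_antipode_opr char0 ssH intL (F := fun u => (u * h) ⊗ b)); last by lin_tac.
    rewrite mul1r; over.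
  by rewrite /= (sw_counitl (F := fun b => h ⊗ b)) //; lin_tac.
pose Q := tmap (\1%VF : 'End(H)) P.
have QE h y : Q (h ⊗ y) = h ⊗ P y by rewrite tmapE id_lfunE.
have Qfix (F : H -> H) y : islin F -> y \in K ->
    Q (\sw_(a, b <- y) (F a ⊗ b)) = \sw_(a, b <- y) (F a ⊗ b).
  move=> FL Ky; rewrite lfun_tlift.
  apply: (sw_coideal_eq cK Ky); [by bil_tac|by bil_tac|].
  by move=> a b Kb; rewrite QE Pid.
(* [Q] and its conjugate [R] are projections onto the same subspace, as [QR] and [RQ] show. Since
   [L] preserves that subspace, its traces against both agree. *)
pose R := (phi \o Q \o psi)%VF.
have QR : (Q \o R = R)%VF.
  apply/lfunP=> t; rewrite /R !comp_lfunE; move: (psi t).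
  apply: tens_ind => [h y|c s t' Hs Ht]; last by rewrite !lfun_lin Hs Ht.
  by rewrite QE phiE (Qfix (fun a => a * h)) //; lin_tac.
have RQ : (R \o Q = Q)%VF.
  apply/lfunP; apply: tens_ind => [h y|c s t' Hs Ht]; last by rewrite !lfun_lin Hs Ht.
  rewrite /R !comp_lfunE QE psiE (Qfix (fun a => S a * h)) //; last by lin_tac.
  by rewrite -psiE phipsi.
pose L : 'End(tens H H) := \sw_(a, b <- x) tmap (amull a) (amull b).
have LE u v : L (u ⊗ v) = \sw_(a, b <- x) ((a * u) ⊗ (b * v)).
  rewrite /L (lin_tlift (h := fun M : 'End(tens H H) => M (u ⊗ v))); last by lin_tac.
  by apply: eq_tlift => a b; rewrite tmapE !amullE.
have QLQ : (Q \o (L \o Q) = L \o Q)%VF.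
  apply/lfunP; apply: tens_ind => [h y|c s t' Hs Ht]; last by rewrite !lfun_lin Hs Ht.
  rewrite !comp_lfunE QE LE lfun_tlift.
  apply: (sw_coideal_eq cK Kx); [by bil_tac|by bil_tac|].
  by move=> a b Kb; rewrite QE Pid // KM.
have phiL : (phi \o tmap \1 (amull x) = L \o phi)%VF.
  apply/lfunP; apply: tens_ind => [h y|c s t' Hs Ht]; last by rewrite !lfun_lin Hs Ht.
  rewrite !comp_lfunE tmapE id_lfunE amullE !phiE sw_mul; last by bil_tac.
  rewrite tlift_swap lfun_tlift; apply: eq_tlift => a b.
  by rewrite LE; apply: eq_tlift => c d; rewrite mulrA.
have -> : (\dim {:H})%:R * lftr (amull x \o P)%VF = lftr (L \o R)%VF.
  have -> : (L \o R = phi \o (tmap \1 (amull x \o P) \o psi))%VF.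
    apply/lfunP=> t; rewrite /R comp_lfunA comp_lfunA -phiL -!comp_lfunA.
    rewrite !comp_lfunE; congr (phi _); rewrite /Q tmap_comp; congr (tmap _ _ _).
    by rewrite comp_lfun1l.
  by rewrite [RHS]lftrC -comp_lfunA psiphi comp_lfun1r lftr_tmap lftr_id.
have -> : lftr (L \o R)%VF = lftr (L \o Q)%VF.
  have -> : (L \o R = Q \o (L \o Q \o R))%VF.
    by rewrite -[in LHS]QR comp_lfunA -{1}QLQ -comp_lfunA.
  rewrite lftrC -(comp_lfunA (L \o Q)%VF R Q) RQ -comp_lfunA; congr (lftr (L \o _)%VF).
  rewrite /Q; apply/lfunP; apply: tens_ind => [h y|c s t' Hs Ht]; last by rewrite !lfun_lin Hs Ht.
  by rewrite comp_lfunE !QE Pid.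
have -> : (L \o Q = \sw_(a, b <- x) (tmap (amull a) (amull b \o P)))%VF.
  apply/lfunP; apply: tens_ind => [h y|c s t' Hs Ht]; last by rewrite !lfun_lin Hs Ht.
  rewrite comp_lfunE QE LE (lin_tlift (h := fun M : 'End(tens H H) => M (h ⊗ y))); last by lin_tac.
  by apply: eq_tlift => a b; rewrite tmapE !comp_lfunE !amullE.
rewrite (lin_tlift (X := k^o) (h := fun M : 'End(tens H H) => lftr M : k^o)); last first.
  by move=> c A B; rewrite /= lftrP.
have chiL : islin (fun y => lftr (amull y \o P)%VF : k^o).
  by move=> c y z; rewrite /= -lftrP; congr lftr; apply/lfunP=> u; rewrite lfunPl !comp_lfunE !amullE mulPl.
under eq_tlift => a b do rewrite lftr_tmap -(coint_lftr char0 ssH intL).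
transitivity (lftr (amull (\sw_(a, b <- x) ((lam a : k) *: b)) \o P)%VF).
  rewrite (lin_tlift (X := k^o) (h := fun y => lftr (amull y \o P)%VF)) //.
  by apply: (@eq_tlift k H H k^o) => a b; rewrite (linear_Z _ _ chiL).
rewrite (sw_cointl ssH intL) (linear_Z _ _ chiL) mulrC; congr (_ * _).
rewrite (_ : (amull 1 \o P)%VF = P); last by apply/lfunP=> y; rewrite comp_lfunE amullE mul1r.
rewrite lftr_idem ?limg_proj //; last by apply/lfunP=> y; rewrite comp_lfunE Pid.
Qed.

(** [Kp] being smaller than [K], some non-zero [x] in [K] is orthogonal to [Kp]; nondegeneracy makes
    it a two-sided integral of [K] with non-zero counit. Then [lftr_coideal] at [x], divided by the
    counit, exhibits [\dim {:H}] as [\dim K] times the rank of the idempotent [e]. *)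
Lemma dvdn_coideal_subalgebra : (\dim K %| \dim {:H})%N.
Proof.
have nondeg := coint_coideal_nondeg.
pose Kp := (K :&: lker counit)%VS; pose b := vbasis Kp.
have KpE x : x \in Kp = (x \in K) && (counit x == 0) by rewrite memv_cap memv_ker.
have bE i : (i < \dim Kp)%N -> b`_i \in Kp by move=> lti; rewrite vbasis_mem ?mem_nth ?size_tuple.
pose A_fun x := \sum_(i < \dim Kp) (lam (x * b`_i) : k) *: b`_i.
have AL : linear A_fun by rewrite /A_fun; lin_tac.
pose A : 'End(H) := linfun (HB.pack_for {linear H -> H} A_fun (GRing.isLinear.Build k H H *:%R _ AL)).
have AE x : A x = A_fun x by rewrite lfunE.
have ltKp : (\dim Kp < \dim K)%N.
  rewrite ltn_neqAle dimvS ?capvSl // andbT; apply/eqP=> E.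
  have /eqP EK : Kp == K by rewrite eqEdim capvSl E leqnn.
  by have := K1; rewrite -EK KpE counit1 oner_eq0 andbF.
have nzW : (K :&: lker A)%VS != 0%VS.
  apply/eqP=> W0; have := limg_ker_dim A K; rewrite W0 dimv0 add0n => E.
  have : (A @: K <= Kp)%VS.
    apply/subvP=> _ /memv_imgP[x _ ->]; rewrite AE memv_suml // => i _.
    by rewrite memvZ // bE.
  by move/dimvS; rewrite E leqNgt ltKp.
pose x := vpick (K :&: lker A)%VS.
have nzx : x != 0 by rewrite vpick0.
have /memv_capP[Kx] : x \in (K :&: lker A)%VS := memv_pick _.
rewrite memv_ker AE => /eqP Ax.
have xKp y : y \in Kp -> lam (x * y) = 0.
  move=> Ky; rewrite (coord_vbasis Ky) mulr_sumr linear_sum big1 // => i _.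
  rewrite -scalerAr linearZ /=.
  have /freeP/(_ _ Ax i) -> := basis_free (vbasisP Kp); exact: mulr0.
have xK y : y \in K -> x * y = counit y *: x.
  move=> Ky; apply/eqP; rewrite -subr_eq0; apply/eqP/nondeg.
    by rewrite memvB ?KM // memvZ.
  move=> z Kz; rewrite mulrBl -mulrA -scalerAl scalerAr -mulrBr xKp // KpE.
  by rewrite memvB ?KM ?memvZ //= linearB linearZ /= counitM subrr.
have nzlx : lam x != 0.
  apply: contra nzx => /eqP lx0; apply/eqP/nondeg => // y Ky.
  by rewrite xK // linearZ /= lx0 scaler0.
have Kx' y : y \in K -> y * x = counit y *: x.
  move=> Ky; apply/eqP; rewrite -subr_eq0; apply/eqP/nondeg.
    by rewrite memvB ?KM // memvZ.
  move=> z Kz; rewrite mulrBl linearB /= -mulrA (cointC char0 ssH intL) -mulrA xK ?KM //.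
  by rewrite -scalerAl xK // !linearZ /= counitM /GRing.scale /= mulrCA mulrA mulrN subrr.
have trx : lftr (amull x \o projv K)%VF = counit x.
  rewrite (lftr_rank1 (f := (counit \o projv K)%VF) (v := x)) ?comp_lfunE ?projv_id // => y.
  by rewrite !comp_lfunE amullE xK ?memv_proj.
have := lftr_coideal Kx; rewrite trx => E.
have nzdK : (\dim K)%:R != 0 :> k.
  by rewrite natr_eq0_char0 // -lt0n; apply: leq_ltn_trans ltKp.
have nzex : counit x != 0.
  by apply: contraTneq (mulf_neq0 nzdK nzlx) => ex0; rewrite -E ex0 mulr0 eqxx.
pose e := (counit x : k)^-1 *: x.
have ee : e * e = e.
  by rewrite /e -scalerAl -scalerAr xK // [_ *: (counit x *: x)]scalerA mulVf // scale1r.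
have dimE : (\dim {:H})%:R = ((\dim K * \dim (limg (amull e)))%N%:R : k).
  rewrite natrM -lftr_idem -?(coint_lftr char0 ssH intL); last first.
    by apply/lfunP=> y; rewrite comp_lfunE !amullE mulrA ee.
  by apply: (mulIf nzex); rewrite E linearZ /= -mulrA [_ * counit x]mulrC mulVKf.
have /(intr_inj_char0 char0) [->] : (((\dim {:H})%:Z)%:~R : k) = ((\dim K * \dim (limg (amull e)))%N%:Z)%:~R.
  exact: dimE.
exact: dvdn_mulr.
Qed.
End CoidealSubalgebra.

(** * One-dimensional submodules over the double *)

Section CentralGrouplike.
Variables (k : closedFieldType) (H : hopfAlgType k).
Implicit Types (x y h : H) (X : {vspace H}).
Local Notation S := (@antipode k H).

Lemma mul_adjoint h x : \sw_(a, b <- h) (adjoint a x * b) = h * x.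
Proof.
under eq_tlift => a b.
  rewrite adjointE (lin_tlift (h := fun u => u * b)); last by lin_tac.
  over.
rewrite /= (sw_coassoc (F := fun a c b => a * x * S c * b)); last by tri_tac.
under eq_tlift => a b.
  under eq_tlift => c d do rewrite -mulrA.
  rewrite (sw_antipodel (F := fun u => a * x * u)); last by lin_tac.
  rewrite mulr1; over.
by rewrite /= (sw_counitr (F := fun a => a * x)) //; lin_tac.
Qed.

Lemma counit_adjoint h x : counit (adjoint h x) = counit h * counit x.
Proof.
rewrite adjointE lfun_tlift -[in RHS](counitr h) lfun_tlift.
rewrite [RHS](lin_tlift (X := k^o) (h := fun u : k^o => (u : k) * counit x)); last by lin_tac.
apply: (@eq_tlift k H H k^o) => a b; rewrite !counitM counit_antipode linearZ /=.
by rewrite /GRing.scale /= mulrC mulrA.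
Qed.

(** Both actions are scalar on a line, and the counit computes the scalars once the generator has
    counit 1. Scalar translations mean that the generator is grouplike; an adjoint action through
    the counit means that it is central, by [mul_adjoint]. *)
Lemma stable_line_grouplike X : stable (@double_op k H) X -> \dim X = 1%N ->
  exists g, [/\ grouplike g, forall h, h * g = g * h & X = <[g]>%VS].
Proof.
move=> /double_stable[aX cX] dX; pose x := vpick X.
have nzX : X != 0%VS by rewrite -dimv_eq0 dX.
have nzx : x != 0 by rewrite vpick0.
have EX : X = <[x]>%VS.
  by apply/eqP; rewrite eq_sym eqEdim -memvE memv_pick dX dim_vline nzx.
have Xx : x \in X by apply: memv_pick.
have lx f : counit x *: ltrans f x = (f x : k) *: x.
  have : ltrans f x \in X by apply: cX.
  rewrite {1}EX => /vlineP[c E]; have := counit_ltrans f x.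
  by rewrite E linearZ /= => <-; rewrite scalerA mulrC.
have nzex : counit x != 0.
  apply: (contra _ (nzx)) => /eqP ex0; apply/eqP/functional_sep => f.
  by have := lx f; rewrite ex0 scale0r => /esym/eqP; rewrite scaler_eq0 (negPf nzx) orbF => /eqP.
pose g := (counit x : k)^-1 *: x.
have eg : counit g = 1 by rewrite linearZ; apply: mulVf.
have Xg : g \in X by rewrite memvZ.
have EXg : X = <[g]>%VS.
  by apply/eqP; rewrite eq_sym eqEdim -memvE Xg dX dim_vline scaler_eq0 invr_eq0 (negPf nzex) (negPf nzx).
have lg f : ltrans f g = (f g : k) *: g.
  rewrite /g !linearZ /= !scalerA -[RHS]scalerA -[ltrans f x]scale1r -(mulVf nzex) -[(_ * _) *: ltrans f x]scalerA lx.
  by rewrite !scalerA; congr (_ *: _); rewrite [RHS]mulrA.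
clearbody g; exists g; split=> //.
  split=> //; apply: tens_sep => f f'; rewrite tpairE.
  have := congr1 f' (lg f); rewrite linearZ ltransE lfun_tlift => <-.
  by apply: (@eq_tlift k H H k^o) => a b; rewrite linearZ.
move=> h; rewrite -mul_adjoint.
have ag a : adjoint a g = counit a *: g.
  have : adjoint a g \in X by apply: aX.
  rewrite {1}EXg => /vlineP[c E]; have := counit_adjoint a g.
  by rewrite E linearZ /= eg [_ *: 1]mulr1 mulr1 => ->.
under eq_tlift => a b do rewrite ag -scalerAl.
by rewrite (sw_counitl (F := fun b => g * b)) //; lin_tac.
Qed.

Lemma stable_one : stable (@double_op k H) <[1]>%VS.
Proof.
apply/double_stable; split=> [h x|f x] /vlineP[c ->]; rewrite linearZ memvZ //=.
  rewrite adjointE; under eq_tlift => a b do rewrite mulr1.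
  by rewrite antipoder memvZ // memv_line.
rewrite ltransE sw_1; last by bil_tac.
by rewrite memvZ // memv_line.
Qed.

Lemma minimal_one : minimal (@double_op k H) <[1]>%VS.
Proof.
split=> [||W _ leW nzW]; first exact: stable_one.
  by rewrite -dimv_eq0 dim_vline oner_eq0.
by apply/eqP; rewrite eqEdim leW dim_vline oner_neq0 lt0n dimv_eq0.
Qed.
End CentralGrouplike.

(** * Existence of a central grouplike element *)

Section Arithmetic.
Variables (k : closedFieldType) (p q : nat).
Hypothesis char0 : [pchar k] =i pred0.
Hypotheses (p_prime : prime p) (q_prime : prime q) (lt_p4_q : (p ^ 4 < q)%N).
Hypotheses (p_ndvd_qB1 : ~~ (p %| q - 1)%N) (p_ndvd_qD1 : ~~ (p %| q + 1)%N).

Lemma small_divisor d : (d %| p ^ 2 * q ^ 2)%N -> ~~ (q %| d)%N -> (d %| p ^ 2)%N.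
Proof.
move=> dpq nqd; rewrite -(Gauss_dvdl _ (_ : coprime d (q ^ 2))) //.
by rewrite coprimeXr // coprime_sym prime_coprime.
Qed.

Lemma leq_divisor d : (d %| p ^ 2)%N -> (d < q)%N.
Proof.
move=> dp; have p0 := prime_gt0 p_prime; apply: leq_ltn_trans lt_p4_q.
by apply: leq_trans (dvdn_leq _ dp) _; rewrite ?expn_gt0 ?p0 // leq_exp2l // prime_gt1.
Qed.

Lemma dvdn_prime_of_dvdn_sqr d : (d %| p ^ 2)%N -> d != 1%N -> (p %| d)%N.
Proof.
by case/(dvdn_pfactor _ _ p_prime) => -[|m] _ ->; rewrite ?expn0 ?eqxx // expnS dvdn_mulr.
Qed.

Lemma exists_central_grouplike (H : hopfAlgType k) : semisimple_algebra H ->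
    (\dim {:H} %| p ^ 2 * q ^ 2)%N -> (1 < \dim {:H})%N ->
  exists g : H, [/\ grouplike g, forall h, h * g = g * h & g != 1].
Proof.
move=> ssH dvd_n n1; set n := \dim {:H} in dvd_n n1.
have [//|noC] := classic (exists g : H, [/\ grouplike g, forall h, h * g = g * h & g != 1]).
have p0 := prime_gt0 p_prime; have q0 := prime_gt0 q_prime.
have [Lam intL] := exists_integral ssH.
have compl := double_complemented char0 ssH intL.
have dvdM M : minimal (@double_op k H) M -> (\dim M %| p ^ 2 * q ^ 2)%N.
  by move=> minM; apply: dvdn_trans dvd_n; apply: dvdn_minimal intL M minM.
have gt0M M : minimal (@double_op k H) M -> (0 < \dim M)%N.
  by case=> _ nzM _; rewrite lt0n dimv_eq0.
have smallM M : minimal (@double_op k H) M -> (\dim M < q)%N -> (\dim M %| p ^ 2)%N.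
  by move=> minM ltM; apply: small_divisor (dvdM M minM) _; rewrite gtnNdvd ?gt0M.
have bigM M : minimal (@double_op k H) M -> (q <= \dim M)%N -> (q %| \dim M)%N.
  move=> minM leM; apply: contraLR leM => nqM; rewrite -ltnNge.
  exact/leq_divisor/small_divisor/nqM/dvdM.
have [K [sK K1 K2]] := small_socle (@double_op k H) q.
have [aK cK] := iffLR (double_stable K) sK.
have one_K : 1 \in K.
  by rewrite memvE; apply: K1; rewrite ?dim_vline ?oner_neq0 ?prime_gt1 //; apply: minimal_one.
have leMN M N : minimal (@double_op k H) M -> minimal (@double_op k H) N ->
    (M <= K)%VS -> (N <= K)%VS -> (M * N <= K)%VS.
  move=> minM minN leMK leNK; have [[sM _ _] [sN _ _]] := (minM, minN).
  apply: (stable_sub compl (double_stable_prod sM sN)) => L minL leL.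
  apply: K1 => //; apply: leq_ltn_trans lt_p4_q.
  apply: leq_trans (dimvS leL) _; apply: leq_trans (dim_prodv _ _) _.
  have leD X : minimal (@double_op k H) X -> (X <= K)%VS -> (\dim X <= p ^ 2)%N.
    by move=> minX leX; rewrite dvdn_leq ?expn_gt0 ?p0 // smallM // K2.
  by rewrite (_ : 4 = 2 + 2)%N // expnD leq_mul ?leD.
have KM x y : x \in K -> y \in K -> x * y \in K.
  move=> Kx Ky; have K_K M : minimal (@double_op k H) M -> (M <= K)%VS -> forall z u, z \in M -> u \in K -> z * u \in K.
    move=> minM leMK z u Mz Ku; rewrite -amullE memv_preim; move: u Ku; apply/subvP.
    apply: (stable_sub compl sK) => N minN leNK; apply/subvP=> v Nv.
    by rewrite -memv_preim amullE; apply: (subvP (leMN _ _ minM minN leMK leNK)); apply: memv_mul.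
  rewrite -amulrE memv_preim; move: x Kx; apply/subvP.
  apply: (stable_sub compl sK) => M minM leMK; apply/subvP=> v Mv.
  by rewrite -memv_preim amulrE; apply: K_K Mv Ky.
have dvdK : (\dim K %| n)%N by apply: dvdn_coideal_subalgebra intL _ one_K KM cK.
have [U [sU _ KU KU0]] := complement_in compl sK (stableT _) (subvf K).
have qU : (q %| \dim U)%N.
  apply: (dvdn_dim_stable compl sU) => M minM leMU; apply: bigM => //.
  rewrite leqNgt; apply/negP=> ltM; have [_ nzM _] := minM; case/eqP: nzM; apply/eqP.
  by rewrite -subv0 -KU0 subv_cap leMU K1.
have nE : n = (\dim K + \dim U)%N by rewrite /n -KU dimv_disjoint_sum.
have le1K : (<[1]> <= K)%VS by rewrite -memvE.
(* In a complement of the trivial line, a one-dimensional submodule would be spanned by a central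
   grouplike other than 1, against [noC]. All its minimal submodules thus have dimension divisible
   by [p]. *)
have [V [sV leVK OV OV0]] := complement_in compl (@stable_one k H) sK le1K.
have pV : (p %| \dim V)%N.
  apply: (dvdn_dim_stable compl sV) => M minM leMV; apply: dvdn_prime_of_dvdn_sqr.
    by apply: smallM; rewrite ?K2 // (subv_trans leMV).
  apply/eqP=> dM; have [sM nzM _] := minM.
  have [g [gg cg Mg]] := stable_line_grouplike sM dM.
  have g1 : g = 1 by apply/eqP; apply: contra_notT noC => ng; exists g.
  case/eqP: nzM; apply/eqP; rewrite -subv0 -OV0 subv_cap leMV.
  by rewrite Mg g1 subvv.
have dK : \dim K = (1 + \dim V)%N by rewrite -OV dimv_disjoint_sum // dim_vline oner_neq0.
have npK : ~~ (p %| \dim K)%N by rewrite dK dvdn_addl // dvdn1 neq_ltn prime_gt1 ?orbT.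
have dvdKq : (\dim K %| q ^ 2)%N.
  rewrite -(Gauss_dvdr _ (_ : coprime (\dim K) (p ^ 2))) ?(dvdn_trans dvdK) //.
  by rewrite coprimeXr // coprime_sym prime_coprime.
(* If [q] does not divide [n], then [n] divides [p ^ 2] and is less than [q], so [U = 0] and [K] is
   all of [H]; but [p] divides [n] and not [\dim K]. *)
have [qn|nqn] := boolP (q %| n)%N; last first.
  have dvd_np := small_divisor dvd_n nqn.
  have U0 : \dim U = 0%N.
    apply/eqP; apply: contraTT qU; rewrite -lt0n => U0; rewrite gtnNdvd //.
    by apply: leq_ltn_trans (leq_divisor dvd_np); rewrite nE leq_addl.
  case/negP: npK; rewrite -[\dim K]addn0 -U0 -nE.
  by apply: dvdn_prime_of_dvdn_sqr => //; rewrite neq_ltn n1 orbT.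
have qK : (q %| \dim K)%N by rewrite -(dvdn_addl _ qU) -nE.
have pK1 : (p %| \dim K - 1)%N by rewrite dK addKn.
case/(dvdn_pfactor _ _ q_prime): dvdKq pK1 qK => -[|[|[|m]]] // _ ->.
- by move=> _; rewrite expn0 dvdn1 => /eqP q1; move: q_prime; rewrite q1.
- by rewrite expn1 (negPf p_ndvd_qB1).
have -> : (q ^ 2 - 1 = (q - 1) * (q + 1))%N by rewrite -[1%N in LHS](exp1n 2) subn_sqr.
by rewrite Euclid_dvdM // (negPf p_ndvd_qB1) (negPf p_ndvd_qD1).
Qed.
End Arithmetic.

(** * Images under Hopf algebra maps and quotients of semisimple algebras *)

Lemma tensv_pure (k : fieldType) (U V : vectType k) (A : {vspace U}) (B : {vspace V}) a b :
  a \in A -> b \in B -> a ⊗ b \in tensv A B.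
Proof.
move=> Aa Bb; rewrite (coord_vbasis Aa) (coord_vbasis Bb).
have L1 : linear (fun x : U => x ⊗ (\sum_(i < \dim B) coord (vbasis B) i b *: (vbasis B)`_i)) by lin_tac.
rewrite (lin_sum L1) memv_suml // => i _; rewrite memvZ //.
have L2 : linear (fun y : V => (vbasis A)`_i ⊗ y) by lin_tac.
rewrite (lin_sum L2) memv_suml // => j _; rewrite memvZ // memv_span //.
by apply/allpairsP; exists ((vbasis A)`_i, (vbasis B)`_j); rewrite !mem_nth ?size_tuple.
Qed.

Lemma tensv_tmap (k : fieldType) (U V U' V' : vectType k) (f : 'Hom(U, U')) (g : 'Hom(V, V')) t :
  tmap f g t \in tensv (limg f) (limg g).
Proof.
move: t; apply: tens_ind => [u v|a s t Hs Ht]; last by rewrite lfun_lin memvD // memvZ.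
by rewrite tmapE tensv_pure ?memv_img ?memvf.
Qed.

Section HopfMap.
Variable k : fieldType.
Implicit Types H K : hopfAlgType k.

Lemma limg_hopf_subalgebra K H (f : 'Hom(K, H)) : hopf_map f -> hopf_subalgebra (limg f).
Proof.
case=> f1 fM fC _ fS; apply/and4P; split.
- by rewrite -f1 memv_img ?memvf.
- apply/prodvP=> _ _ /memv_imgP[x _ ->] /memv_imgP[y _ ->].
  by rewrite -fM memv_img ?memvf.
- apply/subvP=> _ /memv_imgP[_ /memv_imgP[x _ ->] ->].
  by rewrite fC tensv_tmap.
apply/subvP=> _ /memv_imgP[_ /memv_imgP[x _ ->] ->].
by rewrite -fS memv_img ?memvf.
Qed.

Lemma hopf_map_inverse K H (f : 'Hom(K, H)) (g : 'Hom(H, K)) :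
  hopf_map f -> cancel f g -> cancel g f -> hopf_map g.
Proof.
case=> f1 fM fC fe fS fK gK; have gf : (g \o f = \1)%VF by apply/lfunP=> x; rewrite comp_lfunE fK id_lfunE.
split.
- by rewrite -f1 fK.
- by move=> x y; rewrite -{1}[x]gK -{1}[y]gK -fM fK.
- by move=> x; rewrite -{2}[x]gK fC tmap_comp gf tmap_id.
- by move=> x; rewrite -fe gK.
by move=> x; rewrite -{1}[x]gK -fS fK.
Qed.

Lemma hopf_map_corestrict K H (f : 'Hom(K, H)) (A : {vspace H}) (hA : hopf_subalgebra A) :
  hopf_map f -> (limg f <= A)%VS -> hopf_map (sub_proj hA \o f)%VF.
Proof.
case=> f1 fM fC fe fS fA.
have iE x : sub_incl hA ((sub_proj hA \o f)%VF x) = f x.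
  rewrite comp_lfunE sub_inclE [sub_proj hA _]lfunE /= vsprojK //.
  by apply: (subvP fA); rewrite memv_img ?memvf.
have ipf : (sub_incl hA \o (sub_proj hA \o f) = f)%VF by apply/lfunP=> x; rewrite comp_lfunE iE.
have iI := @sub_incl_inj _ _ _ hA.
split.
- by apply: iI; rewrite iE sub_incl1.
- by move=> x y; apply: iI; rewrite iE sub_inclM !iE.
- move=> x; apply: (@sub_tincl_inj _ _ _ hA).
  by rewrite [LHS]sub_comulE iE fC tmap_comp ipf.
- by move=> x; rewrite -[LHS]/(sub_counit hA _) comp_lfunE iE.
by move=> x; apply: iI; rewrite iE [RHS]sub_antipodeE iE.
Qed.

Lemma sub_hopf_limg K H (f : 'Hom(K, H)) (A : {vspace H}) (hA : hopf_subalgebra A) :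
  hopf_map f -> injective f -> limg f = A -> hopf_isomorphic (sub_hopf hA) K.
Proof.
move=> hf fI fA; pose F := (sub_proj hA \o f)%VF.
have hF : hopf_map F by apply: hopf_map_corestrict => //; rewrite fA subvv.
have iE x : sub_incl hA (F x) = f x.
  rewrite comp_lfunE sub_inclE [sub_proj hA _]lfunE /= vsprojK //.
  by rewrite -fA memv_img ?memvf.
have FI : lker F == 0%VS by apply/lker0P => x y E; apply: fI; rewrite -!iE E.
have FT x : x \in limg F.
  have := subvsP x; rewrite -{2}fA => /memv_imgP[y _ E].
  suff -> : x = F y by rewrite memv_img ?memvf.
  by apply: (@sub_incl_inj _ _ _ hA); rewrite iE -E sub_inclE.
have FK : cancel F (F^-1)%VF := lker0_lfunK FI.
have KF : cancel (F^-1)%VF F by move=> x; rewrite limg_lfunVK.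
exists (F^-1)%VF; split; first exact: hopf_map_inverse FK KF.
by exists F.
Qed.
End HopfMap.

Section Semisimple.
Variable k : fieldType.

(** The image of a complement of the preimage of [U] is a complement of [U]. *)
Lemma semisimple_limg (A B : falgType k) (f : 'Hom(A, B)) : {morph f : x y / x * y} ->
  limg f = fullv -> semisimple_algebra A -> semisimple_algebra B.
Proof.
move=> fM fT ssA U /prodvP lU.
have fS y : exists x, y = f x.
  by have := memvf y; rewrite -fT => /memv_imgP[x _ ->]; exists x.
have [|W [/prodvP lW UW UW0]] := ssA (f @^-1: U)%VS.
  by apply/prodvP=> a x _; rewrite -!memv_preim fM => Ux; apply: lU; rewrite ?memvf.
exists (f @: W)%VS; split.
- apply/prodvP=> b _ _ /memv_imgP[x Wx ->]; have [a ->] := fS b.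
  by rewrite -fM memv_img // lW ?memvf.
- apply/eqP; rewrite eqEsubv subvf -fT -UW limgD subv_add addvSr andbT.
  by apply: subv_trans (addvSl _ _); apply/subvP=> _ /memv_imgP[x + ->]; rewrite -memv_preim.
apply/eqP; rewrite -subv0; apply/subvP=> y /memv_capP[Uy /memv_imgP[x Wx Ey]].
have : x \in (f @^-1: U :&: W)%VS by rewrite memv_cap -memv_preim -Ey Uy.
by rewrite UW0 memv0 Ey => /eqP->; rewrite linear0 mem0v.
Qed.
End Semisimple.

(** * The quotient by a central grouplike element *)

Section CentralQuotient.
Variables (k : closedFieldType) (H : hopfAlgType k).
Hypothesis char0 : [pchar k] =i pred0.
Hypothesis ssH : semisimple_algebra H.
Implicit Types (x y h : H).
Local Notation S := (@antipode k H).
Local Notation lam := (coint H).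
Local Notation D := (dual_hopf H).
Variables (g : H) (m' : nat).
Local Notation m := m'.+1.
Hypotheses (gg : grouplike g) (cg : forall h, h * g = g * h) (gm : g ^+ m = 1).
Hypothesis g_order : forall i, (0 < i < m)%N -> g ^+ i != 1.

Let nzm : (m%:R : k) != 0. Proof. by rewrite natr_eq0_char0. Qed.

(** The normalised integral of the group algebra of the group generated by [g]; multiplication by it
    projects onto the elements fixed by [g]. *)
Definition cyclic_idem : H := (m%:R : k)^-1 *: \sum_(i < m) g ^+ i.
Local Notation u := cyclic_idem.

Lemma expr_mod_order i : g ^+ i = g ^+ (i %% m).
Proof. by rewrite {1}(divn_eq i m) exprD mulnC exprM gm expr1n mul1r. Qed.

Lemma mul_cyclic_idem : g * u = u.
Proof.
rewrite /u -scalerAr; congr (_ *: _); rewrite mulr_sumr big_ord_recr big_ord_recl /=.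
rewrite -exprS gm addrC expr0; congr (_ + _); apply: eq_bigr => i _.
by rewrite -exprS.
Qed.

Lemma expr_cyclic_idem i : g ^+ i * u = u.
Proof. by elim: i => [|i IHi]; rewrite ?mul1r // exprSr -mulrA mul_cyclic_idem. Qed.

Lemma cyclic_idemC h : h * u = u * h.
Proof.
rewrite /u -scalerAl -scalerAr; congr (_ *: _); rewrite mulr_sumr mulr_suml.
apply: eq_bigr => i _; elim: (i : nat) => [|j IHj]; first by rewrite mulr1 mul1r.
by rewrite exprS mulrA cg -!mulrA IHj.
Qed.

Lemma cyclic_idemM : u * u = u.
Proof.
rewrite {1}/u -scalerAl mulr_suml (eq_bigr (fun => u)) => [|i _]; last exact: expr_cyclic_idem.
by rewrite sumr_const card_ord -scaler_nat scalerA mulVf // scale1r.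
Qed.

Lemma grouplike_expr i : grouplike (g ^+ i). Proof. exact: grouplikeX. Qed.

Fact invariant_proj_is_linear : linear (fun f : D => (f \o amulr u)%VF : D).
Proof. by move=> a f f'; apply/lfunP=> x; rewrite lfunPl !comp_lfunE lfunPl. Qed.
Definition invariant_proj : 'Hom(D, D) := linfun (HB.pack_for {linear D -> D}
  (fun f : D => (f \o amulr u)%VF : D)
  (GRing.isLinear.Build k D D *:%R _ invariant_proj_is_linear)).
Local Notation E := invariant_proj.

Lemma invariant_projE (f : D) x : (E f : D) x = f (x * u).
Proof. by rewrite [E f]lfunE /= comp_lfunE amulrE. Qed.

(* The functionals on [H] that factor through the quotient by [g - 1]. *)
Definition invariant_functionals : {vspace D} := limg E.
Local Notation A := invariant_functionals.

Lemma invariant_id (f : D) : (forall x, f (x * g) = f x) -> E f = f.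
Proof.
move=> fg; apply/lfunP=> x; rewrite invariant_projE -scalerAr mulr_sumr linearZ linear_sum /=.
rewrite (eq_bigr (fun => f x)) => [|i _].
  by rewrite sumr_const card_ord -scaler_nat scalerA mulVf // scale1r.
by elim: (i : nat) => [|j IHj]; rewrite ?mulr1 // exprSr mulrA fg.
Qed.

Lemma invariantP (f : D) : reflect (forall x, f (x * g) = f x) (f \in A).
Proof.
apply: (iffP idP) => [/memv_imgP[f' _ ->] x|fg]; last by rewrite -(invariant_id fg) memv_img ?memvf.
by rewrite !invariant_projE -mulrA mul_cyclic_idem.
Qed.

Lemma invariant_hopf_subalgebra : hopf_subalgebra A.
Proof.
have [cgg eg] := gg.
apply/and4P; split.
- by apply/invariantP=> x; rewrite !dual_oneE counitM eg mulr1.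
- apply/prodvP=> f f' /invariantP fg /invariantP fg'; apply/invariantP=> x.
  rewrite !dual_mulE sw_mul; last by bil_tac.
  apply: (@eq_tlift k H H k^o) => a b; rewrite (sw_grouplike gg) ?fg ?fg' //.
  by bil_tac.
- apply/subvP=> _ /memv_imgP[f Af ->].
  (* Centrality and idempotence of [u] make the coproduct of an invariant functional a fixed point
     of [tmap E E], hence a tensor over [A]. *)
  have <- : tmap E E (comul f) = comul f; last exact: tensv_tmap.
  apply: dext2 => x y; rewrite tpair_tmap.
  have devEu z : (dev z \o E)%VF = dev (z * u).
    by apply/lfunP=> f'; rewrite comp_lfunE !devE invariant_projE.
  rewrite !devEu !dcomulE.
  have -> : x * u * (y * u) = x * y * u by rewrite mulrA -[x * u * y]mulrA -cyclic_idemC !mulrA -mulrA cyclic_idemM.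
  by rewrite -invariant_projE invariant_id //; apply/invariantP.
apply/subvP=> _ /memv_imgP[f /invariantP fg ->]; apply/invariantP=> x.
rewrite !dual_antipodeE antipodeM.
have gS : S g * g = 1 := grouplike_mulVl gg.
by rewrite -fg -mulrA cg mulrA gS mul1r.
Qed.
Local Notation hA := invariant_hopf_subalgebra.
Local Notation i := (sub_incl hA).

(** Realising the quotient as the dual of a Hopf subalgebra of the dual supplies its Hopf structure
    through [sub_hopf] and [dual_hopf]. *)
Definition central_quotient : hopfAlgType k := dual_hopf (sub_hopf hA).
Local Notation B := central_quotient.

Fact central_proj_is_linear : linear (fun x => (dev x \o i)%VF : B).
Proof.
by move=> c x y; apply/lfunP=> a; rewrite lfunPl !comp_lfunE !devE linearP.
Qed.
Definition central_proj : 'Hom(H, B) := linfun (HB.pack_for {linear H -> B}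
  (fun x => (dev x \o i)%VF : B) (GRing.isLinear.Build k H B *:%R _ central_proj_is_linear)).
Local Notation pi := central_proj.

Lemma central_proj_dev x : pi x = (dev x \o i)%VF.
Proof. by rewrite [pi x]lfunE. Qed.

Lemma central_projE x (a : sub_hopf hA) : (pi x : dual_hopf (sub_hopf hA)) a = (i a : D) x.
Proof. by rewrite central_proj_dev comp_lfunE devE. Qed.

Lemma dev_central_proj (a : sub_hopf hA) : (dev a \o pi)%VF = i a.
Proof. by apply/lfunP=> x; rewrite comp_lfunE devE central_projE. Qed.

Lemma central_proj_hopf_map : hopf_map pi.
Proof.
split.
- apply/lfunP=> a; rewrite central_projE.
  by rewrite -[RHS]/(sub_counit hA a) comp_lfunE -dual_counitE.
- move=> x y; apply/lfunP=> a; rewrite central_projE -dcomulE.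
  have -> : dcomul H (i a) = tmap i i (sub_comul hA a) by rewrite sub_comulE.
  by rewrite tpair_tmap -!central_proj_dev [RHS]dmulE.
- move=> x; apply: dext2 => a b; rewrite dcomulE central_projE sub_inclM tpair_tmap.
  by rewrite !dev_central_proj [LHS]dmulE.
- by move=> x; rewrite -[LHS]/(dev 1 (pi x)) devE central_projE sub_incl1.
move=> x; apply/lfunP=> a; rewrite central_projE [RHS]dual_antipodeE central_projE.
by rewrite [i (antipode a)]sub_antipodeE dual_antipodeE.
Qed.

Lemma central_proj_limg : limg pi = fullv.
Proof.
apply/eqP; rewrite eqEsubv subvf; apply/subvP=> phi _.
pose p := sub_proj hA.
(* By biduality, [x] represents the extension [phi \o p \o E] of [phi] to the whole dual. *)
pose x := \sum_(j < \dim {:H}) (phi (p (E (vcoord j))) : k) *: (vbasis {:H})`_j.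
suff -> : phi = pi x by rewrite memv_img ?memvf.
apply/lfunP=> a; rewrite central_projE linear_sum.
have {1}-> : a = p (E (i a)).
  rewrite invariant_id; last by apply/invariantP; rewrite sub_inclE subvsP.
  by rewrite -comp_lfunE sub_inclK id_lfunE.
have {1}-> : i a = \sum_(j < \dim {:H}) ((i a : D) (vbasis {:H})`_j : k) *: (vcoord j : D).
  apply/lfunP=> y; rewrite {1}(coord_vbasis (memvf y)) linear_sum sum_lfunE; apply: eq_bigr => j _.
  by rewrite scale_lfunE linearZ vcoordE; apply: mulrC.
rewrite !linear_sum; apply: eq_bigr => j _.
by rewrite !linearZ; apply: mulrC.
Qed.

Lemma coint_grouplike (h : H) : grouplike h -> h != 1 -> lam h = 0.
Proof.
move=> gh; have [Lam intL] := exists_integral ssH.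
have := sw_cointr char0 ssH intL h; rewrite (sw_grouplike gh); last by bil_tac.
move/eqP; rewrite -subr_eq0 -scalerBr scaler_eq0 subr_eq0.
by case/orP=> /eqP // ->; rewrite eqxx.
Qed.
Lemma coint_expr j : lam (g ^+ j) = (if (m %| j)%N then (\dim {:H})%:R else 0).
Proof.
have [Lam intL] := exists_integral ssH.
rewrite expr_mod_order /dvdn; have [->|nj0] := eqVneq (j %% m)%N 0%N.
  by rewrite expr0 (coint1_dim char0 ssH intL).
by apply: coint_grouplike; [exact: grouplike_expr | rewrite g_order // lt0n nj0 ltn_pmod].
Qed.

Lemma coint_cyclic_idem : lam u = (m%:R : k)^-1 * (\dim {:H})%:R.
Proof.
rewrite linearZ linear_sum big_ord_recl big1 => [|j _]; last first.
  by rewrite /= coint_expr /bump leq0n add1n gtnNdvd ?ltnS.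
by rewrite /= addr0 coint_expr dvdn0.
Qed.

(** The kernel of [pi] is that of multiplication by [u], so [\dim {:B}] is the trace [lam u]. As
    [lam] kills the non-trivial powers of [g], only the term [lam 1] divided by [m] remains. *)
Lemma dim_central_quotient : (\dim {:H} = \dim {:B} * m)%N.
Proof.
have [Lam intL] := exists_integral ssH.
have uC : amulr u = amull u by apply/lfunP=> x; rewrite amulrE amullE cyclic_idemC.
have kerE : lker pi = lker (amulr u).
  apply/eqP; rewrite eqEsubv; apply/andP; split; apply/subvP=> x; rewrite !memv_ker.
    move/eqP=> px0; rewrite amulrE; apply/eqP/functional_sep => f.
    have Ef : E f \in A by rewrite memv_img ?memvf.
    have := congr1 (fun b : dual_hopf (sub_hopf hA) => b (Subvs Ef)) px0.
    by rewrite central_projE sub_inclE invariant_projE zero_lfunE.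
  rewrite amulrE => /eqP xu0; apply/eqP/lfunP=> a; rewrite central_projE zero_lfunE.
  have /invariantP/invariant_id <- : i a \in A by rewrite sub_inclE subvsP.
  by rewrite invariant_projE xu0 linear0.
have dimB : \dim {:B} = \dim (limg (amull u)).
  have := limg_ker_dim pi fullv; rewrite central_proj_limg kerE uC.
  by rewrite -[X in _ = X](limg_ker_dim (amull u) fullv) => /addnI.
have : ((\dim {:H})%:Z%:~R : k) = (\dim {:B} * m)%:Z%:~R.
  rewrite -[RHS]/((\dim {:B} * m)%:R) natrM dimB -lftr_idem -?(coint_lftr char0 ssH intL).
    by rewrite coint_cyclic_idem mulrC mulVKf.
  by apply/lfunP=> x; rewrite comp_lfunE !amullE mulrA cyclic_idemM.
by case/(intr_inj_char0 char0).
Qed.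

(** The cyclic group is ['I_m] under addition, which is why the order [m] is written as a
    successor. *)
Definition cyclic_embed : 'Hom(group_algebra k 'I_m, H) := gext (fun j : 'I_m => g ^+ j).
Local Notation psi := cyclic_embed.

Lemma cyclic_embedE (j : 'I_m) : psi (gelt k j) = g ^+ j. Proof. exact: gextE. Qed.

Lemma antipode_expr j : S (g ^+ j) = g ^+ (m - j %% m).
Proof.
have gj := grouplike_expr j.
have E0 : g ^+ j * g ^+ (m - j %% m) = 1.
  by rewrite expr_mod_order -exprD subnKC ?gm // ltnW // ltn_pmod.
by rewrite -[LHS]mulr1 -E0 mulrA grouplike_mulVl ?mul1r.
Qed.

Lemma cyclic_embed_hopf_map : hopf_map psi.
Proof.
have [cgg eg] := gg; split.
- by rewrite -[1 in LHS]/(gelt k (1%g : 'I_m)) cyclic_embedE expr0.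
- move=> x y; move: x; apply: group_algebra_ind => [j|c x x' Hx Hx']; last first.
    by rewrite mulPl !lfun_lin mulPl Hx Hx'.
  move: y; apply: group_algebra_ind => [l|c y y' Hy Hy']; last first.
    by rewrite mulPr !lfun_lin mulPr Hy Hy'.
  rewrite -[gelt k j * _]/(gmul _ _) -[gmul _ _]/(gelt k j * gelt k l).
  by rewrite geltM !cyclic_embedE -exprD [RHS]expr_mod_order.
- apply: group_algebra_ind => [j|c x y Hx Hy]; last by rewrite !lfun_lin Hx Hy.
  rewrite cyclic_embedE (grouplike_expr j).1 -[comul (gelt k j)]/(gcomul k _ _) /gcomul gextE tmapE.
  by rewrite cyclic_embedE.
- apply: group_algebra_ind => [j|c x y Hx Hy]; last by rewrite !lfun_lin Hx Hy.
  by rewrite cyclic_embedE (grouplike_expr j).2 -[counit (gelt k j)]/(gcounit k _ _) /gcounit gextE.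
apply: group_algebra_ind => [j|c x y Hx Hy]; last by rewrite !lfun_lin Hx Hy.
rewrite cyclic_embedE antipode_expr -[antipode (gelt k j)]/(gantipode k _ _) /gantipode gextE cyclic_embedE.
by rewrite (modn_small (ltn_ord j)) [RHS]expr_mod_order.
Qed.
Lemma cyclic_embed_sum (x : group_algebra k 'I_m) : psi x = \sum_(j < m) x j *: g ^+ j.
Proof. exact: lfunE. Qed.

Lemma coint_cyclic_embed (x : group_algebra k 'I_m) (j : 'I_m) : lam (psi x * S (g ^+ j)) = (\dim {:H})%:R * x j.
Proof.
rewrite cyclic_embed_sum mulr_suml linear_sum (bigD1 j) //= big1 => [|l /negPf nlj].
  by rewrite addr0 -scalerAl linearZ /= grouplike_mulV ?(coint_expr 0) ?dvdn0; [apply: mulrC|exact: grouplike_expr].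
rewrite -scalerAl linearZ /= antipode_expr -exprD coint_expr modn_small //.
suff /negPf -> : ~~ (m %| l + (m - j))%N by rewrite scaler0.
have [ltl ltj] := (ltn_ord l, ltn_ord j).
have [lt_lj|le_jl] := ltnP l j; first by rewrite gtnNdvd //; lia.
have -> : (l + (m - j) = m + (l - j))%N by lia.
have ne_lj : (l : nat) <> j by move/val_inj/eqP; rewrite nlj.
by rewrite dvdn_addr // gtnNdvd //; lia.
Qed.

Lemma cyclic_embed_inj : injective psi.
Proof.
move=> x y E0; apply/ffunP=> j; apply: (mulfI (dim_neq0 H char0)).
by rewrite -!coint_cyclic_embed E0.
Qed.

Lemma expr_cyclic_embed j : g ^+ j \in limg psi.
Proof.
have -> : g ^+ j = psi (gelt k (inZp j : 'I_m)) by rewrite cyclic_embedE expr_mod_order.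
by rewrite memv_img ?memvf.
Qed.

Lemma central_proj_expr j : pi (g ^+ j) = 1.
Proof.
apply/lfunP=> a; rewrite central_projE -[RHS]/(sub_counit hA a) comp_lfunE -[RHS]/(counit (i a : D)) dual_counitE.
have /invariantP ag : i a \in A by rewrite sub_inclE subvsP.
by elim: j => [|j IHj]; rewrite ?expr0 // exprSr ag.
Qed.

Let coint_A : E lam \in A. Proof. by rewrite memv_img ?memvf. Qed.
Let c : sub_hopf hA := Subvs coint_A.

Let central_proj_coint x : (pi x : dual_hopf (sub_hopf hA)) c = lam (x * u).
Proof. by rewrite central_projE sub_inclE invariant_projE. Qed.

Let one_coint : (1 : dual_hopf (sub_hopf hA)) c = lam u.
Proof. by rewrite -(hopf_map1 central_proj_hopf_map) central_proj_coint mul1r. Qed.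

Let nz_lam_u : lam u != 0.
Proof. by rewrite coint_cyclic_idem mulf_neq0 ?invr_eq0 // (dim_neq0 H char0). Qed.

(** Applying the functional [c] induced by [lam] to the second leg of a coinvariant [h] recovers
    [lam u *: h]. Invariance of [lam] evaluates the other side as a combination of antipodes of
    powers of [g]. *)
Lemma right_coinv_central_proj : right_coinv pi = limg psi.
Proof.
have [Lam intL] := exists_integral ssH.
apply/eqP; rewrite eqEsubv; apply/andP; split; apply/subvP=> h; last first.
  case/memv_imgP=> x _ ->; rewrite cyclic_embed_sum memv_suml // => j _; rewrite memvZ //.
  by apply/right_coinvP; rewrite (grouplike_expr j).1 tmapE id_lfunE central_proj_expr.
move/right_coinvP=> hE.
pose T : 'Hom(tens H B, H) := tlift (fun x b => ((b : dual_hopf (sub_hopf hA)) c : k) *: x).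
have := congr1 T hE; rewrite /T tliftE; last by bil_tac.
rewrite one_coint /tmap lfun_tlift; under eq_tlift => a b.
  rewrite tliftE; last by bil_tac.
  rewrite id_lfunE central_proj_coint -scalerAr mulr_sumr linearZ linear_sum /= -scalerA scaler_suml.
  over.
move=> /esym/(canRL (scalerK nz_lam_u)) ->; rewrite /= swZ !memvZ // tlift_sum memv_suml // => j _.
have -> : \sw_(a, b <- h) ((lam (b * g ^+ j) : k) *: a) = (lam (h * g ^+ j) : k) *: S (g ^+ j).
  rewrite -[RHS]mul1r -[S _]mul1r -scalerAr scalerAl -(sw_cointr char0 ssH intL) sw_mul; last by bil_tac.
  rewrite mul1r (lin_tlift (h := fun z => z * S (g ^+ j))); last by lin_tac.
  apply: eq_tlift => a b; rewrite (sw_grouplike (grouplike_expr j)); last by bil_tac.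
  by rewrite -scalerAl -mulrA (grouplike_mulV (grouplike_expr j)) mulr1.
by rewrite memvZ // antipode_expr expr_cyclic_embed.
Qed.

Lemma left_coinv_central_proj : left_coinv pi = limg psi.
Proof.
have [Lam intL] := exists_integral ssH.
apply/eqP; rewrite eqEsubv; apply/andP; split; apply/subvP=> h; last first.
  case/memv_imgP=> x _ ->; rewrite cyclic_embed_sum memv_suml // => j _; rewrite memvZ //.
  by apply/left_coinvP; rewrite (grouplike_expr j).1 tmapE id_lfunE central_proj_expr.
move/left_coinvP=> hE.
pose T : 'Hom(tens B H, H) := tlift (fun b x => ((b : dual_hopf (sub_hopf hA)) c : k) *: x).
have := congr1 T hE; rewrite /T tliftE; last by bil_tac.
rewrite one_coint /tmap lfun_tlift; under eq_tlift => a b.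
  rewrite tliftE; last by bil_tac.
  rewrite id_lfunE central_proj_coint -scalerAr mulr_sumr linearZ linear_sum /= -scalerA scaler_suml.
  over.
move=> /esym/(canRL (scalerK nz_lam_u)) ->; rewrite /= swZ !memvZ // tlift_sum memv_suml // => j _.
have -> : \sw_(a, b <- h) ((lam (a * g ^+ j) : k) *: b) = (lam (h * g ^+ j) : k) *: S (g ^+ j).
  rewrite -[S _]mul1r scalerAl -(sw_cointl ssH intL) sw_mul; last by bil_tac.
  rewrite (lin_tlift (h := fun z => z * S (g ^+ j))); last by lin_tac.
  apply: eq_tlift => a b; rewrite (sw_grouplike (grouplike_expr j)); last by bil_tac.
  by rewrite -scalerAl -mulrA (grouplike_mulV (grouplike_expr j)) mulr1.
by rewrite memvZ // antipode_expr expr_cyclic_embed.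
Qed.

Lemma central_quotient_semisimple : semisimple_algebra B.
Proof.
exact: semisimple_limg (hopf_mapM central_proj_hopf_map) central_proj_limg ssH.
Qed.

Lemma upper_semisolvable_central_quotient : upper_semisolvable B -> upper_semisolvable H.
Proof.
have hC : hopf_subalgebra (right_coinv pi).
  rewrite right_coinv_central_proj; exact: limg_hopf_subalgebra cyclic_embed_hopf_map.
apply: (UpperStep (hC := hC) central_proj_hopf_map central_proj_limg).
  by rewrite /normal_hopf_map right_coinv_central_proj left_coinv_central_proj.
exists 'I_m; left; apply: (sub_hopf_limg hC cyclic_embed_hopf_map cyclic_embed_inj).
by rewrite right_coinv_central_proj.
Qed.
End CentralQuotient.

(** * Induction on the dimension *)

Lemma upper_semisolvable_dvdn (k : closedFieldType) (char0 : [pchar k] =i pred0) (p q : nat) :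
    prime p -> prime q -> (p ^ 4 < q)%N -> ~~ (p %| q - 1)%N -> ~~ (p %| q + 1)%N ->
  forall H : hopfAlgType k, semisimple_algebra H -> (\dim {:H} %| p ^ 2 * q ^ 2)%N ->
    upper_semisolvable H.
Proof.
move=> p_prime q_prime lt_p4_q pB1 pD1 H.
have [d] := ubnP (\dim {:H}); elim: d H => // d IHd H ltHd ssH dvdH.
have [le1|gt1] := leqP (\dim {:H}) 1.
  apply: UpperBase; apply/eqP; rewrite eqn_leq le1 lt0n dimv_eq0.
  by apply/eqP=> H0; have := memvf (1 : H); rewrite H0 memv0 oner_eq0.
have [g [gg cg ng]] := exists_central_grouplike char0 p_prime q_prime lt_p4_q pB1 pD1 ssH dvdH gt1.
have [m0 m0_gt0 gm0] := grouplike_order gg.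
have ex : exists m, (0 < m)%N && (g ^+ m == 1) by exists m0; rewrite m0_gt0 gm0 eqxx.
case: (ex_minnP ex) => -[|m'] // /eqP gm min_m.
have g_order i : (0 < i < m'.+1)%N -> g ^+ i != 1.
  case/andP=> i0 ltim; apply: contraL ltim => gi.
  by rewrite -leqNgt min_m // i0 gi.
(* The order of [g] is at least 2, so the dimension strictly drops. *)
have m'_gt0 : (0 < m')%N.
  by rewrite lt0n; apply: contra ng => /eqP m'0; rewrite -[g]expr1 -[1%N]/(0.+1) -m'0 gm.
have dimB := dim_central_quotient char0 ssH gg cg gm g_order.
apply: (@upper_semisolvable_central_quotient _ _ char0 ssH _ _ gg cg gm g_order).
apply: IHd; last 1 first.
- by apply: dvdn_trans dvdH; rewrite dimB dvdn_mulr.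
- rewrite -ltnS; apply: leq_trans ltHd; rewrite ltnS dimB ltn_Pmulr //.
  by rewrite lt0n; apply: contraTneq gt1 => B0; rewrite dimB B0.
exact: central_quotient_semisimple.
Qed.

Theorem corollary3p8 (k : closedFieldType) (char0 : [pchar k] =i pred0)
    (p q : nat) (p_prime : prime p) (q_prime : prime q) (lt_p4_q : (p ^ 4 < q)%N)
    (H : hopfAlgType k) (H_semisimple : semisimple_algebra H)
    (dimH : \dim {:H} = (p ^ 2 * q ^ 2)%N)
    (p_ndvd_qB1 : ~~ (p %| q - 1)%N) (p_ndvd_qD1 : ~~ (p %| q + 1)%N) :
  semisolvable H.
Proof.
by left; apply: (upper_semisolvable_dvdn char0 p_prime q_prime); rewrite ?dimH.
Qed.
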